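(* The following are equivalent over $\mathsf{RCA}_0$. (i) $\mathsf{ACA}_0$. (ii) If $Q$ is a wqo, then $\mathcal{A}(\mathcal{P}_{\mathrm f}^\flat(Q))$ is Noetherian. (iii) If $Q$ is a wqo, then $\mathcal{U}(\mathcal{P}_{\mathrm f}^\flat(Q))$ is Noetherian. (iv) If $Q$ is a wqo, then $\mathcal{U}(\mathcal{P}_{\mathrm f}^\sharp(Q))$ is Noetherian. (v) If $Q$ is a wqo, then $\mathcal{U}(\mathcal{P}^\flat(Q))$ is Noetherian. (vi) If $Q$ is a wqo, then $\mathcal{U}(\mathcal{P}^\sharp(Q))$ is Noetherian. (In each of (ii)-(vi), $Q$ is universally quantified over all wqo's.)
   Context: **Systems.** $\mathsf{RCA}_0$ is the usual base theory of second-order arithmetic: the axioms of a discretely ordered commutative semiring with identity for $\mathbb{N}$, $\Sigma^0_1$ induction, and $\Delta^0_1$ comprehension. $\mathsf{ACA}_0$ is $\mathsf{RCA}_0$ plus arithmetical comprehension. All sets are subsets of $\mathbb{N}$, with the usual coding of pairs and finite sets as numbers. All definitions below are made in $\mathsf{RCA}_0$. **Orders.** A quasi-order is a set $Q$ with a reflexive transitive relation $\leq_Q$. It is a well-quasi-order (wqo) if for every $f\colon\mathbb{N}\to Q$ there are $m<n$ with $f(m)\leq_Q f(n)$. For $E\subseteq Q$, $E{\downarrow}=\{q\in Q:(\exists p\in E)(q\leq_Q p)\}$ and $E{\uparrow}=\{q\in Q:(\exists p\in E)(p\leq_Q q)\}$, with $q{\downarrow}=\{q\}{\downarrow}$ and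 $q{\uparrow}=\{q\}{\uparrow}$. (For infinite $E$ membership in these is read as the defining formula.) For a set $Y$, $\mathcal{P}_{\mathrm f}(Y)$ is the set of (codes of) finite subsets of $Y$. For $A,B\subseteq Q$: $A\leq_Q^\flat B$ iff $(\forall a\in A)(\exists b\in B)(a\leq_Q b)$; $A\leq_Q^\sharp B$ iff $(\forall b\in B)(\exists a\in A)(a\leq_Q b)$. $\mathcal{P}_{\mathrm f}^\flat(Q)$ and $\mathcal{P}_{\mathrm f}^\sharp(Q)$ are the quasi-orders $(\mathcal{P}_{\mathrm f}(Q),\leq_Q^\flat)$ and $(\mathcal{P}_{\mathrm f}(Q),\leq_Q^\sharp)$. **Countable second-countable spaces.** Such a space is a triple $(X,(U_i)_{i\in I},k)$ where $X$ is a set, $(U_i)_{i\in I}$ is an indexed sequence of subsets of $X$ and $k\colon X\times I\times I\to I$, such that every $x\in X$ lies in some $U_i$, and if $x\in U_i\cap U_j$ then $x\in U_{k(x,i,j)}\subseteq U_i\cap U_j$. A function $h\colon\mathbb{N}\to\mathcal{P}_{\mathrm f}(I)$ codes the effectively open set $G_h=\bigcup_{n}\bigcup_{i\in h(n)}U_i$ and the effectively closed set $F_h=X\setminus G_h$ (''$x\in G_h$'' abbreviates $(\exists n)(\exists i\in h(n))(x\in U_i)$). A sequence of effectively open (closed) sets is coded by $g\colon\mathbb{N}\times\mathbb{N}\to\mathcal{P}_{\mathrm f}(I)$, the $n$-th set being the one coded by $g(n,\cdot)$. **Alexandroff and upper topologies.** For a quasi-order $R$, $\mathcal{A}(R)$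 is the countable second-countable space $(R,(U_q)_{q\in R},k)$ with $U_q=q{\uparrow}$ and $k(q,p,r)=q$; $\mathcal{U}(R)$ is the countable second-countable space $(R,(V_{\mathbf i})_{\mathbf i\in\mathcal{P}_{\mathrm f}(R)},\ell)$ with $V_{\mathbf i}=R\setminus(\mathbf i{\downarrow})$ and $\ell(q,\mathbf i,\mathbf j)=\mathbf i\cup\mathbf j$. In (ii)-(iv) these are applied to $R=\mathcal{P}_{\mathrm f}^\flat(Q)$ or $R=\mathcal{P}_{\mathrm f}^\sharp(Q)$. **General second-countable spaces.** Such a space is coded by a set $I\subseteq\mathbb{N}$ and formulas $\varphi(X)$ (''$X$ codes a point''), $\Psi_=(X,Y)$ (''$X,Y$ code the same point''), $\Psi_\in(X,i)$ (''the point $X$ is in the basic open set $i$''), satisfying: if $\varphi(X)$ then $\Psi_\in(X,i)$ for some $i\in I$; if $\varphi(X)$, $\Psi_\in(X,i)$, $\Psi_\in(X,j)$ with $i,j\in I$, then there is $k\in I$ with $\Psi_\in(X,k)$ and $\forall Y[\Psi_\in(Y,k)\to(\Psi_\in(Y,i)\wedge\Psi_\in(Y,j))]$; if $\varphi(X)$, $\varphi(Y)$, $\Psi_\in(X,i)$ with $i\in I$ and $\Psi_=(X,Y)$, then $\Psi_\in(Y,i)$. A function $h\colon\mathbb{N}\to\mathcal{P}_{\mathrm f}(I)$ codes the effectively open set $G_h$, where $X\in G_h$ abbreviates $\varphi(X)\wedge(\exists n)(\exists i\in h(n))\Psi_\in(X,i)$, and the effectively closed set $F_h$, where $X\in F_h$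 abbreviates $\varphi(X)\wedge(\forall n)(\forall i\in h(n))\neg\Psi_\in(X,i)$. Sequences are coded by $g\colon\mathbb{N}\times\mathbb{N}\to\mathcal{P}_{\mathrm f}(I)$ as before. For a quasi-order $Q$, the second-countable space $\mathcal{U}(\mathcal{P}^\flat(Q))$ is coded by $I=\mathcal{P}_{\mathrm f}(Q)$, $\varphi(X):= X\subseteq Q$, $\Psi_=(X,Y):= X=Y$, $\Psi_\in(X,\mathbf i):=\mathbf i\subseteq X{\downarrow}$. The second-countable space $\mathcal{U}(\mathcal{P}^\sharp(Q))$ is coded by $I=\mathcal{P}_{\mathrm f}(Q)$, $\varphi(X):= X\subseteq Q$, $\Psi_=(X,Y):= X=Y$, $\Psi_\in(X,\mathbf i):=\mathbf i\cap X{\uparrow}=\emptyset$. **Noetherian.** A (countable or general) second-countable space is Noetherian if for every sequence $(F_n)_{n\in\mathbb{N}}$ of effectively closed sets with $\forall n(F_n\supseteq F_{n+1})$ there is $N$ with $(\forall n>N)(F_n=F_N)$ (inclusions and equalities meaning having the corresponding points). Over $\mathsf{RCA}_0$ this is equivalent to: for every effectively open set $G_h$ there is $N$ such that $G_h$ equals the union of the basic open sets with indices in $\bigcup_{n<N}h(n)$. *)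

(* Defs.v *)
From Stdlib Require Import List Arith.
Import ListNotations.

(** * The language of second-order arithmetic

    Two sorts, numbers and sets, each with its own de Bruijn indices.
    The only set terms are set variables; equality is between numbers. *)

Inductive term : Type :=
| Var (n : nat)
| Zero
| One
| Plus (s t : term)
| Times (s t : term).

Inductive form : Type :=
| EqN (s t : term)
| LtN (s t : term)
| Mem (t : term) (X : nat)
| Bot
| Imp (A B : form)
| AllN (A : form)
| AllS (A : form).

Definition Neg A := Imp A Bot.
Definition And A B := Neg (Imp A (Neg B)).
Definition Or A B := Imp (Neg A) B.
Definition Iff A B := And (Imp A B) (Imp B A).
Definition ExN A := Neg (AllN (Neg A)).
Definition ExS A := Neg (AllS (Neg A)).

Fixpoint subst_term (f : nat -> term) (t : term) : term :=
  match t with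
  | Var n => f n
  | Zero => Zero
  | One => One
  | Plus s t => Plus (subst_term f s) (subst_term f t)
  | Times s t => Times (subst_term f s) (subst_term f t)
  end.

Definition scons {T} (x : T) (f : nat -> T) (n : nat) : T :=
  match n with 0 => x | S n => f n end.

Definition lift_term : term -> term := subst_term (fun n => Var (S n)).

(** Simultaneous substitution of terms for number variables ([f]) and of set
    variables for set variables ([r]). *)
Fixpoint subst (f : nat -> term) (r : nat -> nat) (A : form) : form :=
  match A with
  | EqN s t => EqN (subst_term f s) (subst_term f t)
  | LtN s t => LtN (subst_term f s) (subst_term f t)
  | Mem t X => Mem (subst_term f t) (r X)
  | Bot => Bot
  | Imp A B => Imp (subst f r A) (subst f r B)
  | AllN A => AllN (subst (scons (Var 0) (fun n => lift_term (f n))) r A)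
  | AllS A => AllS (subst f (scons 0 (fun n => S (r n))) A)
  end.

Definition lift_num : form -> form := subst (fun n => Var (S n)) (fun X => X).
Definition lift_set : form -> form := subst Var S.
Definition inst_num (t : term) : form -> form := subst (scons t Var) (fun X => X).
Definition inst_set (X : nat) : form -> form := subst Var (scons X (fun Y => Y)).

(** * Provability in classical two-sorted first-order logic

    [T] is a set of non-logical axioms.  The generalisation rules lift only the
    local hypotheses [G], so free variables of axioms in [T] are parameters,
    read as universally quantified. *)

Definition theory := form -> Prop.

Inductive prv (T : theory) : list form -> form -> Prop :=
| Ax G A : T A -> prv T G A
| Hyp G A : In A G -> prv T G A
| ImpI G A B : prv T (A :: G) B -> prv T G (Imp A B)
| ImpE G A B : prv T G (Imp A B) -> prv T G A -> prv T G B
| Raa G A : prv T (Neg A :: G) Bot -> prv T G A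
| AllNI G A : prv T (map lift_num G) A -> prv T G (AllN A)
| AllNE G A t : prv T G (AllN A) -> prv T G (inst_num t A)
| AllSI G A : prv T (map lift_set G) A -> prv T G (AllS A)
| AllSE G A X : prv T G (AllS A) -> prv T G (inst_set X A)
| EqRefl G t : prv T G (EqN t t)
| EqSubst G A s t : prv T G (EqN s t) -> prv T G (inst_num s A) ->
    prv T G (inst_num t A).

Definition proves (T : theory) (A : form) : Prop := prv T [] A.

Definition join (T U : theory) : theory := fun A => T A \/ U A.

Definition equivalent_over (T : theory) (l : list theory) : Prop :=
  forall U V, In U l -> In V l -> forall A, V A -> proves (join T U) A.

(** * Writing formulas with binders

    A [fml] yields a formula once the numbers of number and set quantifiers in
    whose scope it lies are known; a [num] or [set] likewise yields a term or a
    set variable.  This allows the object-level quantifiers below to bind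
    variables of the metalanguage. *)

Definition num := nat -> term.
Definition set := nat -> nat.
Definition fml := nat -> nat -> form.

Definition closed_form (A : fml) : form := A 0 0.

Declare Scope num_scope.
Delimit Scope num_scope with num.
Bind Scope num_scope with num.
Declare Scope fml_scope.
Delimit Scope fml_scope with fml.
Bind Scope fml_scope with fml.

Definition zero : num := fun _ => Zero.
Definition one : num := fun _ => One.
Definition add (s t : num) : num := fun d => Plus (s d) (t d).
Definition mul (s t : num) : num := fun d => Times (s d) (t d).

Definition eqn (s t : num) : fml := fun d _ => EqN (s d) (t d).
Definition ltn (s t : num) : fml := fun d _ => LtN (s d) (t d).
Definition mem (t : num) (X : set) : fml := fun d e => Mem (t d) (X e).
Definition neg (A : fml) : fml := fun d e => Neg (A d e).
Definition imp (A B : fml) : fml := fun d e => Imp (A d e) (B d e).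
Definition conj (A B : fml) : fml := fun d e => And (A d e) (B d e).
Definition disj (A B : fml) : fml := fun d e => Or (A d e) (B d e).
Definition equ (A B : fml) : fml := fun d e => Iff (A d e) (B d e).
(** The variable bound at depth [d] has index [d' - S d] at depth [d']. *)
Definition alln (F : num -> fml) : fml :=
  fun d e => AllN (F (fun d' => Var (d' - S d)) (S d) e).
Definition exn (F : num -> fml) : fml :=
  fun d e => ExN (F (fun d' => Var (d' - S d)) (S d) e).
Definition alls (F : set -> fml) : fml :=
  fun d e => AllS (F (fun e' => e' - S e) d (S e)).

Notation "0" := zero : num_scope.
Notation "1" := one : num_scope.
Infix "+" := add : num_scope.
Infix "*" := mul : num_scope.
Notation "s === t" := (eqn s%num t%num) (at level 70) : fml_scope.
Notation "s << t" := (ltn s%num t%num) (at level 70) : fml_scope.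
Notation "t 'ein' X" := (mem t%num X) (at level 70) : fml_scope.
Notation "! A" := (neg A) (at level 75, right associativity) : fml_scope.
Notation "A /\ B" := (conj A B) : fml_scope.
Notation "A \/ B" := (disj A B) : fml_scope.
Notation "A ==> B" := (imp A B) (at level 90, right associativity) : fml_scope.
Notation "A <=> B" := (equ A B) (at level 95, no associativity) : fml_scope.
Notation "'ALL' x .. y , A" := (alln (fun x => .. (alln (fun y => A%fml)) ..))
  (at level 200, x binder, y binder, right associativity) : fml_scope.
Notation "'EX' x .. y , A" := (exn (fun x => .. (exn (fun y => A%fml)) ..))
  (at level 200, x binder, y binder, right associativity) : fml_scope.
Notation "'ALLS' X .. Y , A" := (alls (fun X => .. (alls (fun Y => A%fml)) ..))
  (at level 200, X binder, Y binder, right associativity) : fml_scope.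

(** * [RCA0] and [ACA0] *)

Definition semiring_axioms : list fml := ([
  ALL x y z, (x + y) + z === x + (y + z);
  ALL x y, x + y === y + x;
  ALL x y z, (x * y) * z === x * (y * z);
  ALL x y, x * y === y * x;
  ALL x y z, x * (y + z) === x * y + x * z;
  ALL x, x + 0 === x;
  ALL x, x * 0 === 0;
  ALL x, x * 1 === x;
  ALL x y z, x << y ==> y << z ==> x << z;
  ALL x, ! x << x;
  ALL x y, x << y \/ x === y \/ y << x;
  ALL x y z, x << y ==> x + z << y + z;
  ALL x y z, 0 << z ==> x << y ==> x * z << y * z;
  ALL x y, x << y ==> EX z, x + z === y;
  0 << 1;
  ALL x, 0 << x ==> x === 1 \/ 1 << x;
  ALL x, x === 0 \/ 0 << x ])%fml.

(** Bounded existential quantifiers are [Neg (AllN (Imp (LtN _ _) (Neg _)))]. *)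
Inductive Delta0 : form -> Prop :=
| Delta0_EqN s t : Delta0 (EqN s t)
| Delta0_LtN s t : Delta0 (LtN s t)
| Delta0_Mem t X : Delta0 (Mem t X)
| Delta0_Bot : Delta0 Bot
| Delta0_Imp A B : Delta0 A -> Delta0 B -> Delta0 (Imp A B)
| Delta0_All t A : Delta0 A -> Delta0 (AllN (Imp (LtN (Var 0) (lift_term t)) A)).

Definition Sigma1 (A : form) : Prop := exists B, Delta0 B /\ A = ExN B.
Definition Pi1 (A : form) : Prop := exists B, Delta0 B /\ A = AllN B.

Fixpoint arithmetical (A : form) : Prop :=
  match A with
  | Imp A B => arithmetical A /\ arithmetical B
  | AllN A => arithmetical A
  | AllS _ => False
  | _ => True
  end.

(** In both schemes [Var 0] is the distinguished variable of [A]; its other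
    number variables and all its set variables are parameters. *)
Definition induction (A : form) : form :=
  Imp (inst_num Zero A)
    (Imp (AllN (Imp A
       (subst (scons (Plus (Var 0) One) (fun n => Var (S n))) (fun X => X) A)))
    (AllN A)).

Definition comprehension (A : form) : form :=
  ExS (AllN (Iff (Mem (Var 0) 0) (lift_set A))).

Inductive RCA0 : theory :=
| RCA0_basic A : In A semiring_axioms -> RCA0 (closed_form A)
| RCA0_induction A : Sigma1 A -> RCA0 (induction A)
| RCA0_comprehension A B : Sigma1 A -> Pi1 B ->
    RCA0 (Imp (AllN (Iff A B)) (comprehension A)).

Inductive ACA0 : theory :=
| ACA0_RCA0 A : RCA0 A -> ACA0 A
| ACA0_comprehension A : arithmetical A -> ACA0 (comprehension A).

(** * Coding pairs, finite sets and functions *)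

Local Open Scope fml_scope.

Definition npair (x y : num) : num := ((x + y) * (x + y) + x)%num.

Definition triple (x y z : num) : num := npair x (npair y z).

Definition is_triple (c : num) : fml := EX k m n, c === triple k m n.

(** The number (k,(m,n)) represents the set of all [i < k] such that
    [m * (i + 1) + 1] divides [n]. *)
Definition infin (i c : num) : fml :=
  EX k m n, c === triple k m n /\ i << k /\
    EX q, n === (m * (i + 1) + 1) * q.

(** The code of a finite set is the least triple that represents it. *)
Definition fincode (c : num) : fml :=
  is_triple c /\
  ALL b, b << c ==> is_triple b ==> ! ALL i, infin i b <=> infin i c.

Definition class := num -> fml.

Definition univ : class := fun x => x === x.
Definition setc (X : set) : class := fun x => x ein X.
Definition finc (c : num) : class := fun x => infin x c.
Definition prodc (A B : class) : class :=
  fun p => EX x y, p === npair x y /\ A x /\ B y.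

Definition Pfin (Y : class) : class :=
  fun c => fincode c /\ ALL x, infin x c ==> Y x.

Definition is_function (f : set) (A B : class) : fml :=
  (ALL p, p ein f ==> prodc A B p) /\
  (ALL x, A x ==> EX y, npair x y ein f /\
     ALL z, npair x z ein f ==> z === y).

(** * Quasi-orders *)

(** A quasi-order is given by the formulas defining its domain and relation, so
    that these may be sets or, as for the orders on finite subsets, be defined
    from sets. *)
Record qorder := QOrder { dom : class; leq : num -> num -> fml }.

Definition set_qorder (Q L : set) : qorder :=
  QOrder (setc Q) (fun x y => npair x y ein L).

Definition quasi_order (Q L : set) : fml :=
  (ALL p, p ein L ==> prodc (setc Q) (setc Q) p) /\
  (ALL x, x ein Q ==> npair x x ein L) /\
  (ALL x y z, x ein Q ==> y ein Q ==> z ein Q ==>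
     npair x y ein L ==> npair y z ein L ==> npair x z ein L).

Definition wqo (Q L : set) : fml :=
  quasi_order Q L /\
  ALLS f, is_function f univ (setc Q) ==>
    EX m n, m << n /\ EX a b, npair m a ein f /\ npair n b ein f /\
      npair a b ein L.

Definition downc (R : qorder) (E : class) : class :=
  fun q => dom R q /\ EX p, E p /\ leq R q p.
Definition upc (R : qorder) (E : class) : class :=
  fun q => dom R q /\ EX p, E p /\ leq R p q.

Definition Pf_flat (R : qorder) : qorder :=
  QOrder (Pfin (dom R))
    (fun a b => ALL x, infin x a ==> EX y, infin y b /\ leq R x y).

Definition Pf_sharp (R : qorder) : qorder :=
  QOrder (Pfin (dom R))
    (fun a b => ALL y, infin y b ==> EX x, infin x a /\ leq R x y).

(** * Countable second-countable spaces *)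

(** As for quasi-orders, the components are given by their defining formulas;
    for the spaces below these are [Delta^0_1], so [RCA0] proves that the
    corresponding sets exist.  [crefine] does not enter the definition of
    Noetherian, nor does [gequal] below. *)
Record cspace := CSpace {
  cpoint : class;
  cindex : class;
  cbasic : num -> num -> fml;  (** [cbasic x i]: the point [x] is in [U_i] *)
  crefine : num -> num -> num -> num -> fml  (** graph of [k] *)
}.

Definition Alexandroff (R : qorder) : cspace :=
  CSpace (dom R) (dom R) (fun x q => upc R (fun p => p === q) x)
    (fun q _ _ l => l === q).

Definition upper (R : qorder) : cspace :=
  CSpace (dom R) (Pfin (dom R)) (fun x i => dom R x /\ ! downc R (finc i) x)
    (fun _ i j l => fincode l /\ ALL z, infin z l <=> infin z i \/ infin z j).

Definition codes_sequence (I : class) (g : set) : fml :=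
  is_function g (prodc univ univ) (Pfin I).

(** The point [x] is in the [n]-th open set of the sequence coded by [g]. *)
Definition in_copen (X : cspace) (g : set) (n x : num) : fml :=
  cpoint X x /\ EX m c, npair (npair n m) c ein g /\
    EX i, infin i c /\ cbasic X x i.
Definition in_cclosed (X : cspace) (g : set) (n x : num) : fml :=
  cpoint X x /\ ! in_copen X g n x.

Definition cNoetherian (X : cspace) : fml :=
  ALLS g, codes_sequence (cindex X) g ==>
    (ALL n x, in_cclosed X g (n + 1) x ==> in_cclosed X g n x) ==>
    EX N, ALL n, N << n ==>
      ALL x, in_cclosed X g n x <=> in_cclosed X g N x.

(** * General second-countable spaces *)

Record gspace := GSpace {
  gpoint : set -> fml;
  gindex : class;
  gequal : set -> set -> fml;
  gbasic : set -> num -> fml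
}.

Definition in_gclosed (X : gspace) (g : set) (n : num) (P : set) : fml :=
  gpoint X P /\ ALL m c, npair (npair n m) c ein g ==>
    ALL i, infin i c ==> ! gbasic X P i.

Definition gNoetherian (X : gspace) : fml :=
  ALLS g, codes_sequence (gindex X) g ==>
    (ALL n, ALLS P, in_gclosed X g (n + 1) P ==> in_gclosed X g n P) ==>
    EX N, ALL n, N << n ==>
      ALLS P, in_gclosed X g n P <=> in_gclosed X g N P.

Definition subc (A B : class) : fml := ALL x, A x ==> B x.

Definition upper_P_flat (R : qorder) : gspace :=
  GSpace (fun X => subc (setc X) (dom R)) (Pfin (dom R))
    (fun X Y => ALL x, x ein X <=> x ein Y)
    (fun X i => subc (finc i) (downc R (setc X))).

Definition upper_P_sharp (R : qorder) : gspace :=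
  GSpace (fun X => subc (setc X) (dom R)) (Pfin (dom R))
    (fun X Y => ALL x, x ein X <=> x ein Y)
    (fun X i => ! EX x, infin x i /\ upc R (setc X) x).

(** The theory whose only axiom says that [F] holds of every wqo. *)
Definition for_all_wqo (F : qorder -> fml) : theory :=
  fun A => A = closed_form (ALLS Q L, wqo Q L ==> F (set_qorder Q L)).

(* Main.v *)
From Stdlib Require Import List Arith Lia Ring Cantor.
From Stdlib Require Import Classical ClassicalEpsilon FunctionalExtensionality PropExtensionality.
From Stdlib Require Import ssreflect.
Require Import Defs.
Import ListNotations.

(** Provability in [RCA0] is compared by comparing models.  A Henkin-style [completeness]
    theorem for the two-sorted calculus reduces the equivalence to the following: a
    structure that satisfies [RCA0] and one of the six theories satisfies the other five
    ([equivalent_over_models]).  Everything else takes place inside an arbitrary structure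
    [Mo], whose numbers may be nonstandard and whose sets are closed only under
    [Delta^0_1] comprehension.  So whenever induction, recursion or comprehension is used,
    the predicate at hand has to be shown to be definable with low complexity; from
    [Sigma^0_1] induction one first recovers bounding, least elements, codes of finite sets,
    primitive recursion and the pigeonhole principle.  [ACA0] enters as the statement
    [Sigma1Complement], that [Sigma^0_1] predicates are closed under complement.

    From [ACA0] to the Noetherian properties.  The heart is [flat_good]: if [Q] is a wqo,
    then so are its finite subsets with the order [flat_le].  Let [A n] be a bad sequence
    of finite sets, and say that [s] avoids [A n] if no element of [s] is below an element
    of [A n].  Starting with the empty set, let a finite set [s] that avoids infinitely
    many [A n] grow: pick one [A n] that [s] avoids.  By badness each later [A n'] lies
    above not all elements of [A n], and [A n] is finite, so [s] together with one fixed
    element of [A n] still avoids infinitely many of the sets.  The elements so chosen form a bad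
    sequence in [Q].  In each of the five spaces the basic open sets are unions of sets that
    are antitone in an index from such a wqo, and an increasing union of these stops growing
    ([noetherian_of_good]).

    From each Noetherian property to [ACA0].  Suppose that a [Sigma^0_1] class is not a
    set, and let [f] be an injection whose range codes it.  Call a stage [j] dead at [n] if a
    smaller value of [f] appears after [j] up to [n], and true if it never dies; the true
    stages compute the range of [f].  Let [Q] consist of the pairs (j, m) for which [j] still looks
    true at [m], and put (j, m) below a later (j', n) if [j] has died, or if [j = j'] and
    some stage above [j] looks true at both [m] and [n].  A bad sequence in [Q] runs through
    true stages and computes the range, so [Q] is a wqo.  But the finite sets [A m] of all
    (j, m) in [Q] form a bad sequence for [flat_le]: if [j] is the greatest
    stage that looks true at both [m] and [n], then (j, m) is below no element of [A n]
    ([range_or_bad]).  Such a bad sequence refutes each of the five Noetherian properties;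
    the upper topology on the finite subsets with [flat_le] needs a larger wqo, in which
    principal up-sets of [Q] become complements of principal down-sets ([dual_extension]). *)

Open Scope general_if_scope.

(** * Substitution *)

Local Notation up f := (scons (Var 0) (fun n => lift_term (f n))).
Local Notation upr r := (scons 0 (fun n => S (r n))).

Lemma subst_term_comp f g t :
  subst_term g (subst_term f t) = subst_term (fun n => subst_term g (f n)) t.
Proof. by elim: t => //= s -> t ->. Qed.

Lemma subst_term_id t : subst_term Var t = t.
Proof. by elim: t => //= s -> t ->. Qed.

Lemma up_comp f g :
  (fun n => subst_term (up g) (up f n)) = up (fun n => subst_term g (f n)).
Proof.
  apply: functional_extensionality; case=> [//|n] /=.
  by rewrite /lift_term !subst_term_comp.
Qed.

Lemma upr_comp r s : (fun X => (upr s) ((upr r) X)) = upr (fun X => s (r X)).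
Proof. by apply: functional_extensionality; case. Qed.

Lemma subst_comp A : forall f r g s,
  subst g s (subst f r A) = subst (fun n => subst_term g (f n)) (fun X => s (r X)) A.
Proof.
  elim: A => [t u|t u|t X| |A IHA B IHB|A IH|A IH] f r g s //=.
  - by rewrite !subst_term_comp.
  - by rewrite !subst_term_comp.
  - by rewrite subst_term_comp.
  - by rewrite IHA IHB.
  - by rewrite IH up_comp.
  - by rewrite IH upr_comp.
Qed.

Lemma up_id : up Var = Var.
Proof. by apply: functional_extensionality; case. Qed.

Lemma upr_id : upr (fun X => X) = (fun X => X).
Proof. by apply: functional_extensionality; case. Qed.

Lemma subst_id A : subst Var (fun X => X) A = A.
Proof.
  elim: A => [t u|t u|t X| |A IHA B IHB|A IH|A IH] //=.
  - by rewrite !subst_term_id.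
  - by rewrite !subst_term_id.
  - by rewrite subst_term_id.
  - by rewrite IHA IHB.
  - by rewrite up_id IH.
  - by rewrite upr_id IH.
Qed.

Lemma subst_lift_num f r A : subst (up f) r (lift_num A) = lift_num (subst f r A).
Proof. by rewrite /lift_num !subst_comp. Qed.

Lemma subst_lift_set f r A : subst f (upr r) (lift_set A) = lift_set (subst f r A).
Proof.
  rewrite /lift_set !subst_comp /=; congr subst.
  by apply: functional_extensionality => n; rewrite subst_term_id.
Qed.

Lemma inst_num_subst f r t A :
  inst_num t (subst (up f) r A) = subst (scons t f) r A.
Proof.
  rewrite /inst_num subst_comp; congr subst.
  apply: functional_extensionality; case=> [//|n] /=.
  by rewrite /lift_term subst_term_comp /= subst_term_id.
Qed.

Lemma inst_set_subst f r X A :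
  inst_set X (subst f (upr r) A) = subst f (scons X r) A.
Proof.
  rewrite /inst_set subst_comp; congr subst.
  - by apply: functional_extensionality => n; rewrite subst_term_id.
  - by apply: functional_extensionality; case.
Qed.

Lemma subst_inst_num f r t A :
  subst f r (inst_num t A) = inst_num (subst_term f t) (subst (up f) r A).
Proof.
  rewrite inst_num_subst /inst_num subst_comp; congr subst.
  by apply: functional_extensionality; case.
Qed.

Lemma subst_inst_set f r X A :
  subst f r (inst_set X A) = inst_set (r X) (subst f (upr r) A).
Proof.
  rewrite inst_set_subst /inst_set subst_comp; congr subst.
  by apply: functional_extensionality; case.
Qed.

(** ** Free variables *)

Fixpoint term_bound (t : term) : nat :=
  match t with
  | Var n => S n
  | Zero | One => 0
  | Plus s t | Times s t => Nat.max (term_bound s) (term_bound t)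
  end.

Fixpoint num_bound (A : form) : nat :=
  match A with
  | EqN s t | LtN s t => Nat.max (term_bound s) (term_bound t)
  | Mem t _ => term_bound t
  | Bot => 0
  | Imp A B => Nat.max (num_bound A) (num_bound B)
  | AllN A => pred (num_bound A)
  | AllS A => num_bound A
  end.

Fixpoint set_bound (A : form) : nat :=
  match A with
  | EqN _ _ | LtN _ _ | Bot => 0
  | Mem _ X => S X
  | Imp A B => Nat.max (set_bound A) (set_bound B)
  | AllN A => set_bound A
  | AllS A => pred (set_bound A)
  end.

Lemma subst_term_agree f g t : (forall n, n < term_bound t -> f n = g n) ->
  subst_term f t = subst_term g t.
Proof.
  elim: t => [n|||s IHs t IHt|s IHs t IHt] //= H.
  - by apply: H; lia.
  - by rewrite IHs ?IHt // => n Hn; apply: H; lia.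
  - by rewrite IHs ?IHt // => n Hn; apply: H; lia.
Qed.

Lemma subst_agree A : forall f g r s,
  (forall n, n < num_bound A -> f n = g n) ->
  (forall X, X < set_bound A -> r X = s X) -> subst f r A = subst g s A.
Proof.
  elim: A => [t u|t u|t X| |A IHA B IHB|A IH|A IH] f g r s /= Hf Hr //.
  - by rewrite (subst_term_agree f g t) ?(subst_term_agree f g u) // => n Hn; apply: Hf; lia.
  - by rewrite (subst_term_agree f g t) ?(subst_term_agree f g u) // => n Hn; apply: Hf; lia.
  - by rewrite (subst_term_agree f g t) // Hr.
  - by rewrite (IHA f g r s) ?(IHB f g r s) // => n Hn; (apply: Hf || apply: Hr); lia.
  - f_equal; apply: IH => // -[//|n] Hn /=; rewrite Hf //; lia.
  - f_equal; apply: IH => // -[//|X] HX /=; rewrite Hr //; lia.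
Qed.

(** * Completeness *)

Lemma prv_weaken T G A : prv T G A -> forall G', incl G G' -> prv T G' A.
Proof.
  elim=> {G A}.
  - by move=> G A HA G' _; apply: Ax.
  - by move=> G A HA G' HG; apply: Hyp; apply: HG.
  - move=> G A B _ IH G' HG; apply: ImpI; apply: IH.
    by apply: incl_cons; [left|apply: incl_tl].
  - by move=> G A B _ IH1 _ IH2 G' HG; apply: ImpE (IH1 _ HG) (IH2 _ HG).
  - move=> G A _ IH G' HG; apply: Raa; apply: IH.
    by apply: incl_cons; [left|apply: incl_tl].
  - by move=> G A _ IH G' HG; apply: AllNI; apply: IH; apply: incl_map.
  - by move=> G A t _ IH G' HG; apply: AllNE; apply: IH.
  - by move=> G A _ IH G' HG; apply: AllSI; apply: IH; apply: incl_map.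
  - by move=> G A t _ IH G' HG; apply: AllSE; apply: IH.
  - by move=> G t G' HG; apply: EqRefl.
  - by move=> G A s t _ IH1 _ IH2 G' HG; apply: EqSubst (IH1 _ HG) (IH2 _ HG).
Qed.

Definition subst_closed (T : theory) : Prop := forall A f r, T A -> T (subst f r A).

Lemma prv_subst T G A : subst_closed T -> prv T G A ->
  forall f r, prv T (map (subst f r) G) (subst f r A).
Proof.
  move=> HT; elim=> {G A}.
  - by move=> G A HA f r; apply: Ax; apply: HT.
  - by move=> G A HA f r; apply: Hyp; apply: in_map.
  - by move=> G A B _ IH f r; apply: ImpI; apply: IH.
  - by move=> G A B _ IH1 _ IH2 f r; apply: ImpE (IH1 f r) (IH2 f r).
  - by move=> G A _ IH f r; apply: Raa; apply: IH.
  - move=> G A _ IH f r /=; apply: AllNI.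
    move: (IH (up f) r); rewrite !map_map.
    by under map_ext => B do rewrite subst_lift_num.
  - by move=> G A t _ IH f r; rewrite subst_inst_num; apply: AllNE; apply: IH.
  - move=> G A _ IH f r /=; apply: AllSI.
    move: (IH f (upr r)); rewrite !map_map.
    by under map_ext => B do rewrite subst_lift_set.
  - by move=> G A t _ IH f r; rewrite subst_inst_set; apply: AllSE; apply: IH.
  - by move=> G t f r; apply: EqRefl.
  - move=> G A s t _ IH1 _ IH2 f r; rewrite subst_inst_num.
    apply: EqSubst (IH1 f r) _; rewrite -subst_inst_num; exact: IH2.
Qed.

Definition fresh_num (G : list form) : nat := list_max (map num_bound G).
Definition fresh_set (G : list form) : nat := list_max (map set_bound G).

Lemma list_max_le (l : list nat) n : In n l -> n <= list_max l.
Proof. by elim: l => //= a l IH [->|/IH]; lia. Qed.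

(** Generalisation over a variable that occurs neither in the hypotheses nor in the
    formula: the calculus, which has de Bruijn indices, can only generalise the variable 0, so
    the whole derivation is renamed. *)
Lemma gen_num T G A : subst_closed T -> let x := fresh_num (AllN A :: G) in
  prv T G (inst_num (Var x) A) -> prv T G (AllN A).
Proof.
  move=> HT x H; apply: AllNI.
  (* The renaming that sends the fresh variable to the bound one. *)
  pose f n := if Nat.eq_dec n x then Var 0 else Var (S n).
  move: (prv_subst _ _ _ HT H f (fun X => X)).
  have -> : map (subst f (fun X => X)) G = map lift_num G.
    apply: map_ext_in => B HB; apply: subst_agree => // n Hn.
    have : num_bound B <= x.
      by rewrite /x /fresh_num /=; have := list_max_le _ _ (in_map num_bound _ _ HB); lia.
    by rewrite /f; case: Nat.eq_dec => // ?; lia.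
  suff -> : subst f (fun X => X) (inst_num (Var x) A) = A by [].
  rewrite /inst_num subst_comp -[RHS]subst_id; apply: subst_agree => // -[|n] Hn /=.
    by rewrite /f; case: Nat.eq_dec.
  by rewrite /f; case: Nat.eq_dec => // E; move: E; rewrite /x /fresh_num /=; lia.
Qed.

Lemma gen_set T G A : subst_closed T -> let x := fresh_set (AllS A :: G) in
  prv T G (inst_set x A) -> prv T G (AllS A).
Proof.
  move=> HT x H; apply: AllSI.
  pose f n := if Nat.eq_dec n x then 0 else S n.
  move: (prv_subst _ _ _ HT H Var f).
  have -> : map (subst Var f) G = map lift_set G.
    apply: map_ext_in => B HB; apply: subst_agree => // n Hn.
    have : set_bound B <= x.
      by rewrite /x /fresh_set /=; have := list_max_le _ _ (in_map set_bound _ _ HB); lia.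
    by rewrite /f; case: Nat.eq_dec => // ?; lia.
  suff -> : subst Var f (inst_set x A) = A by [].
  rewrite /inst_set subst_comp -[RHS]subst_id; apply: subst_agree => // -[|n] Hn /=.
    by rewrite /f; case: Nat.eq_dec.
  by rewrite /f; case: Nat.eq_dec => // E; move: E; rewrite /x /fresh_set /=; lia.
Qed.

Local Arguments to_nat : simpl never.

(** Formulas are coded by numbers, so that the Henkin construction can treat them
    one at a time. *)
Fixpoint term_code (t : term) : nat :=
  match t with
  | Var n => to_nat (0, n)
  | Zero => to_nat (1, 0)
  | One => to_nat (2, 0)
  | Plus s t => to_nat (3, to_nat (term_code s, term_code t))
  | Times s t => to_nat (4, to_nat (term_code s, term_code t))
  end.

Fixpoint form_code (A : form) : nat :=
  match A with
  | EqN s t => to_nat (0, to_nat (term_code s, term_code t))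
  | LtN s t => to_nat (1, to_nat (term_code s, term_code t))
  | Mem t X => to_nat (2, to_nat (term_code t, X))
  | Bot => to_nat (3, 0)
  | Imp A B => to_nat (4, to_nat (form_code A, form_code B))
  | AllN A => to_nat (5, form_code A)
  | AllS A => to_nat (6, form_code A)
  end.

Ltac code_inj := repeat match goal with
  | H : to_nat _ = to_nat _ |- _ => apply to_nat_inj in H; injection H; clear H; intros
  end.

Lemma term_code_inj s : forall t, term_code s = term_code t -> s = t.
Proof.
  elim: s => [n|||s IHs s' IHs'|s IHs s' IHs'] [m|||t t'|t t'] H; cbn in H; code_inj => //;
  f_equal; auto.
Qed.

Lemma form_code_inj A : forall B, form_code A = form_code B -> A = B.
Proof.
  elim: A => [s s'|s s'|s X| |A IHA A' IHA'|A IHA|A IHA] [t t'|t t'|t Y| |B B'|B|B] H;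
  cbn in H; code_inj => //; f_equal; auto using term_code_inj.
Qed.

(** ** Structures *)

(** Henkin structures, in which [EqN] is equality; two sets with the same elements may
    differ.  The set [sset] only ensures that there is an assignment. *)
Record structure := Structure {
  carrier : Type;
  sets : Type;
  s0 : carrier;
  s1 : carrier;
  splus : carrier -> carrier -> carrier;
  stimes : carrier -> carrier -> carrier;
  slt : carrier -> carrier -> Prop;
  smem : carrier -> sets -> Prop;
  sset : sets
}.

Section Sat.
Variable Mo : structure.

Fixpoint eval (e : nat -> carrier Mo) (t : term) : carrier Mo :=
  match t with
  | Var n => e n
  | Zero => s0 Mo
  | One => s1 Mo
  | Plus s t => splus Mo (eval e s) (eval e t)
  | Times s t => stimes Mo (eval e s) (eval e t)
  end.

Fixpoint sat (e : nat -> carrier Mo) (d : nat -> sets Mo) (A : form) : Prop :=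
  match A with
  | EqN s t => eval e s = eval e t
  | LtN s t => slt Mo (eval e s) (eval e t)
  | Mem t X => smem Mo (eval e t) (d X)
  | Bot => False
  | Imp A B => sat e d A -> sat e d B
  | AllN A => forall x, sat (scons x e) d A
  | AllS A => forall X, sat e (scons X d) A
  end.

Lemma eval_agree e e' t : (forall n, n < term_bound t -> e n = e' n) -> eval e t = eval e' t.
Proof.
  elim: t => [n|||s IHs t IHt|s IHs t IHt] //= H.
  - by apply: H; lia.
  - by rewrite IHs ?IHt // => n Hn; apply: H; lia.
  - by rewrite IHs ?IHt // => n Hn; apply: H; lia.
Qed.

Lemma sat_agree A : forall e e' d, (forall n, n < num_bound A -> e n = e' n) ->
  sat e d A <-> sat e' d A.
Proof.
  elim: A => [t u|t u|t X| |A IHA B IHB|A IH|A IH] e e' d /= H //.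
  - by rewrite (eval_agree e e' t) ?(eval_agree e e' u) // => n Hn; apply: H; lia.
  - by rewrite (eval_agree e e' t) ?(eval_agree e e' u) // => n Hn; apply: H; lia.
  - by rewrite (eval_agree e e' t).
  - by rewrite (IHA e e' d) ?(IHB e e' d) // => n Hn; apply: H; lia.
  - have E x : sat (scons x e) d A <-> sat (scons x e') d A.
      by apply: IH => -[//|n] Hn /=; apply: H; lia.
    by split=> H1 x; move: (H1 x); rewrite E.
  - have E X : sat e (scons X d) A <-> sat e' (scons X d) A by apply: IH.
    by split=> H1 X; move: (H1 X); rewrite E.
Qed.

Lemma eval_subst e f t : eval e (subst_term f t) = eval (fun n => eval e (f n)) t.
Proof. by elim: t => //= s -> t ->. Qed.

Lemma sat_subst A : forall e d f r,
  sat e d (subst f r A) <-> sat (fun n => eval e (f n)) (fun X => d (r X)) A.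
Proof.
  elim: A => [t u|t u|t X| |A IHA B IHB|A IH|A IH] e d f r //=; rewrite ?eval_subst //.
  - by rewrite IHA IHB.
  - split=> H x; move: (H x); rewrite IH.
    + suff -> : (fun n => eval (scons x e) (up f n)) = scons x (fun n => eval e (f n)) by [].
      by apply: functional_extensionality; case=> //= n; rewrite /lift_term eval_subst.
    + suff -> : (fun n => eval (scons x e) (up f n)) = scons x (fun n => eval e (f n)) by [].
      by apply: functional_extensionality; case=> //= n; rewrite /lift_term eval_subst.
  - split=> H x; move: (H x); rewrite IH.
    + suff -> : (fun X => scons x d (upr r X)) = scons x (fun X => d (r X)) by [].
      by apply: functional_extensionality; case.
    + suff -> : (fun X => scons x d (upr r X)) = scons x (fun X => d (r X)) by [].
      by apply: functional_extensionality; case.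
Qed.

End Sat.

Definition models (Mo : structure) (T : theory) : Prop :=
  forall A, T A -> forall e d, sat Mo e d A.

(** ** The Henkin construction *)
Section Henkin.
Variables (T : theory) (A0 : form).
Hypothesis HT : subst_closed T.
Hypothesis HA0 : ~ prv T [] A0.

Definition consistent (G : list form) : Prop := ~ prv T G Bot.

(** The formula [A], when added as the negation of a universal formula, comes with a
    negated instance at a fresh variable.  Variables serve as Henkin constants: at each
    stage only finitely many of them have been used. *)
Definition witness (A : form) (G : list form) : list form :=
  match A with
  | Imp (AllN B) Bot => [Neg (inst_num (Var (fresh_num (AllN B :: A :: G))) B)]
  | Imp (AllS B) Bot => [Neg (inst_set (fresh_set (AllS B :: A :: G)) B)]
  | _ => []
  end.

Definition decoded (n : nat) : form := epsilon (inhabits Bot) (fun A => form_code A = n).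

Fixpoint stage (n : nat) : list form :=
  match n with
  | 0 => [Neg A0]
  | S n => if excluded_middle_informative (consistent (decoded n :: stage n))
           then witness (decoded n) (stage n) ++ decoded n :: stage n
           else stage n
  end.

Definition hmem (A : form) : Prop := exists n, In A (stage n).

Lemma decoded_code A : decoded (form_code A) = A.
Proof.
  apply: form_code_inj; rewrite /decoded.
  by apply: (epsilon_spec (inhabits Bot) (fun B => form_code B = form_code A)); exists A.
Qed.

Lemma neg_of_inconsistent G A : ~ consistent (A :: G) -> prv T G (Neg A).
Proof. by move/NNPP => H; apply: ImpI. Qed.

(** If the witness contradicted the rest, the instance would be derivable for a fresh
    variable, hence also the universal formula whose negation is present. *)
Lemma witness_consistent A G :
  consistent (A :: G) -> consistent (witness A G ++ A :: G).
Proof.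
  case: A => // -[] // B [] //= H H1; apply: H.
  - apply: (ImpE _ _ (AllN B)); first by apply: Hyp; left.
    by apply: gen_num => //; apply: Raa.
  - apply: (ImpE _ _ (AllS B)); first by apply: Hyp; left.
    by apply: gen_set => //; apply: Raa.
Qed.

Lemma stage_consistent n : consistent (stage n).
Proof.
  elim: n => [|n IH] /=.
    by move=> H; apply: HA0; apply: Raa.
  case: excluded_middle_informative => // H.
  exact: witness_consistent.
Qed.

Lemma stage_mono n m : n <= m -> incl (stage n) (stage m).
Proof.
  elim: m => [|m IH] Hn; first by have -> : n = 0 by lia.
  case: (Nat.eq_dec n (S m)) => [-> //|Hne].
  apply: (incl_tran (IH _)); first lia.
  move=> /=; case: excluded_middle_informative => // _.
  by apply: incl_appr; apply: incl_tl.
Qed.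

Lemma hmem_prv n A : prv T (stage n) A -> hmem A.
Proof.
  move=> H; pose m := form_code A.
  case: (classic (consistent (A :: stage m))) => Hc.
    exists (S m) => /=; rewrite decoded_code.
    by case: excluded_middle_informative => // _; apply: in_or_app; right; left.
  have HN := neg_of_inconsistent _ _ Hc.
  case: (stage_consistent (Nat.max n m)).
  apply: (ImpE _ _ A); apply: prv_weaken.
  - exact: HN.
  - by apply: stage_mono; lia.
  - exact: H.
  - by apply: stage_mono; lia.
Qed.

Lemma hmem_common A B : hmem A -> hmem B -> exists n, In A (stage n) /\ In B (stage n).
Proof.
  move=> [n Hn] [m Hm]; exists (Nat.max n m).
  by split; [apply: (stage_mono n)|apply: (stage_mono m)] => //; lia.
Qed.

Lemma hmem_bot : ~ hmem Bot.
Proof. by move=> [n Hn]; apply: (stage_consistent n); apply: Hyp. Qed.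

Lemma hmem_imp A B : hmem (Imp A B) <-> (hmem A -> hmem B).
Proof.
  split.
    move=> HAB HA; case: (hmem_common _ _ HAB HA) => n [H1 H2].
    by apply: (hmem_prv n); apply: (ImpE _ _ A); apply: Hyp.
  move=> H; case: (classic (hmem A)) => [/H [n HB]|HA].
    apply: (hmem_prv n); apply: ImpI; apply: Hyp; by right.
  apply: (hmem_prv (form_code A)); apply: ImpI; apply: Raa.
  apply: (ImpE _ _ A); last by apply: Hyp; right; left.
  apply: (prv_weaken _ (stage (form_code A))); last by do 2 apply: incl_tl.
  apply: neg_of_inconsistent => Hc; apply: HA; exists (S (form_code A)) => /=.
  rewrite decoded_code.
  by case: excluded_middle_informative => // _; apply: in_or_app; right; left.
Qed.

Lemma hmem_neg A : ~ hmem A -> hmem (Neg A).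
Proof. by move=> H; apply/hmem_imp. Qed.

Lemma hmem_witness A B : hmem A -> In B (witness A (stage (form_code A))) -> hmem B.
Proof.
  move=> [n Hn] HB; exists (S (form_code A)) => /=; rewrite decoded_code.
  case: excluded_middle_informative => [_|Hc].
    by apply: in_or_app; left.
  have HN := neg_of_inconsistent _ _ Hc.
  case: (stage_consistent (Nat.max n (form_code A))).
  apply: (ImpE _ _ A); first by apply: prv_weaken HN _ _; apply: stage_mono; lia.
  by apply: Hyp; apply: (stage_mono n) => //; lia.
Qed.

Lemma hmem_alln A : hmem (AllN A) <-> forall t, hmem (inst_num t A).
Proof.
  split=> [[n Hn] t|H].
    by apply: (hmem_prv n); apply: AllNE; apply: Hyp.
  apply: NNPP => Hn; have HN := hmem_neg _ Hn.
  have HW := hmem_witness _ _ HN (or_introl eq_refl).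
  by apply: hmem_bot; move/hmem_imp: HW; apply; apply: H.
Qed.

Lemma hmem_alls A : hmem (AllS A) <-> forall X, hmem (inst_set X A).
Proof.
  split=> [[n Hn] t|H].
    by apply: (hmem_prv n); apply: AllSE; apply: Hyp.
  apply: NNPP => Hn; have HN := hmem_neg _ Hn.
  have HW := hmem_witness _ _ HN (or_introl eq_refl).
  by apply: hmem_bot; move/hmem_imp: HW; apply; apply: H.
Qed.

Lemma hmem_refl t : hmem (EqN t t).
Proof. by apply: (hmem_prv 0); apply: EqRefl. Qed.

Lemma hmem_rewrite s t A : hmem (EqN s t) -> hmem (inst_num s A) -> hmem (inst_num t A).
Proof.
  move=> H1 H2; case: (hmem_common _ _ H1 H2) => n [? ?].
  by apply: (hmem_prv n); apply: EqSubst; apply: Hyp; eassumption.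
Qed.

Lemma inst_lift t u : subst_term (scons t Var) (lift_term u) = u.
Proof. by rewrite /lift_term subst_term_comp subst_term_id. Qed.

Lemma hmem_sym s t : hmem (EqN s t) -> hmem (EqN t s).
Proof.
  move=> H; have := hmem_rewrite _ _ (EqN (Var 0) (lift_term s)) H.
  by rewrite /inst_num /= !inst_lift; apply; apply: hmem_refl.
Qed.

Lemma hmem_trans s t u : hmem (EqN s t) -> hmem (EqN t u) -> hmem (EqN s u).
Proof.
  move=> H1 H2; have := hmem_rewrite _ _ (EqN (lift_term s) (Var 0)) H2.
  by rewrite /inst_num /= !inst_lift; apply.
Qed.

(** Equality has to be read as equality, so the points are not terms but chosen
    representatives of the classes of provably equal terms. *)
Definition rep (t : term) : term := epsilon (inhabits Zero) (fun s => hmem (EqN t s)).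

Lemma rep_eq t : hmem (EqN t (rep t)).
Proof.
  apply: (epsilon_spec (inhabits Zero) (fun s => hmem (EqN t s))).
  exists t; exact: hmem_refl.
Qed.

Lemma rep_unique s t : hmem (EqN s t) -> rep s = rep t.
Proof.
  move=> H; rewrite /rep; congr epsilon; apply: functional_extensionality => u.
  apply: propositional_extensionality; split=> H'.
    exact: hmem_trans (hmem_sym _ _ H) H'.
  exact: hmem_trans H H'.
Qed.

Definition hcarrier : Type := {t | rep t = t}.

Definition hclass (t : term) : hcarrier :=
  exist _ (rep t) (eq_sym (rep_unique _ _ (rep_eq t))).

Lemma hclass_eq s t : hclass s = hclass t <-> hmem (EqN s t).
Proof.
  split=> [[E]|H].
    by apply: hmem_trans (rep_eq s) _; rewrite E; apply: hmem_sym; apply: rep_eq.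
  have E := rep_unique _ _ H; rewrite /hclass.
  by move: (eq_sym _) (eq_sym _); rewrite E => p q; rewrite (proof_irrelevance _ p q).
Qed.

Lemma hclass_proj x : hclass (proj1_sig x) = x.
Proof.
  case: x => t Ht; rewrite /hclass /=.
  by move: (eq_sym _); rewrite Ht => p; rewrite (proof_irrelevance _ p Ht).
Qed.

Definition hstructure : structure := {|
  carrier := hcarrier; sets := nat;
  s0 := hclass Zero; s1 := hclass One;
  splus := fun x y => hclass (Plus (proj1_sig x) (proj1_sig y));
  stimes := fun x y => hclass (Times (proj1_sig x) (proj1_sig y));
  slt := fun x y => hmem (LtN (proj1_sig x) (proj1_sig y));
  smem := fun x X => hmem (Mem (proj1_sig x) X);
  sset := 0 |}.

(** Operations and relations of the structure are defined on representatives; this and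
    [hmem_rel] show that any other terms of the classes would do. *)
Lemma hclass_op (F : term -> term -> term) :
  (forall a s t, subst_term a (F s t) = F (subst_term a s) (subst_term a t)) ->
  forall s t, hclass (F (rep s) (rep t)) = hclass (F s t).
Proof.
  move=> HF s t; apply/hclass_eq.
  have := hmem_rewrite _ _ (EqN (F (Var 0) (lift_term (rep t))) (lift_term (F s t)))
    (rep_eq s).
  rewrite /inst_num /= !HF !inst_lift /=; apply.
  have := hmem_rewrite _ _ (EqN (F (lift_term s) (Var 0)) (lift_term (F s t))) (rep_eq t).
  rewrite /inst_num /= !HF !inst_lift /=; apply; exact: hmem_refl.
Qed.

Lemma heval f t : eval hstructure (fun n => hclass (f n)) t = hclass (subst_term f t).
Proof.
  elim: t => [n|||s IHs t IHt|s IHs t IHt] //=; rewrite IHs IHt /=.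
    exact: (hclass_op Plus).
  exact: (hclass_op Times).
Qed.

Lemma hmem_rel (F : term -> term -> form) :
  (forall a s t, subst a (fun X => X) (F s t) = F (subst_term a s) (subst_term a t)) ->
  forall s t, hmem (F (rep s) (rep t)) <-> hmem (F s t).
Proof.
  move=> HF.
  have step s s' t t' : hmem (EqN s s') -> hmem (EqN t t') -> hmem (F s t) -> hmem (F s' t').
    move=> Hs Ht H.
    have := hmem_rewrite _ _ (F (Var 0) (lift_term t')) Hs.
    rewrite /inst_num !HF !inst_lift; apply=> /=.
    have := hmem_rewrite _ _ (F (lift_term s) (Var 0)) Ht.
    by rewrite /inst_num !HF !inst_lift; apply.
  move=> s t; split; apply: step; try exact: rep_eq; apply: hmem_sym; exact: rep_eq.
Qed.

Lemma truth A : forall f r,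
  sat hstructure (fun n => hclass (f n)) r A <-> hmem (subst f r A).
Proof.
  elim: A => [t u|t u|t X| |A IHA B IHB|A IH|A IH] f r /=.
  - by rewrite !heval hclass_eq.
  - by rewrite !heval /=; apply: (hmem_rel LtN).
  - rewrite heval /=; exact: (hmem_rel (fun s _ => Mem s (r X)) _ _ Zero).
  - by split=> // /hmem_bot.
  - by rewrite IHA IHB hmem_imp.
  - rewrite hmem_alln; split=> H.
      move=> t; rewrite inst_num_subst -IH; move: (H (hclass t)).
      suff -> : scons (hclass t) (fun n => hclass (f n)) =
        (fun n => hclass (scons t f n)) by [].
      by apply: functional_extensionality; case.
    move=> x; move: (H (proj1_sig x)); rewrite inst_num_subst -IH.
    suff -> : (fun n => hclass (scons (proj1_sig x) f n)) =
      scons x (fun n => hclass (f n)) by [].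
    by apply: functional_extensionality; case=> //=; apply: hclass_proj.
  - rewrite hmem_alls; split=> H X.
      by rewrite inst_set_subst -IH; apply: H.
    by move: (H X); rewrite inst_set_subst -IH.
Qed.

Lemma hstructure_models : models hstructure T.
Proof.
  move=> A HA e d.
  have -> : e = (fun n => hclass (proj1_sig (e n))).
    by apply: functional_extensionality => n; rewrite hclass_proj.
  apply/truth; apply: (hmem_prv 0); apply: Ax; exact: HT.
Qed.

Lemma hstructure_refutes : ~ sat hstructure (fun n => hclass (Var n)) (fun X => X) A0.
Proof.
  move/truth; rewrite subst_id => H; apply: hmem_bot.
  have HN : hmem (Neg A0) by exists 0; left.
  by move/hmem_imp: HN; apply.
Qed.

End Henkin.

(** The theory must contain the substitution instances of its axioms, because the free
    variables of axioms are parameters. *)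
Theorem completeness T A : subst_closed T ->
  (forall Mo, models Mo T -> forall e d, sat Mo e d A) -> proves T A.
Proof.
  move=> HT H; apply: NNPP => HA.
  apply: (hstructure_refutes T A HT HA); apply: H; exact: hstructure_models.
Qed.


(** * Substitution instances of the axioms *)

Lemma lift_term_subst f t : subst_term (up f) (lift_term t) = lift_term (subst_term f t).
Proof. by rewrite /lift_term !subst_term_comp. Qed.

Lemma Delta0_subst A : Delta0 A -> forall f r, Delta0 (subst f r A).
Proof.
  elim=> {A} /=; try by intros; constructor.
  by move=> t A _ IH f r; rewrite lift_term_subst; constructor.
Qed.

Lemma Sigma1_subst A f r : Sigma1 A -> Sigma1 (subst f r A).
Proof. by move=> [B [HB ->]]; exists (subst (up f) r B); split; [apply: Delta0_subst|]. Qed.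

Lemma Pi1_subst A f r : Pi1 A -> Pi1 (subst f r A).
Proof. by move=> [B [HB ->]]; exists (subst (up f) r B); split; [apply: Delta0_subst|]. Qed.

Lemma arithmetical_subst A : arithmetical A -> forall f r, arithmetical (subst f r A).
Proof.
  elim: A => //= [A IHA B IHB [/IHA HA /IHB HB] f r|A IHA /IHA HA f r]; first by split.
  exact: HA.
Qed.

Lemma subst_induction f r A : subst f r (induction A) = induction (subst (up f) r A).
Proof.
  rewrite /induction /= !subst_inst_num /= !subst_comp.
  suff -> : (fun n => subst_term (up f) (scons (Plus (Var 0) One) (fun n => Var (S n)) n)) =
    (fun n => subst_term (scons (Plus (Var 0) One) (fun n => Var (S n))) (up f n)) by [].
  apply: functional_extensionality; case=> //= n.
  by rewrite /lift_term subst_term_comp.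
Qed.

Lemma subst_comprehension f r A :
  subst f r (comprehension A) = comprehension (subst (up f) r A).
Proof. by rewrite /comprehension /= !subst_lift_set. Qed.

Lemma RCA0_subst_closed : subst_closed RCA0.
Proof.
  move=> A f r [{}A HA|{}A HA|{}A B HA HB].
  - have -> : subst f r (closed_form A) = closed_form A; last by constructor.
    by move: HA; rewrite /semiring_axioms /=; intuition; subst A.
  - by rewrite subst_induction; constructor; apply: Sigma1_subst.
  - change (RCA0 (Imp (AllN (Iff (subst (up f) r A) (subst (up f) r B)))
      (subst f r (comprehension A)))).
    rewrite subst_comprehension; constructor; first exact: Sigma1_subst.
    exact: Pi1_subst.
Qed.

Lemma ACA0_subst_closed : subst_closed ACA0.
Proof.
  move=> A f r [{}A HA|{}A HA].
    by constructor; apply: RCA0_subst_closed.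
  by rewrite subst_comprehension; apply: ACA0_comprehension; apply: arithmetical_subst.
Qed.

Lemma closed_subst_closed F :
  (forall f r, subst f r (closed_form (ALLS Q L, wqo Q L ==> F (set_qorder Q L))) =
     closed_form (ALLS Q L, wqo Q L ==> F (set_qorder Q L)))%fml ->
  subst_closed (for_all_wqo F).
Proof. by move=> H A f r ->; rewrite /for_all_wqo H. Qed.

Lemma join_subst_closed T U : subst_closed T -> subst_closed U -> subst_closed (join T U).
Proof. by move=> HT HU A f r [/HT|/HU] H; [left|right]. Qed.

Lemma equivalent_over_models T l : subst_closed T -> (forall U, In U l -> subst_closed U) ->
  (forall Mo, models Mo T -> forall U V, In U l -> In V l -> models Mo U -> models Mo V) ->
  equivalent_over T l.
Proof.
  move=> HT Hl H U V HU HV A HA; apply: completeness.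
    by apply: join_subst_closed => //; apply: Hl.
  move=> Mo HM; apply: (H Mo _ U V) => // B HB; apply: HM; first by left.
  by right.
Qed.

(** * Reading formulas *)

Section Sat2.
Variable Mo : structure.

(** The connectives other than implication and universal quantification are defined, by
    double negations.  [reading] recognises them, so that the truth of a concrete
    formula becomes by mere conversion a statement of ordinary mathematics.  An implication whose
    premise is a negation is not read as a disjunction: this would misread premises
    that are conjunctions or existential. The negated universal conjunction comes before
    the existential quantifier, since a conjunction is itself a negation. *)
Definition read_step
  (S : form -> (nat -> carrier Mo) -> (nat -> sets Mo) -> Prop)
  (A : form) (e : nat -> carrier Mo) (d : nat -> sets Mo) : Prop :=
  match A with
  | EqN s t => eval Mo e s = eval Mo e t
  | LtN s t => slt Mo (eval Mo e s) (eval Mo e t)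
  | Mem t X => smem Mo (eval Mo e t) (d X)
  | Bot => False
  | Imp (AllN (Imp (Imp A (Imp B Bot)) Bot)) Bot =>
      ~ forall x, S A (scons x e) d /\ S B (scons x e) d
  | Imp (AllN (Imp A Bot)) Bot => exists x, S A (scons x e) d
  | Imp (AllS (Imp A Bot)) Bot => exists X, S A e (scons X d)
  | Imp (Imp A (Imp B Bot)) Bot => S A e d /\ S B e d
  | Imp A Bot => ~ S A e d
  | Imp A B => S A e d -> S B e d
  | AllN A => forall x, S A (scons x e) d
  | AllS A => forall X, S A e (scons X d)
  end.

Fixpoint reading (A : form) : (nat -> carrier Mo) -> (nat -> sets Mo) -> Prop :=
  read_step reading A.

Fixpoint form_size (A : form) : nat :=
  match A with
  | Imp A B => S (form_size A + form_size B)
  | AllN A | AllS A => S (form_size A)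
  | _ => 0
  end.

Lemma reading_eq A e d : reading A e d = read_step reading A e d.
Proof. by case: A. Qed.

(** The two readings agree by classical logic, one layer of connectives at a time. *)
Lemma read_step_sat A e d : read_step (fun A e d => sat Mo e d A) A e d <-> sat Mo e d A.
Proof.
  have ex_neg (T : Type) (P : T -> Prop) : (exists x, P x) <-> ((forall x, P x -> False) -> False).
    split; first by move=> [x Hx] H; apply: H Hx.
    by move=> H; apply: NNPP => Hn; apply: H => x Hx; apply: Hn; exists x.
  have or_neg (P Q : Prop) : P \/ Q <-> ((P -> False) -> Q).
    by case: (classic P); tauto.
  have and_neg (P Q : Prop) : P /\ Q <-> ((P -> Q -> False) -> False).
    by case: (classic P); case: (classic Q); tauto.
  case: A => //= A B.
  case: A => [s t|s t|t X||A1 A2|A|A]; case: B => [s' t'|s' t'|t' X'||B1 B2|B|B] //=.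
  all: repeat match goal with
    | |- context [match ?X with _ => _ end] => is_var X; destruct X; cbn [read_step]
    end; try reflexivity; try (rewrite ex_neg; reflexivity);
    cbn [sat]; first [exact: or_neg|exact: and_neg|
      by split=> H H1; apply: H => x; apply/and_neg; exact: H1].
Qed.

Lemma reading_sat_size n : forall A, form_size A < n -> forall e d,
  reading A e d <-> sat Mo e d A.
Proof.
  elim: n => [|n IH] A HA e d; first lia.
  rewrite reading_eq -read_step_sat.
  have IHe B : form_size B < form_size A -> forall e d, reading B e d = sat Mo e d B.
    by move=> HB e' d'; apply: propositional_extensionality; apply: IH; lia.
  case: A IHe {HA} => //= [A B|A|A] IHe.
  - destruct A, B; cbn [read_step];
    repeat match goal with
    | |- context [match ?X with _ => _ end] => is_var X; destruct X; cbn [read_step]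
    end; rewrite ?IHe; cbn [form_size]; try lia; try reflexivity.
    all: try by split; move=> [x Hx]; exists x; move: Hx; rewrite IHe //=; lia.
    by split=> H H1; apply: H => x; move: (H1 x); rewrite !IHe //=; lia.
  - by split=> H x; move: (H x); rewrite IHe.
  - by split=> H x; move: (H x); rewrite IHe.
Qed.

Theorem reading_sat A e d : reading A e d <-> sat Mo e d A.
Proof. exact: (reading_sat_size (S (form_size A))). Qed.

End Sat2.


(** * The theories in a structure *)
Declare Scope model_scope.
Delimit Scope model_scope with M.
Notation "x + y" := (splus _ x y) : model_scope.
Notation "x * y" := (stimes _ x y) : model_scope.
Notation "x < y" := (slt _ x y) : model_scope.
Notation "0" := (s0 _) : model_scope.
Notation "1" := (s1 _) : model_scope.
Notation "x 'in' X" := (smem _ x X) (at level 70) : model_scope.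
Bind Scope model_scope with carrier.

Section Meaning.
Variable Mo : structure.
Local Notation M := (carrier Mo).
Local Open Scope model_scope.

(** These definitions transcribe the coding of pairs, finite sets, functions, orders and
    spaces into statements about a structure, closely enough for the lemmas at
    the end of the section to hold by conversion. *)
Definition pair (x y : M) : M := (x + y) * (x + y) + x.
Definition istriple (c : M) : Prop := exists k m n, c = pair k (pair m n).
Definition elt (i c : M) : Prop :=
  exists k m n, c = pair k (pair m n) /\ i < k /\ exists q, n = (m * (i + 1) + 1) * q.
Definition fincoded (c : M) : Prop :=
  istriple c /\ forall b, b < c -> istriple b -> ~ forall i, elt i b <-> elt i c.
Definition prodcl (A B : M -> Prop) (p : M) : Prop :=
  exists x y, p = pair x y /\ A x /\ B y.
Definition pfin (Y : M -> Prop) (c : M) : Prop := fincoded c /\ forall x, elt x c -> Y x.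
Definition univcl (x : M) : Prop := x = x.
Definition isfun (f : sets Mo) (A B : M -> Prop) : Prop :=
  (forall p, p in f -> prodcl A B p) /\
  (forall x, A x -> exists y, pair x y in f /\ forall z, pair x z in f -> z = y).

Record order := Order { odom : M -> Prop; ole : M -> M -> Prop }.
Definition setorder (Q L : sets Mo) : order :=
  Order (fun x => x in Q) (fun x y => pair x y in L).
Definition quasiorder (Q L : sets Mo) : Prop :=
  (forall p, p in L -> prodcl (fun x => x in Q) (fun x => x in Q) p) /\
  (forall x, x in Q -> pair x x in L) /\
  (forall x y z, x in Q -> y in Q -> z in Q -> pair x y in L -> pair y z in L ->
     pair x z in L).
Definition iswqo (Q L : sets Mo) : Prop :=
  quasiorder Q L /\
  forall f, isfun f univcl (fun x => x in Q) ->
    exists m n, m < n /\ exists a b, pair m a in f /\ pair n b in f /\ pair a b in L.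

Definition downward (R : order) (E : M -> Prop) (q : M) : Prop :=
  odom R q /\ exists p, E p /\ ole R q p.
Definition upward (R : order) (E : M -> Prop) (q : M) : Prop :=
  odom R q /\ exists p, E p /\ ole R p q.
Definition flat (R : order) : order :=
  Order (pfin (odom R)) (fun a b => forall x, elt x a -> exists y, elt y b /\ ole R x y).
Definition sharp (R : order) : order :=
  Order (pfin (odom R)) (fun a b => forall y, elt y b -> exists x, elt x a /\ ole R x y).

Definition incopen (point : M -> Prop) (basic : M -> M -> Prop) (g : sets Mo) (n x : M) :=
  point x /\ exists m c, pair (pair n m) c in g /\ exists i, elt i c /\ basic x i.
Definition incclosed point basic g n x := point x /\ ~ incopen point basic g n x.
Definition cnoetherian (point index : M -> Prop) (basic : M -> M -> Prop) : Prop :=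
  forall g, isfun g (prodcl univcl univcl) (pfin index) ->
    (forall n x, incclosed point basic g (n + 1) x -> incclosed point basic g n x) ->
    exists N, forall n, N < n -> forall x,
      incclosed point basic g n x <-> incclosed point basic g N x.

Definition ingclosed {P : Type} (point : P -> Prop) (basic : P -> M -> Prop)
  (g : sets Mo) (n : M) (p : P) :=
  point p /\ forall m c, pair (pair n m) c in g -> forall i, elt i c -> ~ basic p i.
Definition noetherian {P : Type} (point : P -> Prop) (index : M -> Prop)
    (basic : P -> M -> Prop) : Prop :=
  forall g, isfun g (prodcl univcl univcl) (pfin index) ->
    (forall n x, ingclosed point basic g (n + 1) x -> ingclosed point basic g n x) ->
    exists N, forall n, N < n -> forall x,
      ingclosed point basic g n x <-> ingclosed point basic g N x.

Definition alex_noetherian (R : order) : Prop :=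
  cnoetherian (odom R) (odom R) (fun x q => upward R (fun p => p = q) x).
Definition upper_noetherian (R : order) : Prop :=
  cnoetherian (odom R) (pfin (odom R)) (fun x i => odom R x /\ ~ downward R (fun z => elt z i) x).
Definition flat_noetherian (R : order) : Prop :=
  noetherian (fun X : sets Mo => forall x, x in X -> odom R x) (pfin (odom R))
    (fun X i => forall x, elt x i -> downward R (fun z => z in X) x).
Definition sharp_noetherian (R : order) : Prop :=
  noetherian (fun X : sets Mo => forall x, x in X -> odom R x) (pfin (odom R))
    (fun X i => ~ exists x, elt x i /\ upward R (fun z => z in X) x).

Variables (e : nat -> M) (d : nat -> sets Mo).

(* Conversion is left to the kernel: unification does not find these equalities. *)
Ltac meaning := rewrite -reading_sat; match goal with |- _ <-> ?B => exact_no_check (iff_refl B) end.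

Lemma sat_alex : sat Mo e d (closed_form (ALLS Q L, wqo Q L ==> cNoetherian (Alexandroff (Pf_flat (set_qorder Q L))))%fml) <-> forall Q L, iswqo Q L -> alex_noetherian (flat (setorder Q L)).
Proof. meaning. Qed.
Lemma sat_upper_flat : sat Mo e d (closed_form (ALLS Q L, wqo Q L ==> cNoetherian (upper (Pf_flat (set_qorder Q L))))%fml) <-> forall Q L, iswqo Q L -> upper_noetherian (flat (setorder Q L)).
Proof. meaning. Qed.
Lemma sat_upper_sharp : sat Mo e d (closed_form (ALLS Q L, wqo Q L ==> cNoetherian (upper (Pf_sharp (set_qorder Q L))))%fml) <-> forall Q L, iswqo Q L -> upper_noetherian (sharp (setorder Q L)).
Proof. meaning. Qed.
Lemma sat_upper_P_flat : sat Mo e d (closed_form (ALLS Q L, wqo Q L ==> gNoetherian (upper_P_flat (set_qorder Q L)))%fml) <-> forall Q L, iswqo Q L -> flat_noetherian (setorder Q L).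
Proof. meaning. Qed.
Lemma sat_upper_P_sharp : sat Mo e d (closed_form (ALLS Q L, wqo Q L ==> gNoetherian (upper_P_sharp (set_qorder Q L)))%fml) <-> forall Q L, iswqo Q L -> sharp_noetherian (setorder Q L).
Proof. meaning. Qed.
End Meaning.


(** * Arithmetic in a model of [RCA0] *)
Section Arithmetic.
Variable Mo : structure.
Hypothesis HM : models Mo RCA0.
Notation M := (carrier Mo).
Open Scope model_scope.

Lemma basic_axiom A : In A semiring_axioms ->
  reading Mo (closed_form A) (fun _ => 0) (fun _ => sset Mo).
Proof. by move=> H; apply/reading_sat; apply: HM; constructor. Qed.

Ltac axiom n := pose proof (basic_axiom (nth n semiring_axioms (fun _ _ => Bot))
  ltac:(apply: nth_In; cbn; lia)) as H; exact H.

Lemma addA (x y z : M) : (x + y) + z = x + (y + z).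
Proof. revert x y z; axiom 0%nat. Qed.
Lemma addC (x y : M) : x + y = y + x.
Proof. revert x y; axiom 1%nat. Qed.
Lemma mulA (x y z : M) : (x * y) * z = x * (y * z).
Proof. revert x y z; axiom 2%nat. Qed.
Lemma mulC (x y : M) : x * y = y * x.
Proof. revert x y; axiom 3%nat. Qed.
Lemma mulD (x y z : M) : x * (y + z) = x * y + x * z.
Proof. revert x y z; axiom 4%nat. Qed.
Lemma add0 (x : M) : x + 0 = x.
Proof. revert x; axiom 5%nat. Qed.
Lemma mul0 (x : M) : x * 0 = 0.
Proof. revert x; axiom 6%nat. Qed.
Lemma mul1 (x : M) : x * 1 = x.
Proof. revert x; axiom 7%nat. Qed.
Lemma lt_trans (y x z : M) : x < y -> y < z -> x < z.
Proof. revert x y z; axiom 8%nat. Qed.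
Lemma lt_irrefl (x : M) : ~ x < x.
Proof. revert x; axiom 9%nat. Qed.
Lemma lt_total' (x y : M) : ~ x < y -> ~ x = y -> y < x.
Proof. revert x y; axiom 10%nat. Qed.
Lemma lt_add_r (x y z : M) : x < y -> x + z < y + z.
Proof. revert x y z; axiom 11%nat. Qed.
Lemma lt_mul_r (x y z : M) : 0 < z -> x < y -> x * z < y * z.
Proof. revert x y z; axiom 12%nat. Qed.
Lemma lt_sub (x y : M) : x < y -> exists z, x + z = y.
Proof. revert x y; axiom 13%nat. Qed.
Lemma lt_0_1 : (0 : M) < 1.
Proof. axiom 14%nat. Qed.
Lemma discrete' (x : M) : 0 < x -> ~ x = 1 -> 1 < x.
Proof. revert x; axiom 15%nat. Qed.
Lemma pos' (x : M) : ~ x = 0 -> 0 < x.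
Proof. revert x; axiom 16%nat. Qed.

Lemma model_semiring : semi_ring_theory (s0 Mo) (s1 Mo) (splus Mo) (stimes Mo) eq.
Proof.
  split; intros; rewrite ?(addC 0) ?(mulC 1) ?(mulC 0) ?add0 ?mul0 ?mul1 ?addA ?mulA //.
  - exact: addC.
  - exact: mulC.
  - by rewrite mulC mulD (mulC p) (mulC p).
Qed.
Add Ring model_ring : model_semiring.

Lemma lt_total (x y : M) : x < y \/ x = y \/ y < x.
Proof. case: (classic (x < y)); case: (classic (x = y)); auto using lt_total'. Qed.

Lemma lt_asym (x y : M) : x < y -> ~ y < x.
Proof. by move=> H1 H2; apply: (lt_irrefl x); apply: lt_trans H1 H2. Qed.

Lemma not_lt_0 (x : M) : ~ x < 0.
Proof.
  move=> H; case: (classic (x = 0)) => [E|/pos' H'].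
    by apply: (lt_irrefl 0); rewrite {1}E in H.
  exact: lt_asym H H'.
Qed.

Lemma add_cancel (x y z : M) : x + z = y + z -> x = y.
Proof.
  move=> E; case: (lt_total x y) => [H|[//|H]].
    by case: (lt_irrefl (x + z)); rewrite {2}E; apply: lt_add_r.
  by case: (lt_irrefl (y + z)); rewrite -{2}E; apply: lt_add_r.
Qed.

Definition le (x y : M) : Prop := x < y \/ x = y.
Notation "x <= y" := (le x y) : model_scope.

Lemma zero_or_pos (x : M) : x = 0 \/ 0 < x.
Proof. by case: (classic (x = 0)) => [|/pos']; auto. Qed.

Lemma le_0 (x : M) : 0 <= x.
Proof. by case: (zero_or_pos x) => [->|]; [right|left]. Qed.

Lemma zero_or_succ (x : M) : x = 0 \/ exists y, x = y + 1.
Proof.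
  case: (zero_or_pos x); first by left.
  move=> H; right; case: (classic (x = 1)) => [->|/(discrete' _ H) /lt_sub [z E]].
    by exists 0; ring.
  by exists z; rewrite -E; ring.
Qed.

Lemma lt_iff (x y : M) : x < y <-> exists z, y = x + z + 1.
Proof.
  split.
    move=> H; case: (lt_sub _ _ H) => z E; case: (zero_or_succ z) => [Ez|[u Ez]].
      by case: (lt_irrefl x); rewrite -{2}(add0 x) -Ez E.
    by exists u; rewrite -E Ez; ring.
  move=> [z ->].
  have H1 : x < x + 1.
    by have := lt_add_r _ _ x lt_0_1; rewrite (addC 0) add0 (addC 1).
  case: (zero_or_pos z) => [->|Hz]; first by rewrite add0.
  apply: (lt_trans _ _ _ H1); rewrite addA (addC x) (addC x).
  by apply: lt_add_r; have := lt_add_r _ _ 1 Hz; rewrite (addC 0) add0.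
Qed.

Lemma le_iff (x y : M) : x <= y <-> exists z, y = x + z.
Proof.
  split=> [[/lt_iff [z ->]|->]|[z ->]].
  - by exists (z + 1); ring.
  - by exists 0; ring.
  - case: (zero_or_succ z) => [->|[u ->]]; first by right; ring.
    by left; apply/lt_iff; exists u; ring.
Qed.

Lemma le_refl (x : M) : x <= x.
Proof. by right. Qed.
Lemma lt_le (x y : M) : x < y -> x <= y.
Proof. by left. Qed.
Lemma le_trans (y x z : M) : x <= y -> y <= z -> x <= z.
Proof. by move=> [H1|->] // [H2|<-]; left=> //; apply: lt_trans H1 H2. Qed.
Lemma le_lt_trans (y x z : M) : x <= y -> y < z -> x < z.
Proof. by move=> [H1|->] // H2; apply: lt_trans H1 H2. Qed.
Lemma lt_le_trans (y x z : M) : x < y -> y <= z -> x < z.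
Proof. by move=> H1 [H2|<-] //; apply: lt_trans H1 H2. Qed.
Lemma not_lt (x y : M) : ~ x < y <-> y <= x.
Proof.
  split; last by move=> H1 H2; apply: (lt_irrefl x); apply: lt_le_trans H2 H1.
  by case: (lt_total x y) => [//|[->|H]] _; [right|left].
Qed.
Lemma not_le (x y : M) : ~ x <= y <-> y < x.
Proof. by rewrite -not_lt; split=> [/NNPP|H H']. Qed.
Lemma le_or_lt (x y : M) : x <= y \/ y < x.
Proof. by case: (lt_total x y) => [|[|]]; rewrite /le; tauto. Qed.
Lemma lt_succ (x : M) : x < x + 1.
Proof. by apply/lt_iff; exists 0; ring. Qed.
Lemma lt_succ_iff (x y : M) : x < y + 1 <-> x <= y.
Proof.
  split; last by move=> H; apply: le_lt_trans H (lt_succ y).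
  move=> /lt_iff [z E]; apply/le_iff; exists z; exact: add_cancel E.
Qed.
Lemma succ_le_iff (x y : M) : x + 1 <= y <-> x < y.
Proof.
  rewrite le_iff lt_iff; split; move=> [z ->]; exists z; ring.
Qed.
Lemma le_add_l (x y : M) : x <= x + y.
Proof. by apply/le_iff; exists y. Qed.
Lemma le_add_r (x y : M) : y <= x + y.
Proof. by apply/le_iff; exists x; ring. Qed.
Lemma le_plus (x y z w : M) : x <= y -> z <= w -> x + z <= y + w.
Proof. by rewrite !le_iff => -[a ->] [b ->]; exists (a + b); ring. Qed.
Lemma le_mul (x y z w : M) : x <= y -> z <= w -> x * z <= y * w.
Proof. by rewrite !le_iff => -[a ->] [b ->]; exists (x * b + a * z + a * b); ring. Qed.
Lemma lt_add_cancel (x y z : M) : x + z < y + z -> x < y.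
Proof.
  case: (le_or_lt y x) => // H; have := le_plus _ _ z z H (le_refl z).
  by move/not_lt.
Qed.
Lemma one_neq_0 : (1 : M) <> 0.
Proof. by move=> E; apply: (lt_irrefl 0); rewrite -{2}E; apply: lt_0_1. Qed.
Lemma succ_neq_0 (x : M) : x + 1 <> 0.
Proof. by move=> E; apply: (not_lt_0 x); rewrite -E; apply: lt_succ. Qed.
Lemma pos_succ (x : M) : 0 < x + 1.
Proof. by apply/lt_succ_iff; apply: le_0. Qed.
Lemma le_mul_pos (x y : M) : 0 < y -> x <= x * y.
Proof. by move=> /lt_iff [z ->]; apply/le_iff; exists (x * z); ring. Qed.

(** * Definable predicates *)

(** Predicates have an infinite list of arguments, [e 0], [e 1], ..., as in formulas with
    de Bruijn indices. *)

Definition env : Type := nat -> M.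
Definition place (e : env) (p : nat + M) : M := match p with inl k => e k | inr a => a end.

(** A defining formula may use parameters from the structure: [v] tells for each of its
    variables whether it stands for an argument or for a fixed number.  In this way
    arguments can be renamed or fixed without changing the formula. *)
Definition IsDelta0 (P : env -> Prop) : Prop :=
  exists A (v : nat -> nat + M) (d : nat -> sets Mo), Delta0 A /\
    forall e, P e <-> sat Mo (fun i => place e (v i)) d A.

Lemma delta0_ext P Q : (forall e, P e <-> Q e) -> IsDelta0 P -> IsDelta0 Q.
Proof.
  by move=> H [A [v [d [HA HP]]]]; exists A, v, d; split=> // e; rewrite -H.
Qed.

Lemma delta0_sub (p : nat -> nat + M) P : IsDelta0 P -> IsDelta0 (fun e => P (fun i => place e (p i))).
Proof.
  move=> [A [v [d [HA HP]]]].
  exists A, (fun i => match v i with inl k => p k | inr a => inr a end), d.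
  split=> // e; rewrite HP.
  suff -> : (fun i => place (fun i => place e (p i)) (v i)) = (fun i => place e
    (match v i with inl k => p k | inr a => inr a end)) by [].
  by apply: functional_extensionality => i; case: (v i).
Qed.

Lemma delta0_ren (f : nat -> nat) P : IsDelta0 P -> IsDelta0 (fun e => P (fun i => e (f i))).
Proof. exact: (delta0_sub (fun i => inl (f i))). Qed.

Definition interleave {T} (f g : nat -> T) (n : nat) : T :=
  if Nat.even n then f (Nat.div2 n) else g (Nat.div2 n).
Lemma interleave_l {T} (f g : nat -> T) n : interleave f g (2 * n) = f n.
Proof. by rewrite /interleave Nat.even_mul Nat.div2_double. Qed.
Lemma interleave_r {T} (f g : nat -> T) n : interleave f g (2 * n + 1) = g n.
Proof.
  by rewrite /interleave Nat.add_1_r Nat.even_succ Nat.odd_mul Nat.div2_succ_double.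
Qed.

(** Before two formulas can be connected, their variables are made disjoint: the even ones
    serve the first, the odd ones the second. *)
Lemma delta0_common P Q : IsDelta0 P -> IsDelta0 Q ->
  exists A B v d, Delta0 A /\ Delta0 B /\
    (forall e, P e <-> sat Mo (fun i => place e (v i)) d A) /\
    (forall e, Q e <-> sat Mo (fun i => place e (v i)) d B).
Proof.
  move=> [A [v [d [HA HP]]]] [B [w [c [HB HQ]]]].
  exists (subst (fun i => Var (2 * i)) (fun i => (2 * i)%nat) A),
    (subst (fun i => Var (2 * i + 1)) (fun i => (2 * i + 1)%nat) B),
    (interleave v w), (interleave d c).
  split; [exact: Delta0_subst|split; [exact: Delta0_subst|split]] => e.
  - rewrite HP sat_subst /=.
    have -> : (fun n => place e (interleave v w (2 * n))) = (fun n => place e (v n)).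
      by apply: functional_extensionality => n; rewrite interleave_l.
    suff -> : (fun n => interleave d c (2 * n)) = d by [].
    by apply: functional_extensionality => n; rewrite interleave_l.
  - rewrite HQ sat_subst /=.
    have -> : (fun n => place e (interleave v w (2 * n + 1))) = (fun n => place e (w n)).
      by apply: functional_extensionality => n; rewrite interleave_r.
    suff -> : (fun n => interleave d c (2 * n + 1)) = c by [].
    by apply: functional_extensionality => n; rewrite interleave_r.
Qed.

Lemma delta0_imp P Q : IsDelta0 P -> IsDelta0 Q -> IsDelta0 (fun e => P e -> Q e).
Proof.
  move=> HP HQ; case: (delta0_common _ _ HP HQ) => A [B [v [d [HA [HB [EA EB]]]]]].
  exists (Imp A B), v, d; split; first by constructor.
  by move=> e /=; rewrite EA EB.
Qed.

Lemma delta0_false : IsDelta0 (fun _ => False).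
Proof. by exists Bot, (fun _ => inl 0%nat), (fun _ => sset Mo); split; first by constructor. Qed.

Lemma delta0_eq s t (v : nat -> nat + M) :
  IsDelta0 (fun e => eval Mo (fun i => place e (v i)) s = eval Mo (fun i => place e (v i)) t).
Proof. by exists (EqN s t), v, (fun _ => sset Mo); split; first by constructor. Qed.

Lemma delta0_lt s t (v : nat -> nat + M) :
  IsDelta0 (fun e => eval Mo (fun i => place e (v i)) s < eval Mo (fun i => place e (v i)) t).
Proof. by exists (LtN s t), v, (fun _ => sset Mo); split; first by constructor. Qed.

Lemma delta0_mem t X (v : nat -> nat + M) :
  IsDelta0 (fun e => eval Mo (fun i => place e (v i)) t in X).
Proof. by exists (Mem t 0), v, (fun _ => X); split; first by constructor. Qed.

Definition shift (e : env) : env := fun i => e (S i).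

(** The variables of the formula that stand for the argument 0 become the bound variable; the
    other ones are moved up by two, past it and past the variable for the bound [e k]. *)
Lemma delta0_all k (Q : M -> env -> Prop) : IsDelta0 (fun e => Q (e 0%nat) (shift e)) ->
  IsDelta0 (fun e => forall x, x < e k -> Q x e).
Proof.
  move=> [A [v [d [HA HQ]]]].
  pose f i := match v i with inl 0%nat => Var 0 | _ => Var (S (S i)) end.
  pose w i := match i with
    | 0%nat => inl k
    | S i => match v i with inl (S j) => inl j | p => p end
    end.
  exists (AllN (Imp (LtN (Var 0) (lift_term (Var 0))) (subst f (fun X => X) A))), w, d.
  split; first by constructor; apply: Delta0_subst.
  move=> e /=; split=> H x Hx; move: (H x Hx).
    move=> HQx; apply/sat_subst.
    have := HQ (scons x e); rewrite /shift /= => -[HQ1 _]; move: (HQ1 HQx).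
    suff -> : (fun i => place (scons x e) (v i)) =
      (fun n => eval Mo (scons x (fun i => place e (w i))) (f n)) by [].
    apply: functional_extensionality => i; rewrite /f /=.
    by case E: (v i) => [[|j]|a] //=; rewrite E.
  move/sat_subst=> HQx.
  have := HQ (scons x e); rewrite /shift /= => -[_ HQ1]; apply: HQ1; move: HQx.
  suff -> : (fun i => place (scons x e) (v i)) =
    (fun n => eval Mo (scons x (fun i => place e (w i))) (f n)) by [].
  apply: functional_extensionality => i; rewrite /f /=.
  by case E: (v i) => [[|j]|a] //=; rewrite E.
Qed.

Lemma delta0_not P : IsDelta0 P -> IsDelta0 (fun e => ~ P e).
Proof. by move=> H; apply: delta0_imp => //; apply: delta0_false. Qed.

Lemma delta0_and P Q : IsDelta0 P -> IsDelta0 Q -> IsDelta0 (fun e => P e /\ Q e).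
Proof.
  move=> HP HQ; apply: (delta0_ext (fun e => ~ (P e -> ~ Q e))); first by move=> e; tauto.
  by apply: delta0_not; apply: delta0_imp => //; apply: delta0_not.
Qed.

Lemma delta0_or P Q : IsDelta0 P -> IsDelta0 Q -> IsDelta0 (fun e => P e \/ Q e).
Proof.
  move=> HP HQ; apply: (delta0_ext (fun e => ~ P e -> Q e)); first by move=> e; tauto.
  by apply: delta0_imp => //; apply: delta0_not.
Qed.

Lemma delta0_ex k (Q : M -> env -> Prop) : IsDelta0 (fun e => Q (e 0%nat) (shift e)) ->
  IsDelta0 (fun e => exists x, x < e k /\ Q x e).
Proof.
  move=> H; apply: (delta0_ext (fun e => ~ forall x, x < e k -> ~ Q x e)).
    move=> e; split; last by move=> [x [H1 H2]] H3; apply: H3 H1 H2.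
    move=> H1; apply: NNPP => H2; apply: H1 => x Hx HQ; apply: H2; by exists x.
  by apply: delta0_not; apply: (delta0_all k (fun x e => ~ Q x e)); apply: delta0_not.
Qed.

(** ** Sigma^0_1 predicates *)

Definition IsSigma1 (P : env -> Prop) : Prop :=
  exists Q, IsDelta0 Q /\ forall e, P e <-> exists y, Q (scons y e).

Lemma sigma1_ext P Q : (forall e, P e <-> Q e) -> IsSigma1 P -> IsSigma1 Q.
Proof. by move=> H [R [HR HP]]; exists R; split=> // e; rewrite -H. Qed.

Lemma delta0_sigma1 P : IsDelta0 P -> IsSigma1 P.
Proof.
  move=> H; exists (fun e => P (shift e)); split; first exact: (delta0_ren S).
  by move=> e; split=> [He|[y //]]; exists 0.
Qed.

Lemma sigma1_sub (p : nat -> nat + M) P : IsSigma1 P -> IsSigma1 (fun e => P (fun i => place e (p i))).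
Proof.
  move=> [Q [HQ HP]].
  pose q i := match i with
    | 0%nat => inl 0%nat
    | S i => match p i with inl k => inl (S k) | inr a => inr a end
    end.
  exists (fun e => Q (fun i => place e (q i))); split; first exact: delta0_sub.
  move=> e; rewrite HP.
  suff E : forall y, scons y (fun i => place e (p i)) = (fun i => place (scons y e) (q i)).
    by split; move=> [y Hy]; exists y; move: Hy; rewrite E.
  by move=> y; apply: functional_extensionality; case=> //= i; case: (p i).
Qed.

Lemma sigma1_ren (f : nat -> nat) P : IsSigma1 P -> IsSigma1 (fun e => P (fun i => e (f i))).
Proof. exact: (sigma1_sub (fun i => inl (f i))). Qed.

(** Two unbounded quantifiers are merged by bounding both by a single one, which avoids
    decoding pairs at this point. *)
Lemma sigma1_ex (P : M -> env -> Prop) :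
  IsSigma1 (fun e => P (e 0%nat) (shift e)) -> IsSigma1 (fun e => exists x, P x e).
Proof.
  move=> [Q [HQ HP]].
  exists (fun e => exists x, x < e 0%nat /\ exists y, y < e 0%nat /\ Q (scons y (scons x (shift e)))).
  split.
    apply: (delta0_ex 0 (fun x e => exists y, y < e 0%nat /\ Q (scons y (scons x (shift e))))).
    rewrite /=.
    apply: (delta0_ex 1 (fun y e => Q (scons y (scons (e 0%nat) (shift (shift e)))))).
    apply: delta0_ext (delta0_ren (fun i => match i with 0%nat => 0%nat | 1%nat => 1%nat | S (S i) => S (S (S i)) end) _ HQ) => e.
    suff -> : scons (e 0%nat) (scons (shift e 0%nat) (shift (shift (shift e)))) =
      (fun i => e (match i with 0%nat => 0%nat | 1%nat => 1%nat | S (S i) => S (S (S i)) end)) by [].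
    by apply: functional_extensionality; case=> [|[|i]].
  move=> e; split.
    move=> [x]; move: (HP (scons x e)) => /= -[H _] /H [y Hy].
    exists (x + y + 1), x; split; first by apply/lt_iff; exists y.
    by exists y; split=> //; apply/lt_iff; exists x => /=; ring.
  move=> [w [x [_ [y [_ H]]]]]; exists x; apply/(HP (scons x e)); by exists y.
Qed.

Lemma sigma1_and P Q : IsSigma1 P -> IsSigma1 Q -> IsSigma1 (fun e => P e /\ Q e).
Proof.
  move=> [P' [HP' HP]] [Q' [HQ' HQ]].
  apply: (sigma1_ext (fun e => exists x y, P' (scons x e) /\ Q' (scons y e))).
    move=> e; rewrite HP HQ; split; first by move=> [x [y [H1 H2]]]; split; [exists x|exists y].
    by move=> [[x H1] [y H2]]; exists x, y.
  apply: (sigma1_ex (fun x e => exists y, P' (scons x e) /\ Q' (scons y e))).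
  apply: (sigma1_ex (fun y e => P' (scons (e 0%nat) (shift e)) /\ Q' (scons y (shift e)))).
  apply: delta0_sigma1; apply: delta0_and.
    apply: delta0_ext (delta0_ren S _ HP') => e.
    suff -> : scons (shift e 0%nat) (shift (shift e)) = (fun i => e (S i)) by [].
    by apply: functional_extensionality; case.
  apply: delta0_ext (delta0_ren (fun i => match i with 0%nat => 0%nat | S i => S (S i) end) _ HQ') => e.
  suff -> : scons (e 0%nat) (shift (shift e)) =
    (fun i => e (match i with 0%nat => 0%nat | S i => S (S i) end)) by [].
  by apply: functional_extensionality; case.
Qed.

Lemma sigma1_or P Q : IsSigma1 P -> IsSigma1 Q -> IsSigma1 (fun e => P e \/ Q e).
Proof.
  move=> [P' [HP' HP]] [Q' [HQ' HQ]].
  exists (fun e => P' e \/ Q' e); split; first exact: delta0_or.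
  move=> e; rewrite HP HQ; split.
    by move=> [[x H]|[x H]]; exists x; [left|right].
  by move=> [x [H|H]]; [left|right]; exists x.
Qed.

(** ** Induction and comprehension *)

(** The axioms speak of formulas; here a definable predicate is brought back to one, all
    arguments but the first being set to 0. *)
Lemma sigma1_formula (P : M -> Prop) : IsSigma1 (fun e => P (e 0%nat)) ->
  exists A e d, Delta0 A /\ forall x, P x <-> sat Mo (scons x e) d (ExN A).
Proof.
  move=> [Q [[A [v [d [HA HQ]]]] HP]].
  pose f i := match v i with inl 0%nat => Var 0 | inl 1%nat => Var 1 | _ => Var (S (S i)) end.
  pose e i := match v i with inr a => a | _ => (0 : M) end.
  exists (subst f (fun X => X) A), e, d; split; first exact: Delta0_subst.
  have E x y : Q (scons y (scons x (fun _ => 0))) <->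
      sat Mo (scons y (scons x e)) d (subst f (fun X => X) A).
    rewrite HQ sat_subst.
    suff -> : (fun i => place (scons y (scons x (fun _ => 0))) (v i)) =
      (fun n => eval Mo (scons y (scons x e)) (f n)) by [].
    apply: functional_extensionality => i; rewrite /f.
    by case Ei: (v i) => [[|[|j]]|a] //=; rewrite /e Ei.
  move=> x; rewrite (HP (scons x (fun _ => 0))) /=; split.
    by move=> [y /E Hy] H; apply: (H y).
  by move=> H; apply: NNPP => Hn; apply: H => y /E Hy; apply: Hn; exists y.
Qed.

Lemma sat_scons_num t A e d :
  sat Mo e d (inst_num t A) <-> sat Mo (scons (eval Mo e t) e) d A.
Proof.
  rewrite /inst_num sat_subst.
  suff -> : (fun n => eval Mo e (scons t Var n)) = scons (eval Mo e t) e by [].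
  by apply: functional_extensionality; case.
Qed.

Lemma sat_successor A x e d :
  sat Mo (scons x e) d (subst (scons (Plus (Var 0) One) (fun n => Var (S n))) (fun X => X) A)
  <-> sat Mo (scons (x + 1) e) d A.
Proof.
  rewrite sat_subst.
  suff -> : (fun n => eval Mo (scons x e) (scons (Plus (Var 0) One) (fun n => Var (S n)) n)) =
    scons (x + 1) e by [].
  by apply: functional_extensionality; case.
Qed.

Lemma sat_iff A B e d : sat Mo e d (Iff A B) <-> (sat Mo e d A <-> sat Mo e d B).
Proof.
  split; last by move=> [H1 H2] H; apply: H.
  by move=> H; apply: NNPP => Hn; apply: H => H1 H2; apply: Hn; split.
Qed.

Lemma sat_comprehension A e d : sat Mo e d (comprehension A) <->
  exists X, forall x, x in X <-> sat Mo (scons x e) d A.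
Proof.
  have E x X : sat Mo (scons x e) (scons X d) (lift_set A) <-> sat Mo (scons x e) d A.
    by rewrite /lift_set sat_subst.
  have EI X : sat Mo e (scons X d) (AllN (Iff (Mem (Var 0) 0) (lift_set A))) <->
      forall x, x in X <-> sat Mo (scons x e) d A.
    split=> H x.
      have : sat Mo (scons x e) (scons X d) (Iff (Mem (Var 0) 0) (lift_set A)) by exact: H.
      by rewrite sat_iff E.
    suff : sat Mo (scons x e) (scons X d) (Iff (Mem (Var 0) 0) (lift_set A)) by [].
    by rewrite sat_iff E; apply: H.
  split.
    move=> H; apply: NNPP => Hn; apply: H => X /EI HX; apply: Hn; by exists X.
  by move=> [X /EI HX] H; apply: (H X).
Qed.

Lemma sigma1_induction (P : M -> Prop) : IsSigma1 (fun e => P (e 0%nat)) ->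
  P 0 -> (forall x, P x -> P (x + 1)) -> forall x, P x.
Proof.
  move=> /sigma1_formula [A [e [d [HA E]]]] H0 HS x; apply/E.
  have HI : sat Mo e d (inst_num Zero (ExN A)) ->
      (forall x, sat Mo (scons x e) d (ExN A) -> sat Mo (scons x e) d
        (subst (scons (Plus (Var 0) One) (fun n => Var (S n))) (fun X => X) (ExN A))) ->
      forall x, sat Mo (scons x e) d (ExN A).
    exact: (HM _ (RCA0_induction (ExN A) (ex_intro _ A (Logic.conj HA eq_refl))) e d).
  move: x; apply: HI; first by apply/sat_scons_num; apply/E.
  by move=> x /E Hx; apply/sat_successor; apply/E; apply: HS.
Qed.

(** [Sigma^0_1] bounding, by induction on the length of the initial segment that has
    been bounded. *)
Lemma collection (Q : M -> M -> Prop) b : IsDelta0 (fun e => Q (e 0%nat) (e 1%nat)) ->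
  (forall x, x < b -> exists y, Q x y) ->
  exists w, forall x, x < b -> exists y, y < w /\ Q x y.
Proof.
  move=> HQ Hb.
  pose R n := exists w, forall x, x < n -> x < b -> exists y, y < w /\ Q x y.
  suff [w Hw] : R b by exists w => x Hx; apply: Hw.
  apply: (sigma1_induction R).
  - apply: (sigma1_ex (fun w e => forall x, x < e 0%nat -> x < b -> exists y, y < w /\ Q x y)).
    apply: delta0_sigma1.
    apply: (delta0_all 1 (fun x e => x < b -> exists y, y < e 0%nat /\ Q x y)).
    apply: delta0_imp.
      exact: (delta0_lt (Var 0) (Var 1) (fun i => match i with 0%nat => inl 0%nat | _ => inr b end)).
    apply: (delta0_ex 1 (fun y e => Q (e 0%nat) y)).
    exact: delta0_ext (delta0_ren (fun i => match i with 0%nat => 1%nat | _ => 0%nat end) _ HQ).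
  - by exists 0 => x /not_lt_0.
  - move=> n [w Hw]; case: (classic (n < b)) => Hn; last first.
      exists w => x /lt_succ_iff Hx Hxb; apply: Hw => //.
      by case: Hx => // E; case: Hn; rewrite -E.
    case: (Hb n Hn) => y Hy; exists (w + y + 1) => x /lt_succ_iff [Hx|->] Hxb.
      case: (Hw x Hx Hxb) => z [Hz HQz]; exists z; split=> //.
      apply: lt_le_trans Hz _; apply: (le_trans _ _ _ (le_add_l w y)); exact: le_add_l.
    exists y; split=> //; apply/lt_succ_iff; exact: le_add_r.
Qed.

(** By bounding, a bounded quantifier can be moved past an unbounded existential one. *)
Lemma sigma1_all k (Q : M -> env -> Prop) : IsSigma1 (fun e => Q (e 0%nat) (shift e)) ->
  IsSigma1 (fun e => forall x, x < e k -> Q x e).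
Proof.
  move=> [R [HR HQ]].
  have HQ' x e : Q x e <-> exists y, R (scons y (scons x e)).
    exact: (HQ (scons x e)).
  exists (fun e => forall x, x < e (S k) -> exists y, y < e 0%nat /\ R (scons y (scons x (shift e)))).
  split.
    apply: (delta0_all (S k) (fun x e => exists y, y < e 0%nat /\ R (scons y (scons x (shift e))))).
    apply: (delta0_ex 1 (fun y e => R (scons y (scons (e 0%nat) (shift (shift e)))))).
    pose f i := match i with 0%nat => 0%nat | 1%nat => 1%nat | S (S i) => S (S (S i)) end.
    apply: delta0_ext (delta0_ren f _ HR) => e.
    suff -> : (fun i => e (f i)) = scons (e 0%nat) (scons (shift e 0%nat) (shift (shift (shift e)))) by [].
    by apply: functional_extensionality; case=> [|[|i]].
  move=> e; split.
    move=> H; apply: (collection (fun x y => R (scons y (scons x e)))).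
      pose f i : nat + M := match i with 0%nat => inl 1%nat | 1%nat => inl 0%nat | S (S i) => inr (e i) end.
      apply: delta0_ext (delta0_sub f _ HR) => e'.
      suff -> : (fun i => place e' (f i)) = scons (e' 1%nat) (scons (e' 0%nat) e) by [].
      by apply: functional_extensionality; case=> [|[|i]].
    by move=> x /H /HQ'.
  by move=> [w Hw] x /Hw [y [_ Hy]]; apply/HQ'; exists y.
Qed.

(** ** Delta^0_1 predicates and functions *)

Definition IsDelta1 (P : env -> Prop) : Prop := IsSigma1 P /\ IsSigma1 (fun e => ~ P e).

(** A [Sigma^0_1] graph suffices: as [t] is total, [y] differs from the value exactly if
    the value is some other number. *)
Definition Delta1Fun (t : env -> M) : Prop := IsSigma1 (fun e => e 0%nat = t (shift e)).

Lemma delta1_ext P Q : (forall e, P e <-> Q e) -> IsDelta1 P -> IsDelta1 Q.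
Proof.
  move=> H [H1 H2]; split; first exact: sigma1_ext H1.
  by apply: sigma1_ext H2 => e; rewrite H.
Qed.

Lemma delta0_delta1 P : IsDelta0 P -> IsDelta1 P.
Proof. by move=> H; split; apply: delta0_sigma1 => //; apply: delta0_not. Qed.

Lemma delta1_sigma1 P : IsDelta1 P -> IsSigma1 P.
Proof. by case. Qed.

Lemma delta1_ren f P : IsDelta1 P -> IsDelta1 (fun e => P (fun i => e (f i))).
Proof. by move=> [H1 H2]; split; [exact: (sigma1_ren f _ H1)|exact: (sigma1_ren f _ H2)]. Qed.

Lemma delta1_not P : IsDelta1 P -> IsDelta1 (fun e => ~ P e).
Proof. by move=> [H1 H2]; split=> //; apply: sigma1_ext H1 => e; tauto. Qed.

Lemma delta1_and P Q : IsDelta1 P -> IsDelta1 Q -> IsDelta1 (fun e => P e /\ Q e).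
Proof.
  move=> [H1 H2] [H3 H4]; split; first exact: sigma1_and.
  apply: sigma1_ext (sigma1_or _ _ H2 H4) => e; tauto.
Qed.

Lemma delta1_or P Q : IsDelta1 P -> IsDelta1 Q -> IsDelta1 (fun e => P e \/ Q e).
Proof.
  move=> [H1 H2] [H3 H4]; split; first exact: sigma1_or.
  apply: sigma1_ext (sigma1_and _ _ H2 H4) => e; tauto.
Qed.

Lemma delta1_imp P Q : IsDelta1 P -> IsDelta1 Q -> IsDelta1 (fun e => P e -> Q e).
Proof.
  move=> H1 H2; apply: delta1_ext (delta1_or _ _ (delta1_not _ H1) H2) => e; tauto.
Qed.

Lemma delta1_iff P Q : IsDelta1 P -> IsDelta1 Q -> IsDelta1 (fun e => P e <-> Q e).
Proof. by move=> H1 H2; apply: delta1_and; apply: delta1_imp. Qed.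

Lemma delta1_const (P : Prop) : IsDelta1 (fun _ => P).
Proof.
  case: (classic P) => H.
    apply: (delta1_ext (fun _ => ~ False)); first by move=> _; tauto.
    by apply: delta0_delta1; apply: delta0_not; exact: delta0_false.
  apply: (delta1_ext (fun _ => False)); first by move=> _; tauto.
  by apply: delta0_delta1; exact: delta0_false.
Qed.

Lemma sigma1_app (P : M -> env -> Prop) t :
  IsSigma1 (fun e => P (e 0%nat) (shift e)) -> Delta1Fun t -> IsSigma1 (fun e => P (t e) e).
Proof.
  move=> HP Ht; apply: (sigma1_ext (fun e => exists x, x = t e /\ P x e)).
    by move=> e; split=> [[x [->]]//|H]; exists (t e).
  by apply: (sigma1_ex (fun x e => x = t e /\ P x e)); apply: sigma1_and.
Qed.

(** As [t] is total, both [P] and its complement at [t e] can be expressed by introducing the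
    value existentially. *)
Lemma delta1_app (P : M -> env -> Prop) t :
  IsDelta1 (fun e => P (e 0%nat) (shift e)) -> Delta1Fun t -> IsDelta1 (fun e => P (t e) e).
Proof.
  by move=> [H1 H2] Ht; split; [apply: sigma1_app|apply: (sigma1_app (fun x e => ~ P x e))].
Qed.

Lemma delta1fun_ren (f : nat -> nat) t : Delta1Fun t -> Delta1Fun (fun e => t (fun i => e (f i))).
Proof.
  move=> H; pose g i := match i with 0%nat => 0%nat | S i => S (f i) end.
  exact: (sigma1_ren g _ H).
Qed.

Lemma delta1_eq_var i j : IsDelta1 (fun e => e i = e j).
Proof.
  apply: delta0_delta1.
  exact: (delta0_eq (Var 0) (Var 1) (fun n => match n with 0%nat => inl i | _ => inl j end)).
Qed.

Lemma delta1fun_var k : Delta1Fun (fun e => e k).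
Proof. exact: delta1_sigma1 (delta1_eq_var 0 (S k)). Qed.

Lemma delta1fun_const a : Delta1Fun (fun _ => a).
Proof.
  apply: delta0_sigma1.
  exact: (delta0_eq (Var 0) (Var 1) (fun n => match n with 0%nat => inl 0%nat | _ => inr a end)).
Qed.

Lemma delta1_app1 (P : M -> Prop) t : IsDelta1 (fun e => P (e 0%nat)) -> Delta1Fun t -> IsDelta1 (fun e => P (t e)).
Proof. exact: (delta1_app (fun x _ => P x)). Qed.

Lemma delta1_app2 (P : M -> M -> Prop) t u : IsDelta1 (fun e => P (e 0%nat) (e 1%nat)) ->
  Delta1Fun t -> Delta1Fun u -> IsDelta1 (fun e => P (t e) (u e)).
Proof.
  move=> HP Ht Hu; apply: (delta1_app (fun x e => P x (u e))) => //.
  apply: (delta1_app (fun y e => P (e 0%nat) y)); last exact: (delta1fun_ren S).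
  by apply: delta1_ext (delta1_ren (fun i => match i with 0%nat => 1%nat | _ => 0%nat end) _ HP).
Qed.

Lemma delta1_app3 (P : M -> M -> M -> Prop) t u v :
  IsDelta1 (fun e => P (e 0%nat) (e 1%nat) (e 2%nat)) ->
  Delta1Fun t -> Delta1Fun u -> Delta1Fun v -> IsDelta1 (fun e => P (t e) (u e) (v e)).
Proof.
  move=> HP Ht Hu Hv; apply: (delta1_app (fun x e => P x (u e) (v e))) => //.
  apply: (delta1_app (fun y e => P (e 0%nat) y (v (shift e)))); last exact: (delta1fun_ren S).
  apply: (delta1_app (fun z e => P (e 1%nat) (e 0%nat) z)); last exact: (delta1fun_ren (fun i => S (S i))).
  by apply: delta1_ext (delta1_ren (fun i => match i with 0%nat => 2%nat | 1%nat => 1%nat | _ => 0%nat end) _ HP).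
Qed.

Lemma delta1fun_graph t : IsDelta1 (fun e => e 0%nat = t (shift e)) -> Delta1Fun t.
Proof. exact: delta1_sigma1. Qed.

Lemma delta1fun_graph_delta1 t : Delta1Fun t -> IsDelta1 (fun e => e 0%nat = t (shift e)).
Proof. by move=> Ht; apply: (delta1_app (fun x e => e 0%nat = x)); [exact: delta1_eq_var|exact: (delta1fun_ren S)]. Qed.

Lemma delta1fun_app1 (f : M -> M) t : Delta1Fun (fun e => f (e 0%nat)) -> Delta1Fun t -> Delta1Fun (fun e => f (t e)).
Proof.
  move=> Hf Ht; apply: delta1_sigma1; apply: (delta1_app2 (fun y x => y = f x)).
  - by have := delta1fun_graph_delta1 _ Hf.
  - exact: delta1fun_var.
  - exact: (delta1fun_ren S).
Qed.

Lemma delta1fun_app2 (f : M -> M -> M) t u : Delta1Fun (fun e => f (e 0%nat) (e 1%nat)) ->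
  Delta1Fun t -> Delta1Fun u -> Delta1Fun (fun e => f (t e) (u e)).
Proof.
  move=> Hf Ht Hu; apply: delta1_sigma1; apply: (delta1_app3 (fun y x z => y = f x z)).
  - by have := delta1fun_graph_delta1 _ Hf.
  - exact: delta1fun_var.
  - exact: (delta1fun_ren S).
  - exact: (delta1fun_ren S).
Qed.

Lemma delta1fun_add t u : Delta1Fun t -> Delta1Fun u -> Delta1Fun (fun e => t e + u e).
Proof.
  apply: (delta1fun_app2 (splus Mo)); apply: delta0_sigma1.
  exact: (delta0_eq (Var 0) (Plus (Var 1) (Var 2)) (fun n => inl n)).
Qed.

Lemma delta1fun_mul t u : Delta1Fun t -> Delta1Fun u -> Delta1Fun (fun e => t e * u e).
Proof.
  apply: (delta1fun_app2 (stimes Mo)); apply: delta0_sigma1.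
  exact: (delta0_eq (Var 0) (Times (Var 1) (Var 2)) (fun n => inl n)).
Qed.

Lemma delta1fun_pair t u : Delta1Fun t -> Delta1Fun u -> Delta1Fun (fun e => pair Mo (t e) (u e)).
Proof. by move=> Ht Hu; apply: delta1fun_add => //; apply: delta1fun_mul; apply: delta1fun_add. Qed.

Lemma delta1_eq t u : Delta1Fun t -> Delta1Fun u -> IsDelta1 (fun e => t e = u e).
Proof. by apply: (delta1_app2 eq); exact: delta1_eq_var. Qed.

Lemma delta1_lt t u : Delta1Fun t -> Delta1Fun u -> IsDelta1 (fun e => t e < u e).
Proof.
  apply: (delta1_app2 (slt Mo)); apply: delta0_delta1; exact: (delta0_lt (Var 0) (Var 1) (fun n => inl n)).
Qed.

Lemma delta1_le t u : Delta1Fun t -> Delta1Fun u -> IsDelta1 (fun e => t e <= u e).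
Proof. by move=> Ht Hu; apply: delta1_or; [apply: delta1_lt|apply: delta1_eq]. Qed.

Lemma delta1_mem X t : Delta1Fun t -> IsDelta1 (fun e => t e in X).
Proof.
  apply: (delta1_app1 (fun x => x in X)); apply: delta0_delta1.
  exact: (delta0_mem (Var 0) X (fun n => inl n)).
Qed.

Lemma sigma1_all_lt t (Q : M -> env -> Prop) : Delta1Fun t -> IsSigma1 (fun e => Q (e 0%nat) (shift e)) ->
  IsSigma1 (fun e => forall x, x < t e -> Q x e).
Proof.
  move=> Ht HQ; apply: (sigma1_app (fun b e => forall x, x < b -> Q x e)) => //.
  apply: (sigma1_all 0 (fun x e => Q x (shift e))).
  exact: (sigma1_ren (fun i => match i with 0%nat => 0%nat | S i => S (S i) end) _ HQ).
Qed.

Lemma delta1_all_lt t (Q : M -> env -> Prop) : Delta1Fun t -> IsDelta1 (fun e => Q (e 0%nat) (shift e)) ->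
  IsDelta1 (fun e => forall x, x < t e -> Q x e).
Proof.
  move=> Ht [H1 H2]; split; first exact: sigma1_all_lt.
  apply: (sigma1_ext (fun e => exists x, x < t e /\ ~ Q x e)).
    move=> e; split; first by move=> [x [Hx HQ]] H; apply: HQ; apply: H.
    by move=> H; apply: NNPP => Hn; apply: H => x Hx; apply: NNPP => HQ; apply: Hn; exists x.
  apply: (sigma1_ex (fun x e => x < t e /\ ~ Q x e)); apply: sigma1_and => //.
  by apply: delta1_sigma1; apply: delta1_lt; [exact: delta1fun_var|exact: (delta1fun_ren S)].
Qed.

Lemma delta1_ex_lt t (Q : M -> env -> Prop) : Delta1Fun t -> IsDelta1 (fun e => Q (e 0%nat) (shift e)) ->
  IsDelta1 (fun e => exists x, x < t e /\ Q x e).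
Proof.
  move=> Ht HQ; apply: (delta1_ext (fun e => ~ forall x, x < t e -> ~ Q x e)).
    move=> e; split; last by move=> [x [H1 H2]] H3; apply: H3 H1 H2.
    move=> H1; apply: NNPP => H2; apply: H1 => x Hx HQx; apply: H2; by exists x.
  by apply: delta1_not; apply: (delta1_all_lt t (fun x e => ~ Q x e)) => //; apply: delta1_not.
Qed.

Lemma delta1_all_le t (Q : M -> env -> Prop) : Delta1Fun t -> IsDelta1 (fun e => Q (e 0%nat) (shift e)) ->
  IsDelta1 (fun e => forall x, x <= t e -> Q x e).
Proof.
  move=> Ht HQ; apply: (delta1_ext (fun e => forall x, x < t e + 1 -> Q x e)).
    by move=> e; split=> H x Hx; apply: H; apply/lt_succ_iff.
  by apply: delta1_all_lt => //; apply: delta1fun_add => //; apply: delta1fun_const.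
Qed.

Lemma delta1_ex_le t (Q : M -> env -> Prop) : Delta1Fun t -> IsDelta1 (fun e => Q (e 0%nat) (shift e)) ->
  IsDelta1 (fun e => exists x, x <= t e /\ Q x e).
Proof.
  move=> Ht HQ; apply: (delta1_ext (fun e => exists x, x < t e + 1 /\ Q x e)).
    by move=> e; split=> -[x [Hx H]]; exists x; split=> //; apply/lt_succ_iff.
  by apply: delta1_ex_lt => //; apply: delta1fun_add => //; apply: delta1fun_const.
Qed.

(** This is how arithmetical comprehension is used: it makes every arithmetical predicate
    [Delta^0_1], so that one calculus of definable predicates serves both
    theories. *)
Definition Sigma1Complement : Prop := forall P, IsSigma1 P -> IsSigma1 (fun e => ~ P e).

Lemma delta1_ex (Q : M -> env -> Prop) : Sigma1Complement -> IsDelta1 (fun e => Q (e 0%nat) (shift e)) ->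
  IsDelta1 (fun e => exists x, Q x e).
Proof. by move=> HN [HQ _]; have H := sigma1_ex _ HQ; split=> //; apply: HN. Qed.

Lemma delta1_all (Q : M -> env -> Prop) : Sigma1Complement -> IsDelta1 (fun e => Q (e 0%nat) (shift e)) ->
  IsDelta1 (fun e => forall x, Q x e).
Proof.
  move=> HN HQ; apply: (delta1_ext (fun e => ~ exists x, ~ Q x e)).
    move=> e; split; last by move=> H [x]; apply.
    by move=> H x; apply: NNPP => Hn; apply: H; exists x.
  by apply: delta1_not; apply: (delta1_ex (fun x e => ~ Q x e)) => //; apply: delta1_not.
Qed.

(** The tactics below follow the shape of a predicate.  [delta1] accepts an unbounded
    quantifier only if [Sigma1Complement] is among the hypotheses; [sigma1] always accepts
    existential ones.  Predicates and functions other than the arithmetical ones are looked up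
    among the hypotheses and in the database. *)
Create HintDb definable.

Ltac definable_simpl := cbv beta delta [shift].

Ltac delta1fun := definable_simpl; lazymatch goal with
  | |- Delta1Fun (fun e => e ?k) => exact (delta1fun_var k)
  | |- Delta1Fun (fun _ => ?a) => exact (delta1fun_const a)
  | |- Delta1Fun (fun e => splus _ (@?t e) (@?u e)) => refine (delta1fun_add t u _ _); delta1fun
  | |- Delta1Fun (fun e => stimes _ (@?t e) (@?u e)) => refine (delta1fun_mul t u _ _); delta1fun
  | |- Delta1Fun (fun e => pair _ (@?t e) (@?u e)) => refine (delta1fun_pair t u _ _); delta1fun
  | _ => match goal with
    | |- Delta1Fun (fun e => ?f (@?t e) (@?u e)) =>
        refine (delta1fun_app2 f t u _ _ _); [solve [assumption|auto with definable]|delta1fun|delta1fun]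
    | |- Delta1Fun (fun e => ?f (@?t e)) => refine (delta1fun_app1 f t _ _); [solve [assumption|auto with definable]|delta1fun]
    end
  end.

Ltac delta1 := definable_simpl; lazymatch goal with
  | |- IsDelta1 (fun _ => ?P) => exact (delta1_const P)
  | |- IsDelta1 (fun e => ~ @?P e) => refine (delta1_not P _); delta1
  | |- IsDelta1 (fun e => @?P e /\ @?Q e) => refine (delta1_and P Q _ _); delta1
  | |- IsDelta1 (fun e => @?P e \/ @?Q e) => refine (delta1_or P Q _ _); delta1
  | |- IsDelta1 (fun e => @?P e <-> @?Q e) => refine (delta1_iff P Q _ _); delta1
  | |- IsDelta1 (fun e => slt _ (@?t e) (@?u e)) => refine (delta1_lt t u _ _); delta1fun
  | |- IsDelta1 (fun e => le (@?t e) (@?u e)) => refine (delta1_le t u _ _); delta1fun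
  | |- IsDelta1 (fun e => smem _ (@?t e) ?X) => refine (delta1_mem X t _); delta1fun
  | |- IsDelta1 (fun e => forall x, slt _ x (@?t e) -> @?Q x e) => refine (delta1_all_lt t Q _ _); [delta1fun|delta1]
  | |- IsDelta1 (fun e => exists x, slt _ x (@?t e) /\ @?Q x e) => refine (delta1_ex_lt t Q _ _); [delta1fun|delta1]
  | |- IsDelta1 (fun e => forall x, le x (@?t e) -> @?Q x e) => refine (delta1_all_le t Q _ _); [delta1fun|delta1]
  | |- IsDelta1 (fun e => exists x, le x (@?t e) /\ @?Q x e) => refine (delta1_ex_le t Q _ _); [delta1fun|delta1]
  | |- IsDelta1 (fun e => @?P e -> @?Q e) => refine (delta1_imp P Q _ _); delta1
  | |- IsDelta1 (fun e => exists x, @?Q x e) => refine (delta1_ex Q _ _); [assumption|delta1]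
  | |- IsDelta1 (fun e => forall x, @?Q x e) => refine (delta1_all Q _ _); [assumption|delta1]
  | |- IsDelta1 (fun e => @eq (carrier _) (@?t e) (@?u e)) => refine (delta1_eq t u _ _); delta1fun
  | _ => match goal with
    | |- IsDelta1 (fun e => ?P (@?t e) (@?u e) (@?v e)) =>
        refine (delta1_app3 P t u v _ _ _ _); [solve [assumption|auto with definable]|delta1fun|delta1fun|delta1fun]
    | |- IsDelta1 (fun e => ?P (@?t e) (@?u e)) =>
        refine (delta1_app2 P t u _ _ _); [solve [assumption|auto with definable]|delta1fun|delta1fun]
    | |- IsDelta1 (fun e => ?P (@?t e)) => refine (delta1_app1 P t _ _); [solve [assumption|auto with definable]|delta1fun]
    end
  end.

Ltac sigma1 := definable_simpl; lazymatch goal with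
  | |- IsSigma1 (fun e => exists x, @?Q x e) => refine (sigma1_ex Q _); sigma1
  | |- IsSigma1 (fun e => @?P e /\ @?Q e) => refine (sigma1_and P Q _ _); sigma1
  | |- IsSigma1 (fun e => @?P e \/ @?Q e) => refine (sigma1_or P Q _ _); sigma1
  | |- IsSigma1 (fun e => forall x, slt _ x (@?t e) -> @?Q x e) => refine (sigma1_all_lt t Q _ _); [delta1fun|sigma1]
  | _ => apply: delta1_sigma1; delta1
  end.

(** [Pi^0_1] induction: if [P a] fails, then [Sigma^0_1] induction on [x] shows that [P]
    fails at [a - x] for all [x] up to [a], so also at 0. *)
Lemma pi1_induction (P : M -> Prop) : IsSigma1 (fun e => ~ P (e 0%nat)) ->
  P 0 -> (forall x, P x -> P (x + 1)) -> forall x, P x.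
Proof.
  move=> HP H0 HS a; apply: NNPP => Ha.
  have H : forall x, exists z, ~ P z /\ (a < x \/ z + x = a).
  { apply: (sigma1_induction (fun x => exists z, ~ P z /\ (a < x \/ z + x = a))).
    - apply: (sigma1_ex (fun z e => ~ P z /\ (a < e 0%nat \/ z + e 0%nat = a))).
      by apply: sigma1_and; [exact: HP|sigma1].
    - by exists a; split=> //; right; ring.
    - move=> x [z [Hz [H|H]]].
        by exists z; split=> //; left; apply: lt_trans H (lt_succ x).
      case: (zero_or_succ z) => [Ez|[u Eu]]; first by case: Hz; rewrite Ez.
      exists u; split; first by move=> Hu; apply: Hz; rewrite Eu; apply: HS.
      by right; rewrite -H Eu; ring. }
  case: (H a) => z [Hz [/lt_irrefl//|Ez]].
  by apply: Hz; have -> : z = 0 by apply: (add_cancel _ _ a); rewrite Ez; ring.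
Qed.

(** The statement that no number below [x] satisfies [P] is [Pi^0_1], so if there is no
    least such number, it can be proved for all [x] by induction. *)
Lemma sigma1_least (P : M -> Prop) : IsSigma1 (fun e => P (e 0%nat)) -> (exists x, P x) ->
  exists x, P x /\ forall y, y < x -> ~ P y.
Proof.
  move=> HP [a Ha]; apply: NNPP => Hn.
  suff H : forall x y, y < x -> ~ P y by apply: (H (a + 1) a (lt_succ a)).
  apply: (pi1_induction (fun x => forall y, y < x -> ~ P y)).
  - apply: (sigma1_ext (fun e => exists y, y < e 0%nat /\ P y)).
      move=> e; split; first by move=> [y [H1 H2]] H; apply: H H1 H2.
      by move=> H; apply: NNPP => H'; apply: H => y Hy HPy; apply: H'; exists y.
    apply: (sigma1_ex (fun y e => y < e 0%nat /\ P y)); apply: sigma1_and; first by sigma1.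
    exact: HP.
  - by move=> y /not_lt_0.
  - move=> x Hx y /lt_succ_iff [|->]; first exact: Hx.
    by move=> HPx; apply: Hn; exists x.
Qed.

Lemma delta_comprehension (P : M -> Prop) : IsDelta1 (fun e => P (e 0%nat)) ->
  exists X, forall x, x in X <-> P x.
Proof.
  move=> [/sigma1_formula [A [e [d [HA EA]]]] /(sigma1_formula (fun x => ~ P x)) [B [e' [d' [HB EB]]]]].
  (* Both formulas are renamed so as to share one list of parameters. *)
  pose fA i := match i with 0%nat => Var 0 | 1%nat => Var 1 | S (S i) => Var (2 + 2 * i) end.
  pose fB i := match i with 0%nat => Var 0 | 1%nat => Var 1 | S (S i) => Var (2 + (2 * i + 1)) end.
  set c := interleave e e'; set b := interleave d d'.
  have SA x : sat Mo (scons x c) b (ExN (subst fA (fun X => (2 * X)%nat) A)) <-> P x.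
    rewrite EA /=; split=> H H'; apply: H => y; have := H' y; rewrite sat_subst.
      have -> : (fun n => eval Mo (scons y (scons x c)) (fA n)) = scons y (scons x e).
        by apply: functional_extensionality; case=> [|[|i]] //; rewrite [LHS]interleave_l.
      suff -> : (fun X => b (2 * X)%nat) = d by [].
      by apply: functional_extensionality => i; rewrite [LHS]interleave_l.
    have -> : (fun n => eval Mo (scons y (scons x c)) (fA n)) = scons y (scons x e).
      by apply: functional_extensionality; case=> [|[|i]] //; rewrite [LHS]interleave_l.
    suff -> : (fun X => b (2 * X)%nat) = d by [].
    by apply: functional_extensionality => i; rewrite [LHS]interleave_l.
  have SB x y : sat Mo (scons y (scons x c)) b (subst fB (fun X => (2 * X + 1)%nat) B) <->
      sat Mo (scons y (scons x e')) d' B.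
    rewrite sat_subst.
    have -> : (fun n => eval Mo (scons y (scons x c)) (fB n)) = scons y (scons x e').
      by apply: functional_extensionality; case=> [|[|i]] //; rewrite [LHS]interleave_r.
    suff -> : (fun X => b (2 * X + 1)%nat) = d' by [].
    by apply: functional_extensionality => i; rewrite [LHS]interleave_r.
  have HS : Sigma1 (ExN (subst fA (fun X => (2 * X)%nat) A)).
    exact: (ex_intro _ _ (Logic.conj (Delta0_subst _ HA _ _) eq_refl)).
  have HPi : Pi1 (AllN (Neg (subst fB (fun X => (2 * X + 1)%nat) B))).
    eexists; split; last reflexivity.
    by constructor; [apply: Delta0_subst|constructor].
  move: HS HPi SA; set A' := ExN _; set B' := AllN _ => HS HPi SA.
  have HI : (forall x, sat Mo (scons x c) b (Iff A' B')) -> sat Mo c b (comprehension A').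
    exact: (HM _ (RCA0_comprehension _ _ HS HPi) c b).
  move: HI; rewrite sat_comprehension => -[|X HX]; last first.
    by exists X => x; rewrite HX SA.
  move=> x; apply/sat_iff; split.
    by move/SA => Hx y /= /SB Hy; apply: (proj2 (EB x)) Hx => /= H; exact: H Hy.
  move=> H; apply/SA; apply: NNPP => /EB /=; apply=> y /SB; exact: H.
Qed.

(** * Pairs and finite sets *)

(** A pair lies between the square of the sum of its components and the next square, so it
    determines this sum, and then the first component. *)
Lemma pair_inj x y z w : pair Mo x y = pair Mo z w -> x = z /\ y = w.
Proof.
  have sum_le a b c d : pair Mo a b = pair Mo c d -> ~ a + b < c + d.
    move=> E /lt_iff [u Eu]; move: E; rewrite /pair Eu => E.
    have : (a + b) * (a + b) + a < (a + b + u + 1) * (a + b + u + 1) + c.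
      apply/lt_iff; exists (a + b + b + (a + b) * u + (a + b) * u + u * u + u + u + c); ring.
    by rewrite E; apply: lt_irrefl.
  move=> E; have H1 := sum_le _ _ _ _ E; have H2 := sum_le _ _ _ _ (eq_sym E).
  have Es : x + y = z + w by case: (lt_total (x + y) (z + w)) => [|[]].
  have Ex : x = z.
    apply: (add_cancel _ _ ((x + y) * (x + y))).
    by move: E; rewrite /pair -Es => E; rewrite addC E addC.
  split=> //; apply: (add_cancel _ _ x); by rewrite (addC y) Es {1}Ex addC.
Qed.

Lemma le_pair_l x y : x <= pair Mo x y.
Proof. exact: le_add_r. Qed.

Lemma le_square x : x <= x * x.
Proof.
  case: (zero_or_succ x) => [->|[u ->]]; first by right; ring.
  by apply/le_iff; exists (u * u + u); ring.
Qed.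

Lemma le_pair_r x y : y <= pair Mo x y.
Proof.
  apply: (le_trans _ _ _ (le_add_r x y)); apply: (le_trans _ _ _ (le_square _)).
  exact: le_add_l.
Qed.

Lemma le_pair_mono x y z w : x <= z -> y <= w -> pair Mo x y <= pair Mo z w.
Proof. by move=> H1 H2; apply: le_plus => //; apply: le_mul; apply: le_plus. Qed.

Definition dvd (x y : M) : Prop := exists q, y = x * q.

Lemma dvd_delta1 : IsDelta1 (fun e => dvd (e 0%nat) (e 1%nat)).
Proof.
  apply: (delta1_ext (fun e => exists q, q <= e 1%nat /\ e 1%nat = e 0%nat * q)); last by delta1.
  move=> e; split; first by move=> [q [_ H]]; exists q.
  move=> [q Hq]; case: (zero_or_pos (e 0%nat)) => H.
    by exists 0; split; [apply: le_0|rewrite Hq H; ring].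
  by exists q; split=> //; rewrite Hq mulC; apply: le_mul_pos.
Qed.
Hint Resolve dvd_delta1 : definable.

Lemma dvd_mul_r x y z : dvd x y -> dvd x (y * z).
Proof. by move=> [q ->]; exists (q * z); ring. Qed.

Lemma dvd_sub p x y : 0 < p -> dvd p x -> dvd p (x + y) -> dvd p y.
Proof.
  move=> Hp [u Hu] [v Hv].
  case: (le_or_lt u v) => [/le_iff [w Ew]|H].
    exists w; apply: (add_cancel _ _ x); rewrite (addC y) Hv Ew Hu; ring.
  have H' := lt_mul_r _ _ _ Hp H.
  case: (lt_irrefl x); apply: (le_lt_trans (x + y)); first exact: le_add_l.
  by rewrite Hv Hu (mulC p v) (mulC p u).
Qed.

Lemma istriple_delta1 : IsDelta1 (fun e => istriple Mo (e 0%nat)).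
Proof.
  apply: (delta1_ext (fun e => exists k, k <= e 0%nat /\ exists m, m <= e 0%nat /\
    exists n, n <= e 0%nat /\ e 0%nat = pair Mo k (pair Mo m n))); last by delta1.
  move=> e; split; first by move=> [k [_ [m [_ [n [_ H]]]]]]; exists k, m, n.
  move=> [k [m [n H]]]; rewrite H; exists k; split; first exact: le_pair_l.
  have H1 := le_pair_r k (pair Mo m n).
  exists m; split; first by apply: le_trans H1; apply: le_pair_l.
  exists n; split=> //; by apply: le_trans H1; apply: le_pair_r.
Qed.
Hint Resolve istriple_delta1 : definable.

(** The divisor whose divisibility of [n] puts [i] into the set represented by
    [(k, (m, n))]. *)
Definition modulus (m i : M) : M := m * (i + 1) + 1.

Lemma elt_triple i k m n :
  elt Mo i (pair Mo k (pair Mo m n)) <-> i < k /\ dvd (modulus m i) n.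
Proof.
  split; last by move=> [H1 [q H2]]; exists k, m, n; split=> //; split=> //; exists q.
  by move=> [k' [m' [n' [/pair_inj [-> /pair_inj [-> ->]] [H [q Hq]]]]]]; split=> //; exists q.
Qed.

Lemma elt_lt i c : elt Mo i c -> i < c.
Proof. by move=> [k [m [n [-> [H _]]]]]; apply: lt_le_trans H (le_pair_l _ _). Qed.

Lemma elt_delta1 : IsDelta1 (fun e => elt Mo (e 0%nat) (e 1%nat)).
Proof.
  apply: (delta1_ext (fun e => exists k, k <= e 1%nat /\ exists m, m <= e 1%nat /\
    exists n, n <= e 1%nat /\ e 1%nat = pair Mo k (pair Mo m n) /\ e 0%nat < k /\
      dvd (m * (e 0%nat + 1) + 1) n)); last by delta1.
  move=> e; split.
    by move=> [k [_ [m [_ [n [_ [H1 [H2 [q H3]]]]]]]]]; exists k, m, n; split=> //; split=> //; exists q.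
  move=> [k [m [n [H [H' [q Hq]]]]]]; rewrite H; exists k; split; first exact: le_pair_l.
  have H1 := le_pair_r k (pair Mo m n).
  exists m; split; first by apply: le_trans H1; apply: le_pair_l.
  exists n; split; first by apply: le_trans H1; apply: le_pair_r.
  by split=> //; split=> //; exists q.
Qed.
Hint Resolve elt_delta1 : definable.

Lemma fincoded_delta1 : IsDelta1 (fun e => fincoded Mo (e 0%nat)).
Proof.
  apply: (delta1_ext (fun e => istriple Mo (e 0%nat) /\ forall b, b < e 0%nat -> istriple Mo b ->
    ~ forall i, i < e 0%nat -> (elt Mo i b <-> elt Mo i (e 0%nat)))); last by delta1.
  move=> e; split=> -[H1 H2]; split=> // b Hb Hb' H; apply: (H2 b Hb Hb').
    by move=> i _; apply: H.
  move=> i; split=> Hi; apply (H i) => //; last exact: elt_lt.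
  exact: lt_trans (elt_lt _ _ Hi) Hb.
Qed.
Hint Resolve fincoded_delta1 : definable.

(** Plays the part of a factorial in Goedel's coding of finite sets. *)
Lemma common_multiple b : exists m, 0 < m /\ forall d, d < b -> dvd (d + 1) m.
Proof.
  move: b; apply: (sigma1_induction (fun b => exists m, 0 < m /\ forall d, d < b -> dvd (d + 1) m)).
  - by sigma1.
  - by exists 1; split; [exact: lt_0_1|move=> d /not_lt_0].
  - move=> b [m [H0 Hm]]; exists (m * (b + 1)); split.
      by apply: (lt_le_trans _ _ _ H0); apply: le_mul_pos; apply: pos_succ.
    move=> d /lt_succ_iff [/Hm H|->]; first exact: dvd_mul_r.
    by exists m; ring.
Qed.

(** Distinct moduli are coprime: the difference of two of them is [m] times a divisor of
    [m], and each is coprime to [m].  Put as a cancellation property, this needs no Bezout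
    coefficients. *)
Lemma modulus_coprime b m n i k : (forall d, d < b -> dvd (d + 1) m) ->
  i < b -> k < b -> i <> k -> dvd (modulus m i) (n * modulus m k) -> dvd (modulus m i) n.
Proof.
  move=> Hm Hi Hk Hik H; set p := modulus m i.
  have Hp : 0 < p by apply: pos_succ.
  (* As [p] is 1 modulo [m], the factor [m] can be cancelled. *)
  have cancel x : dvd p (x * m) -> dvd p x.
    move=> Hx; apply: (dvd_sub p (x * m * (i + 1))) => //; first exact: dvd_mul_r.
    by exists x; rewrite /p /modulus; ring.
  have [d [Hd Hpd]] : exists d, d < b /\ dvd p (n * m * (d + 1)).
  { case: (lt_total i k) => [/lt_iff [d Ed]|[//|/lt_iff [d Ed]]]; exists d; split.
    - by apply: lt_trans Hk; apply/lt_iff; exists i; rewrite Ed; ring.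
    - apply: (dvd_sub p (n * p)) => //; first by exists n; ring.
      have <- : n * modulus m k = n * p + n * m * (d + 1); last exact: H.
      by rewrite /p /modulus Ed; ring.
    - by apply: lt_trans Hi; apply/lt_iff; exists k; rewrite Ed; ring.
    - apply: (dvd_sub p (n * modulus m k)) => //.
      by exists n; rewrite /p /modulus Ed; ring. }
  case: (Hm d Hd) => q Hq; apply: (cancel); rewrite Hq.
  have -> : n * ((d + 1) * q) = n * (d + 1) * q by ring.
  apply: dvd_mul_r; apply: cancel.
  by have <- : n * m * (d + 1) = n * (d + 1) * m by ring.
Qed.

(** The number [n] is the product of the moduli of the elements, formed step by step. *)
Lemma triple_of_set (P : M -> Prop) b : IsDelta1 (fun e => P (e 0%nat)) ->
  exists c, istriple Mo c /\ forall x, elt Mo x c <-> x < b /\ P x.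
Proof.
  move=> HP; case: (common_multiple b) => m [Hm0 Hm].
  suff [n Hn] : exists n, forall i, i < b -> (dvd (m * (i + 1) + 1) n <-> i < b /\ P i).
    exists (pair Mo b (pair Mo m n)); split; first by exists b, m, n.
    move=> x; rewrite elt_triple; split; first by move=> [Hx /Hn]; apply.
    by move=> [Hx HPx]; split=> //; apply/Hn.
  suff H : forall k, exists n, forall i, i < b -> (dvd (m * (i + 1) + 1) n <-> i < k /\ P i) by [].
  apply: (sigma1_induction (fun k => exists n, forall i, i < b ->
    (dvd (m * (i + 1) + 1) n <-> i < k /\ P i))).
  - by sigma1.
  - exists 1 => i Hi; split; last by move=> [/not_lt_0].
    move=> [q]; case: (zero_or_succ q) => [->|[u ->]].
      by rewrite mul0 => /one_neq_0.
    have -> : (m * (i + 1) + 1) * (u + 1) = (m * (i + 1) * u + u + m * i + m) + 1 by ring.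
    rewrite -{1}(add0 1) (addC 1) => /add_cancel E.
    case: (lt_irrefl 0); rewrite {2}E; apply: lt_le_trans Hm0 _; exact: le_add_r.
  - move=> k [n Hn]; case: (classic (k < b /\ P k)) => [[Hk HPk]|Hk].
      exists (n * modulus m k) => i Hi; case: (classic (i = k)) => [->|Hik].
        split; first by move=> _; split=> //; apply: lt_succ.
        by move=> _; exists n; rewrite /modulus; ring.
      rewrite lt_succ_iff; split.
        move/(modulus_coprime b m n i k Hm Hi Hk Hik)/(Hn i Hi) => [H1 H2].
        by split=> //; left.
      by move=> [[H1|//] H2]; apply: dvd_mul_r; apply/Hn.
    exists n => i Hi; rewrite Hn // lt_succ_iff; split=> -[H1 H2]; split=> //; first by left.
    by case: H1 => // E; case: Hk; rewrite -E.
Qed.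

(** A code is the least triple with the given elements. *)
Lemma fincoded_of_triple c0 : istriple Mo c0 ->
  exists c, fincoded Mo c /\ forall x, elt Mo x c <-> elt Mo x c0.
Proof.
  move=> H0.
  pose same c := forall i, i < c0 + c -> (elt Mo i c <-> elt Mo i c0).
  have Hsame c : same c -> forall i, elt Mo i c <-> elt Mo i c0.
    move=> H i; split=> Hi; apply H => //.
      by apply: lt_le_trans (elt_lt _ _ Hi) _; apply: le_add_r.
    by apply: lt_le_trans (elt_lt _ _ Hi) _; apply: le_add_l.
  case: (sigma1_least (fun c => istriple Mo c /\ same c)).
  - rewrite /same; by sigma1.
  - by exists c0; split=> // i.
  - move=> c [[Hc /Hsame Hs] Hmin]; exists c; split=> //; split=> // b Hb Hb' H.
    by apply: (Hmin b Hb); split=> // i _; rewrite H.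
Qed.

Lemma finite_set (P : M -> Prop) b : IsDelta1 (fun e => P (e 0%nat)) ->
  exists c, fincoded Mo c /\ forall x, elt Mo x c <-> x < b /\ P x.
Proof.
  move=> HP; case: (triple_of_set P b HP) => c0 [/fincoded_of_triple [c [Hc E]] H0].
  by exists c; split=> // x; rewrite E.
Qed.

(** * Recursion *)

(** The main source of functions: search for the least value. *)
Lemma least_value (Q : M -> M -> Prop) : IsDelta1 (fun e => Q (e 0%nat) (e 1%nat)) ->
  (forall x, exists y, Q x y) ->
  exists F : M -> M, Delta1Fun (fun e => F (e 0%nat)) /\
    forall x, Q x (F x) /\ forall y, y < F x -> ~ Q x y.
Proof.
  move=> HQ H.
  have HL x : exists y, Q x y /\ forall z, z < y -> ~ Q x z.
    apply: sigma1_least; last exact: H.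
    by sigma1.
  pose F x := epsilon (inhabits (0 : M)) (fun y => Q x y /\ forall z, z < y -> ~ Q x z).
  have HF x : Q x (F x) /\ forall z, z < F x -> ~ Q x z.
    exact: (epsilon_spec (inhabits (0 : M)) _ (HL x)).
  exists F; split=> //; apply: delta1fun_graph; rewrite /shift.
  apply: (delta1_ext (fun e => Q (e 1%nat) (e 0%nat) /\ forall z, z < e 0%nat -> ~ Q (e 1%nat) z)); last by delta1.
  move=> e; split; last by move->.
  move=> [H1 H2]; have [H3 H4] := HF (e 1%nat).
  case: (lt_total (e 0%nat) (F (e 1%nat))) => [Hl|[//|Hl]]; first by case: (H4 _ Hl).
  by case: (H2 _ Hl).
Qed.

Section Recursion.
Variables (F : M -> M) (a : M).
Hypothesis HF : Delta1Fun (fun e => F (e 0%nat)).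

(** [c] contains the pairs [(i, s i)] for all [i] up to [n], and no other pair with such a
    first component, where [s] is the function with [s 0 = a] and [s (i + 1) = F (s i)]. *)
Definition history (n c : M) : Prop :=
  elt Mo (pair Mo 0 a) c /\ (forall v, v < c -> elt Mo (pair Mo 0 v) c -> v = a) /\
  forall i, i < n -> forall v, v < c -> elt Mo (pair Mo i v) c ->
    elt Mo (pair Mo (i + 1) (F v)) c /\
    forall w, w < c -> elt Mo (pair Mo (i + 1) w) c -> w = F v.

Lemma history_delta1 : IsDelta1 (fun e => history (e 0%nat) (e 1%nat)).
Proof. rewrite /history; by delta1. Qed.
Hint Resolve history_delta1 : definable.

Lemma elt_pair_lt i v c : elt Mo (pair Mo i v) c -> v < c.
Proof. by move/elt_lt; apply: le_lt_trans; apply: le_pair_r. Qed.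

(** Existence and uniqueness of the value at [i] are proved together, for two histories at
    once. *)
Lemma history_agree n c c' : history n c -> history n c' -> forall i, i <= n ->
  exists u, u < c /\ elt Mo (pair Mo i u) c /\ elt Mo (pair Mo i u) c' /\
    (forall v, v < c -> elt Mo (pair Mo i v) c -> v = u) /\
    (forall v, v < c' -> elt Mo (pair Mo i v) c' -> v = u).
Proof.
  move=> [H1 [H2 H3]] [H1' [H2' H3']].
  apply: (sigma1_induction (fun i => i <= n -> exists u, u < c /\ elt Mo (pair Mo i u) c /\ elt Mo (pair Mo i u) c' /\
    (forall v, v < c -> elt Mo (pair Mo i v) c -> v = u) /\
    (forall v, v < c' -> elt Mo (pair Mo i v) c' -> v = u))).
  - by sigma1.
  - by move=> _; exists a; split; first exact: elt_pair_lt H1.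
  - move=> i IH /succ_le_iff Hi; case: (IH (lt_le _ _ Hi)) => u [Hu [E1 [E2 _]]].
    case: (H3 i Hi u Hu E1) => E3 U3.
    case: (H3' i Hi u (elt_pair_lt _ _ _ E2) E2) => E4 U4.
    by exists (F u); split; first exact: elt_pair_lt E3.
Qed.

(** Pairs with too large a first component are removed from a history before it is
    prolonged. *)
Lemma history_exists n : exists c v, history n c /\ elt Mo (pair Mo n v) c.
Proof.
  move: n; apply: (sigma1_induction (fun n => exists c v, history n c /\ elt Mo (pair Mo n v) c)).
  - by sigma1.
  - case: (finite_set (fun x => x = pair Mo 0 a) (pair Mo 0 a + 1)); first by delta1.
    move=> c [_ Hc]; have E : elt Mo (pair Mo 0 a) c by apply/Hc; split=> //; apply: lt_succ.
    exists c, a; split=> //; split=> //; split; last by move=> i /not_lt_0.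
    by move=> v _ /Hc [_ /pair_inj []].
  - move=> n [c [v [Hh Hv]]].
    case: (history_agree _ _ _ Hh Hh _ (le_refl n)) => v' [_ [Ev' [_ [Uv _]]]].
    have {}Uv : forall w, elt Mo (pair Mo n w) c -> w = v.
      move=> w Hw; rewrite (Uv w (elt_pair_lt _ _ _ Hw) Hw).
      by rewrite (Uv v (elt_pair_lt _ _ _ Hv) Hv).
    pose P z := (exists i, i <= n /\ exists w, w <= z /\ z = pair Mo i w /\ elt Mo z c) \/
      z = pair Mo (n + 1) (F v).
    have HP : IsDelta1 (fun e => P (e 0%nat)) by rewrite /P; delta1.
    case: (finite_set P (c + pair Mo (n + 1) (F v) + 1) HP) => c' [_ Hc'].
    have old i w : i <= n -> (elt Mo (pair Mo i w) c' <-> elt Mo (pair Mo i w) c).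
      move=> Hi; rewrite Hc'; split.
        move=> [_ [[j [_ [u [_ [_ //]]]]]|/pair_inj [E _]]].
        by case: (lt_irrefl n); apply/succ_le_iff; rewrite -E.
      move=> H; split.
        apply: lt_trans (elt_lt _ _ H) _; apply/lt_succ_iff; exact: le_add_l.
      left; exists i; split=> //; exists w; split=> //; exact: le_pair_r.
    have new w : elt Mo (pair Mo (n + 1) w) c' <-> w = F v.
      rewrite Hc'; split.
        move=> [_ [[j [Hj [u [_ [/pair_inj [E _] _]]]]]|/pair_inj [_ //]]].
        by case: (lt_irrefl n); apply/succ_le_iff; rewrite E.
      by move=> ->; split; [apply/lt_succ_iff; apply: le_add_r|right].
    exists c', (F v); split; last by apply/new.
    case: Hh => [H1 [H2 H3]]; split; first by apply/old => //; apply: le_0.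
    split.
      by move=> w _ /(old 0 w (le_0 n)) Hw; apply: H2 => //; apply: elt_pair_lt Hw.
    move=> i /lt_succ_iff Hi w _ /(old i w Hi) Hw.
    case: Hi => [Hi|Ei].
      have Hi' : i + 1 <= n by apply/succ_le_iff.
      case: (H3 i Hi w (elt_pair_lt _ _ _ Hw) Hw) => E U; split; first by apply/old.
      by move=> u _ /(old _ _ Hi') Hu; apply: U => //; apply: elt_pair_lt Hu.
    rewrite Ei in Hw *; rewrite (Uv w Hw); split; first by apply/new.
    by move=> u _ /new.
Qed.

Theorem primitive_recursion :
  exists s : M -> M, Delta1Fun (fun e => s (e 0%nat)) /\ s 0 = a /\ forall n, s (n + 1) = F (s n).
Proof.
  pose G n v := exists c, history n c /\ elt Mo (pair Mo n v) c.
  have GU n v w : G n v -> G n w -> v = w.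
    move=> [c [Hc Ec]] [c' [Hc' Ec']].
    case: (history_agree _ _ _ Hc Hc' _ (le_refl n)) => u [_ [_ [_ [U U']]]].
    by rewrite (U v (elt_pair_lt _ _ _ Ec) Ec) (U' w (elt_pair_lt _ _ _ Ec') Ec').
  pose s n := epsilon (inhabits (0 : M)) (G n).
  have Hs n : G n (s n).
    apply: (epsilon_spec (inhabits (0 : M)) (G n)).
    by case: (history_exists n) => c [v H]; exists v, c.
  exists s; split; [|split].
  - rewrite /Delta1Fun /shift; apply: (sigma1_ext (fun e => G (e 1%nat) (e 0%nat))).
      move=> e; split=> [H|->]; [exact: GU H (Hs _)|exact: Hs].
    rewrite /G; by sigma1.
  - case: (Hs 0) => c [[H1 [H2 _]] H]; exact: H2 (elt_pair_lt _ _ _ H) H.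
  - move=> n; case: (Hs (n + 1)) => c [Hc H].
    have Hc' : history n c.
      case: Hc => [H1 [H2 H3]]; split=> //; split=> // i Hi; apply: H3.
      exact: lt_trans Hi (lt_succ n).
    case: (history_agree _ _ _ Hc' Hc' _ (le_refl n)) => u [Hu [Eu _]].
    have -> : s n = u by apply: GU (Hs n) _; exists c.
    case: Hc => [_ [_ H3]]; case: (H3 n (lt_succ n) u Hu Eu) => _; apply=> //.
    exact: elt_pair_lt H.
Qed.

End Recursion.

Lemma increasing_mono (s : M -> M) : Delta1Fun (fun e => s (e 0%nat)) ->
  (forall n, s n < s (n + 1)) -> forall m n, m < n -> s m < s n.
Proof.
  move=> Hs H m n /lt_iff [z ->]; move: z.
  apply: (sigma1_induction (fun z => s m < s (m + z + 1))); first by sigma1.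
    by rewrite add0.
  move=> z Hz; apply: lt_trans Hz _.
  have -> : m + (z + 1) + 1 = (m + z + 1) + 1 by ring.
  exact: H.
Qed.

Lemma increasing_ge (s : M -> M) : Delta1Fun (fun e => s (e 0%nat)) ->
  (forall n, s n < s (n + 1)) -> forall n, n <= s n.
Proof.
  move=> Hs H; apply: (sigma1_induction (fun n => n <= s n)); first by sigma1.
    exact: le_0.
  move=> n IH; apply/succ_le_iff; exact: le_lt_trans IH (H n).
Qed.

(** The subsequence is found by primitive recursion, each term being the least possible
    successor of the previous one. *)
Lemma subsequence (R : M -> M -> Prop) a : IsDelta1 (fun e => R (e 0%nat) (e 1%nat)) ->
  (forall x, exists y, x < y /\ R x y) ->
  exists s : M -> M, Delta1Fun (fun e => s (e 0%nat)) /\ s 0 = a /\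
    (forall m n, m < n -> s m < s n) /\ forall n, R (s n) (s (n + 1)).
Proof.
  move=> HR H.
  case: (least_value (fun x y => x < y /\ R x y)) => [||F [HF HF']] //.
    by delta1.
  case: (primitive_recursion F a HF) => s [Hs [H0 HS]]; exists s; split=> //; split=> //.
  split=> [|n]; last by rewrite HS; case: (HF' (s n)) => -[].
  by apply: increasing_mono => // n; rewrite HS; case: (HF' (s n)) => -[].
Qed.

(** * The pigeonhole principle *)

(** The finite set [c] relates each [i] up to [b] to some number below [b], and no two of
    them to the same one. *)
Definition injects (b c : M) : Prop :=
  (forall i, i <= b -> exists v, v < b /\ elt Mo (pair Mo i v) c) /\
  forall i, i <= b -> forall j, j < i -> forall v, v < b ->
    elt Mo (pair Mo i v) c -> ~ elt Mo (pair Mo j v) c.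

(** A relation from [b + 2] points into [b + 1] points yields one from [b + 1] into [b]
    points: whatever is sent to [b] is sent where [b + 1] goes instead.  The induction is
    over all codes of relations at once, hence [Pi^0_1]. *)
Lemma finite_pigeonhole b c : ~ injects b c.
Proof.
  move: b c; apply: (pi1_induction (fun b => forall c, ~ injects b c)).
  - apply: (sigma1_ext (fun e => exists c, injects (e 0%nat) c)).
      move=> e; split; first by move=> [c Hc] H; apply: H Hc.
      by move=> H; apply: NNPP => H'; apply: H => c Hc; apply: H'; exists c.
    rewrite /injects; by sigma1.
  - by move=> c [H _]; case: (H 0 (le_refl _)) => v [/not_lt_0].
  - move=> b IH c [Htot Hinj].
    have inj i j v : i <= b + 1 -> j < i -> v <= b ->
        elt Mo (pair Mo i v) c -> elt Mo (pair Mo j v) c -> False.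
      by move=> Hi Hj Hv H1 H2; apply: (Hinj i Hi j Hj v _ H1 H2); apply/lt_succ_iff.
    pose P z := exists i, i <= b /\ exists v, v < b /\ z = pair Mo i v /\
      (elt Mo (pair Mo i v) c \/ (elt Mo (pair Mo i b) c /\ elt Mo (pair Mo (b + 1) v) c)).
    have HP : IsDelta1 (fun e => P (e 0%nat)) by rewrite /P; delta1.
    case: (finite_set P (pair Mo b b + 1) HP) => c' [_ Hc'].
    have Hc'' i v : i <= b -> v < b -> elt Mo (pair Mo i v) c' <->
        elt Mo (pair Mo i v) c \/ (elt Mo (pair Mo i b) c /\ elt Mo (pair Mo (b + 1) v) c).
      move=> Hi Hv; rewrite Hc' lt_succ_iff; split.
        by move=> [_ [j [_ [w [_ [/pair_inj [-> ->] //]]]]]].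
      move=> H; split; first by apply: le_pair_mono => //; left.
      by exists i; split=> //; exists v.
    apply: (IH c'); split.
      move=> i Hi; case: (Htot i); first by left; apply/lt_succ_iff.
      move=> v [/lt_succ_iff [Hv|Ev] E]; first by exists v; split=> //; apply/Hc''=> //; left.
      case: (Htot (b + 1) (le_refl _)) => w [/lt_succ_iff [Hw|Ew] E'].
        exists w; split=> //; apply/Hc'' => //; right; split=> //; by rewrite -Ev.
      have E1 : elt Mo (pair Mo (b + 1) b) c by rewrite -{2}Ew.
      have E2 : elt Mo (pair Mo i b) c by rewrite -Ev.
      by case: (inj (b + 1) i b (le_refl _) _ (le_refl _) E1 E2); apply/lt_succ_iff.
    move=> i Hi j Hj v Hv /(Hc'' i v Hi Hv) H1 /(Hc'' j v _ Hv) H2.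
    have Hjb : j <= b by left; apply: lt_le_trans Hj Hi.
    have Hib : i <= b + 1 by left; apply/lt_succ_iff.
    have Hv' : v <= b by left.
    have [H1l|[H1l H1r]] := H1; have [H2l|[H2l H2r]] := H2 Hjb.
    + exact: (inj i j v).
    + by apply: (inj (b + 1) i v) => //; [exact: le_refl|apply/lt_succ_iff].
    + by apply: (inj (b + 1) j v) => //; [exact: le_refl|apply/lt_succ_iff].
    + by apply: (inj i j b) => //; exact: le_refl.
Qed.

Lemma injective_unbounded (h : M -> M) : Delta1Fun (fun e => h (e 0%nat)) ->
  (forall i j, j < i -> h i <> h j) -> forall b, exists i, b <= h i.
Proof.
  move=> Hh Hinj b; apply: NNPP => Hn.
  have Hb i : h i < b by apply/not_le => H; apply: Hn; exists i.
  pose P z := exists i, i <= b /\ z = pair Mo i (h i).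
  have HP : IsDelta1 (fun e => P (e 0%nat)) by rewrite /P; delta1.
  case: (finite_set P (pair Mo b b + 1) HP) => c [_ Hc].
  apply: (finite_pigeonhole b c); split.
    move=> i Hi; exists (h i); split=> //; apply/Hc; split; last by exists i.
    by apply/lt_succ_iff; apply: le_pair_mono => //; left.
  move=> i Hi j Hj v Hv /Hc [_ [i' [_ /pair_inj [<- E1]]]] /Hc [_ [j' [_ /pair_inj [<- E2]]]].
  by apply: (Hinj i j Hj); rewrite -E1.
Qed.

(** * Sets as functions *)

Lemma function_of_set f B : isfun Mo f (univcl Mo) B ->
  exists g : M -> M, Delta1Fun (fun e => g (e 0%nat)) /\ (forall x, B (g x)) /\
    forall x y, pair Mo x y in f <-> y = g x.
Proof.
  move=> [H1 H2].
  pose g x := epsilon (inhabits (0 : M)) (fun y => pair Mo x y in f).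
  have Hg x y : pair Mo x y in f <-> y = g x.
    case: (H2 x eq_refl) => z [Hz Hu].
    have Hgx : pair Mo x (g x) in f.
      by apply: (epsilon_spec (inhabits (0 : M)) (fun y => pair Mo x y in f)); exists z.
    split; last by move->.
    by move=> /Hu ->; rewrite (Hu _ Hgx).
  exists g; split; [|split] => //.
  - apply: delta1fun_graph; rewrite /shift.
    by apply: (delta1_ext (fun e => pair Mo (e 1%nat) (e 0%nat) in f)); [move=> e; apply: Hg|delta1].
  - move=> x; have /H1 [x' [y' [/pair_inj [_ ->] [_ H]]]] : pair Mo x (g x) in f by apply/Hg.
    exact: H.
Qed.

Lemma set_of_function (g : M -> M) (B : M -> Prop) : Delta1Fun (fun e => g (e 0%nat)) ->
  (forall x, B (g x)) -> exists f, isfun Mo f (univcl Mo) B /\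
    forall x y, pair Mo x y in f <-> y = g x.
Proof.
  move=> Hg HB.
  case: (delta_comprehension (fun p => exists x, x <= p /\ p = pair Mo x (g x))); first by delta1.
  move=> f Hf.
  have Hf' x y : pair Mo x y in f <-> y = g x.
    rewrite Hf; split; first by move=> [x' [_ /pair_inj [-> ->]]].
    by move=> ->; exists x; split=> //; apply: le_pair_l.
  exists f; split=> //; split.
    by move=> p /Hf [x [_ ->]]; exists x, (g x); split.
  by move=> x _; exists (g x); split; [apply/Hf'|move=> z /Hf'].
Qed.

(** Being a wqo, for definable orders and without coded functions. *)
Definition good (D : M -> Prop) (R : M -> M -> Prop) : Prop :=
  forall g : M -> M, Delta1Fun (fun e => g (e 0%nat)) -> (forall n, D (g n)) ->
    exists m n, m < n /\ R (g m) (g n).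

Lemma iswqo_good Q L : iswqo Mo Q L <->
  quasiorder Mo Q L /\ good (fun x => x in Q) (fun x y => pair Mo x y in L).
Proof.
  split=> -[HQ H]; split=> //.
    move=> g Hg HD; case: (set_of_function g (fun x => x in Q) Hg HD) => f [Hf E].
    case: (H f Hf) => m [n [Hmn [a [b [/E -> [/E -> Hab]]]]]]; by exists m, n.
  move=> f /function_of_set [g [Hg [HD E]]].
  case: (H g Hg HD) => m [n [Hmn Hab]].
  by exists m, n; split=> //; exists (g m), (g n); split; [|split]; rewrite ?E.
Qed.

(** * Arithmetical comprehension *)

Definition Sigma1Comprehension : Prop := forall P : M -> Prop, IsSigma1 (fun e => P (e 0%nat)) ->
  exists X, forall x, x in X <-> P x.

Definition depends (k : nat) (P : env -> Prop) : Prop :=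
  forall e e', (forall i, (i < k)%nat -> e i = e' i) -> P e <-> P e'.

(** A formula mentions finitely many variables only. *)
Lemma sigma1_depends P : IsSigma1 P -> exists k, depends k P.
Proof.
  move=> [Q [[A [v [d [_ HQ]]]] HP]].
  have [k Hk] : exists k, forall i, (i < num_bound A)%nat -> forall j, v i = inl j -> (j < k)%nat.
    elim: (num_bound A) => [|n [k Hk]]; first by exists 0%nat => i; lia.
    exists (match v n with inl j => k + S j | inr _ => k end)%nat => i Hi j Hj.
    have [Hin|Ei] : (i < n)%nat \/ i = n by lia.
      by have := Hk i Hin j Hj; case: (v n) => *; lia.
    by rewrite -Ei Hj; lia.
  exists k => e e' He; rewrite !HP.
  have E y : Q (scons y e) <-> Q (scons y e').
    rewrite !HQ; apply: sat_agree => // i Hi.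
    by case Ei: (v i) => [[|j]|a] //=; apply: He; have := Hk i Hi _ Ei; lia.
  by split; move=> [y /E Hy]; exists y.
Qed.

(** Pairing reduces a predicate of several variables to one of a single variable. *)
Lemma comprehension_complement_depends k : Sigma1Comprehension -> forall P, IsSigma1 P -> depends k P -> IsSigma1 (fun e => ~ P e).
Proof.
  move=> HC; case: k => [|k].
    move=> P HP Hk; apply: (sigma1_ext (fun _ => ~ P (fun _ => 0))); last by sigma1.
    by move=> e; rewrite (Hk e (fun _ => 0)) // => i; lia.
  elim: k => [|k IH] P HP Hk.
    case: (HC (fun x => P (fun _ => x)) (sigma1_ren (fun _ => 0%nat) _ HP)) => X HX.
    apply: (sigma1_ext (fun e => ~ e 0%nat in X)); last by sigma1.
    by move=> e; rewrite HX (Hk e (fun _ => e 0%nat)) // => -[|i] //; lia.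
  pose P' e := exists x y, e 0%nat = pair Mo x y /\ P (scons x (scons y (shift e))).
  have HP' : IsSigma1 P'.
    apply: (sigma1_ex (fun x e => exists y, e 0%nat = pair Mo x y /\ P (scons x (scons y (shift e))))).
    apply: (sigma1_ex (fun y e => (shift e) 0%nat = pair Mo (e 0%nat) y /\
      P (scons (e 0%nat) (scons y (shift (shift e)))))).
    apply: sigma1_and; first by sigma1.
    pose f i := match i with 0%nat => 1%nat | 1%nat => 0%nat | S (S i) => S (S (S i)) end.
    apply: sigma1_ext (sigma1_ren f _ HP) => e.
    suff -> : (fun i => e (f i)) =
      scons (shift e 0%nat) (scons (e 0%nat) (shift (shift (shift e)))) by [].
    by apply: functional_extensionality; case=> [|[|i]].
  have {}IH : IsSigma1 (fun e => ~ P' e).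
  { apply: IH => // e e' He.
    split; move=> [x [y [E H]]]; exists x, y; split.
    - by rewrite -He //; lia.
    - by move: H; apply Hk => -[|[|i]] //= Hi; rewrite /shift He //; lia.
    - by rewrite He //; lia.
    - by move: H; apply Hk => -[|[|i]] //= Hi; rewrite /shift He //; lia. }
  apply: (sigma1_ext (fun e => ~ P' (scons (pair Mo (e 0%nat) (e 1%nat)) (shift (shift e))))).
    move=> e; have Ee : e = scons (e 0%nat) (scons (e 1%nat) (shift (shift e))).
      by apply: functional_extensionality; case=> [|[|i]].
    split=> H H'; apply: H.
      by move: H'; rewrite {1}Ee => H'; exists (e 0%nat), (e 1%nat); split.
    by case: H' => x [y [/= /pair_inj [<- <-] H']]; rewrite Ee.
  apply: (sigma1_app (fun z e => ~ P' (scons z (shift (shift e))))); last by delta1fun.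
  apply: sigma1_ext (sigma1_ren (fun i => match i with 0%nat => 0%nat | S i => S (S (S i)) end) _ IH) => e.
  suff -> : (fun i => e (match i with 0%nat => 0%nat | S i => S (S (S i)) end)) =
    scons (e 0%nat) (shift (shift (shift e))) by [].
  by apply: functional_extensionality; case.
Qed.

Lemma comprehension_complement : Sigma1Comprehension -> Sigma1Complement.
Proof. by move=> HC P HP; case: (sigma1_depends P HP) => k; apply: comprehension_complement_depends. Qed.

Lemma Delta0_arithmetical A : Delta0 A -> arithmetical A.
Proof. by elim=> {A}. Qed.

(** Arithmetical comprehension enters through its instances for [Sigma^0_1] formulas. *)
Lemma ACA0_complement : models Mo ACA0 -> Sigma1Complement.
Proof.
  move=> H; apply: comprehension_complement => P /sigma1_formula [A [e [d [HA E]]]].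
  have HE : arithmetical (ExN A) by split=> //; split=> //; apply: Delta0_arithmetical.
  have /sat_comprehension [X HX] := H _ (ACA0_comprehension _ HE) e d.
  by exists X => x; rewrite HX E.
Qed.

(** By induction on an arithmetical formula the predicate that it defines is
    [Delta^0_1], each quantifier being absorbed by [Sigma1Complement]. *)
Lemma complement_ACA0 : Sigma1Complement -> models Mo ACA0.
Proof.
  move=> HN A [{}A HA|{}A HA] e d; first exact: HM.
  have HS : IsSigma1 (fun e => sat Mo e d A).
  { elim: A HA {e} => [s t|s t|t X||A IHA B IHB|A IHA|//] /=.
    - by move=> _; apply: delta0_sigma1; exact: (delta0_eq s t (fun i => inl i)).
    - by move=> _; apply: delta0_sigma1; exact: (delta0_lt s t (fun i => inl i)).
    - by move=> _; apply: delta0_sigma1; exact: (delta0_mem t (d X) (fun i => inl i)).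
    - by move=> _; apply: delta0_sigma1; exact: delta0_false.
    - move=> [/IHA HA /IHB HB]; apply: delta1_sigma1; apply: delta1_imp; split=> //; exact: HN.
    - move=> /IHA HA; apply: delta1_sigma1; apply: (delta1_all (fun x e => sat Mo (scons x e) d A)) => //.
      have HA' : IsSigma1 (fun e => sat Mo (scons (e 0%nat) (shift e)) d A).
        apply: sigma1_ext HA => e; suff -> : scons (e 0%nat) (shift e) = e by [].
        by apply: functional_extensionality; case.
      by split=> //; apply: HN. }
  apply/sat_comprehension; apply: (delta_comprehension (fun x => sat Mo (scons x e) d A)).
  pose p i : nat + M := match i with 0%nat => inl 0%nat | S i => inr (e i) end.
  have HS' : IsSigma1 (fun e' => sat Mo (scons (e' 0%nat) e) d A).
    apply: sigma1_ext (sigma1_sub p _ HS) => e'.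
    suff -> : (fun i => place e' (p i)) = scons (e' 0%nat) e by [].
    by apply: functional_extensionality; case.
  by split=> //; apply: HN.
Qed.

(** The value and the witness that it is one are bounded together. *)
Lemma sigma1_collection (Q : M -> M -> Prop) b : IsSigma1 (fun e => Q (e 0%nat) (e 1%nat)) ->
  (forall x, x < b -> exists y, Q x y) ->
  exists w, forall x, x < b -> exists y, y < w /\ Q x y.
Proof.
  move=> [R [HR HQ]] Hb.
  have E x y : Q x y <-> exists z, R (scons z (scons x (fun _ => y))).
    exact: (HQ (scons x (fun _ => y))).
  case: (collection (fun x w => exists y, y < w /\ exists z, z < w /\ R (scons z (scons x (fun _ => y)))) b).
  - apply: (delta0_ex 1 (fun y e => exists z, z < e 1%nat /\ R (scons z (scons (e 0%nat) (fun _ => y))))).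
    apply: (delta0_ex 2 (fun z e => R (scons z (scons (e 1%nat) (fun _ => e 0%nat))))).
    pose f i := match i with 0%nat => 0%nat | 1%nat => 2%nat | _ => 1%nat end.
    apply: delta0_ext (delta0_ren f _ HR) => e.
    suff -> : (fun i => e (f i)) = scons (e 0%nat) (scons (shift e 1%nat) (fun _ => shift e 0%nat)) by [].
    by apply: functional_extensionality; case=> [|[|i]].
  - move=> x /Hb [y /E [z Hz]]; exists (y + z + 1), y; split.
      by apply/lt_succ_iff; apply: le_add_l.
    by exists z; split=> //; apply/lt_succ_iff; apply: le_add_r.
  - move=> w Hw; exists w => x /Hw [w' [Hw' [y [Hy [z [_ Hz]]]]]].
    exists y; split; first exact: lt_trans Hy Hw'.
    by apply/E; exists z.
Qed.

(** * Finite subsets of a well-quasi-order *)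

Definition flat_le (R : M -> M -> Prop) (a b : M) : Prop :=
  forall x, elt Mo x a -> exists y, elt Mo y b /\ R x y.

Lemma flat_le_delta1 R : IsDelta1 (fun e => R (e 0%nat) (e 1%nat)) ->
  IsDelta1 (fun e => flat_le R (e 0%nat) (e 1%nat)).
Proof.
  move=> HR; apply: (delta1_ext (fun e => forall x, x < e 0%nat -> elt Mo x (e 0%nat) ->
    exists y, y < e 1%nat /\ elt Mo y (e 1%nat) /\ R x y)); last by delta1.
  move=> e; split=> H x.
    by move=> Hx; case: (H x (elt_lt _ _ Hx) Hx) => y [_ Hy]; exists y.
  by move=> _ Hx; case: (H x Hx) => y [Hy HR']; exists y; split=> //; apply: elt_lt Hy.
Qed.

Lemma pfin_delta1 D : IsDelta1 (fun e => D (e 0%nat)) -> IsDelta1 (fun e => pfin Mo D (e 0%nat)).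
Proof.
  move=> HD; apply: (delta1_ext (fun e => fincoded Mo (e 0%nat) /\
    forall x, x < e 0%nat -> elt Mo x (e 0%nat) -> D x)); last by delta1.
  move=> e; split=> -[H1 H2]; split=> // x; last by move=> _; apply: H2.
  by move=> Hx; apply: H2 => //; apply: elt_lt.
Qed.
Hint Resolve flat_le_delta1 pfin_delta1 : definable.

Lemma pair_split (g : M -> M) : Delta1Fun (fun e => g (e 0%nat)) ->
  (forall n, exists a b, g n = pair Mo a b) ->
  exists u v : M -> M, Delta1Fun (fun e => u (e 0%nat)) /\ Delta1Fun (fun e => v (e 0%nat)) /\
    forall n, g n = pair Mo (u n) (v n).
Proof.
  move=> Hg H.
  have bound n a b : g n = pair Mo a b -> a <= g n /\ b <= g n.
    by move=> ->; split; [apply: le_pair_l|apply: le_pair_r].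
  case: (least_value (fun n a => exists b, b <= g n /\ g n = pair Mo a b)); first by delta1.
    by move=> n; case: (H n) => a [b E]; exists a, b; split=> //; case: (bound n a b E).
  move=> u [Hu HU].
  case: (least_value (fun n b => g n = pair Mo (u n) b)); first by delta1.
    by move=> n; case: (HU n) => -[b [_ E]] _; exists b.
  move=> v [Hv HV]; exists u, v; split=> //; split=> // n; by case: (HV n).
Qed.

Section Forward.
Hypothesis HN : Sigma1Complement.

Section FlatGood.
Variables (D : M -> Prop) (R : M -> M -> Prop).
Hypotheses (HD : IsDelta1 (fun e => D (e 0%nat))) (HR : IsDelta1 (fun e => R (e 0%nat) (e 1%nat))).
Variable A : M -> M.
Hypothesis HA : Delta1Fun (fun e => A (e 0%nat)).
Hypothesis HAD : forall n, pfin Mo D (A n).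
Hypothesis Abad : forall m n, m < n -> ~ flat_le R (A m) (A n).

(** The construction behind [flat_good]: a state is a pair of the element chosen last and
    the set [s] of all elements chosen so far, and [s] has to be extendible. *)
Definition avoids (s n : M) : Prop :=
  forall a, elt Mo a s -> forall y, elt Mo y (A n) -> ~ R a y.
Definition extendible (s : M) : Prop := forall b, exists n, b < n /\ avoids s n.
Definition extends (z z' : M) : Prop :=
  forall a s, z = pair Mo a s -> extendible s -> exists n a' s', z' = pair Mo a' s' /\
    avoids s n /\ elt Mo a' (A n) /\ extendible s' /\
    forall x, elt Mo x s' <-> elt Mo x s \/ x = a'.

Lemma avoids_delta1 : IsDelta1 (fun e => avoids (e 0%nat) (e 1%nat)).
Proof. rewrite /avoids; by delta1. Qed.
Hint Resolve avoids_delta1 : definable.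
Lemma extendible_delta1 : IsDelta1 (fun e => extendible (e 0%nat)).
Proof. rewrite /extendible; by delta1. Qed.
Hint Resolve extendible_delta1 : definable.
Lemma extends_delta1 : IsDelta1 (fun e => extends (e 0%nat) (e 1%nat)).
Proof. rewrite /extends; by delta1. Qed.

Lemma insert_finite s a : exists s', fincoded Mo s' /\
  forall x, elt Mo x s' <-> elt Mo x s \/ x = a.
Proof.
  case: (finite_set (fun x => elt Mo x s \/ x = a) (s + a + 1)); first by delta1.
  move=> s' [Hf Hs']; exists s'; split=> // x; rewrite Hs'; split; first by case.
  move=> H; split=> //; case: H => [/elt_lt H|->]; last by apply/lt_succ_iff; apply: le_add_r.
  apply: lt_trans H _; apply/lt_succ_iff; exact: le_add_l.
Qed.

(** Each later [A n'] that [s] avoids is also avoided by some element of [A n], by badness.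
    If none of these elements could be added, each would avoid [A n'] only for [n'] up to
    some bound; a common bound for the finitely many elements gives a contradiction. *)
Lemma extendible_step s : extendible s -> exists n a s', avoids s n /\ elt Mo a (A n) /\
  extendible s' /\ forall x, elt Mo x s' <-> elt Mo x s \/ x = a.
Proof.
  move=> Hs; case: (Hs 0) => n [_ Hn]; apply: NNPP => Hno.
  pose Q a b := ~ elt Mo a (A n) \/
    forall n', b < n' -> avoids s n' -> exists y, elt Mo y (A n') /\ R a y.
  case: (sigma1_collection Q (A n)).
  - apply: delta1_sigma1; rewrite /Q; by delta1.
  - move=> a _; case: (classic (elt Mo a (A n))) => Ha; last by exists 0; left.
    case: (insert_finite s a) => s' [_ Hs'].
    apply: NNPP => HnQ; apply: Hno; exists n, a, s'; split=> //; split=> //; split=> // b.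
    apply: NNPP => Hb; apply: HnQ; exists b; right=> n' Hn' Hav.
    apply: NNPP => Hy; apply: Hb; exists n'; split=> // x /Hs' [Hx|->]; first exact: Hav.
    by move=> y Hy1 Hy2; apply: Hy; exists y.
  - move=> w Hw; case: (Hs (w + n)) => n' [Hn' Hav].
    apply: (Abad n n'); first by apply: le_lt_trans Hn'; apply: le_add_r.
    move=> a Ha; case: (Hw a (elt_lt _ _ Ha)) => b [Hb [//|H]]; apply: H => //.
    apply: lt_trans Hb _; apply: le_lt_trans Hn'; exact: le_add_l.
Qed.

(** The element chosen last avoids all sets from which later elements are taken, so it is
    below none of them. *)
Lemma flat_bad_sequence : exists g : M -> M, Delta1Fun (fun e => g (e 0%nat)) /\
  (forall n, D (g n)) /\ forall m n, m < n -> ~ R (g m) (g n).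
Proof.
  case: (least_value extends extends_delta1).
    move=> z; case: (classic (exists a s, z = pair Mo a s /\ extendible s)).
      move=> [a [s [E /extendible_step [n [a' [s' [H1 [H2 [H3 H4]]]]]]]]].
      exists (pair Mo a' s') => a1 s1; rewrite E => /pair_inj [_ <-] _.
      by exists n, a', s'.
    by move=> H; exists 0 => a s E Hs; case: H; exists a, s.
  move=> F [HF HF'].
  case: (finite_set (fun _ => False) 0); first by delta1.
  move=> s0 [_ Hs0].
  case: (primitive_recursion F (pair Mo 0 s0) HF) => z [Hz [Hz0 HzS]].
  have inv n : exists a s, z n = pair Mo a s /\ extendible s.
  { move: n; apply: (sigma1_induction (fun n => exists a s, z n = pair Mo a s /\ extendible s)).
    - by apply: delta1_sigma1; delta1.
    - exists 0, s0; split=> // b; exists (b + 1); split; first exact: lt_succ.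
      by move=> a /Hs0 [].
    - move=> n [a [s [E Hs]]]; case: (proj1 (HF' (z n)) a s E Hs) => k [a' [s' [E' [_ [_ [Hs' _]]]]]].
      by exists a', s'; split=> //; rewrite HzS. }
  case: (pair_split z Hz).
    by move=> n; case: (inv n) => a [s [E _]]; exists a, s.
  move=> u [v [Hu [Hv E]]].
  have Hext n : extendible (v n).
    by case: (inv n) => a [s [Ez Hs]]; move: Ez; rewrite E => /pair_inj [_ ->].
  have step n : exists k, avoids (v n) k /\ elt Mo (u (n + 1)) (A k) /\
      forall x, elt Mo x (v (n + 1)) <-> elt Mo x (v n) \/ x = u (n + 1).
    case: (proj1 (HF' (z n)) _ _ (E n) (Hext n)) => k [a' [s' [E' [H1 [H2 [_ H3]]]]]].
    by exists k; move: E'; rewrite -HzS E => /pair_inj [-> ->].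
  have mem m n : elt Mo (u (m + 1)) (v (m + n + 1)).
  { move: n; apply: (sigma1_induction (fun n => elt Mo (u (m + 1)) (v (m + n + 1)))).
    - by apply: delta1_sigma1; delta1.
    - by rewrite add0; case: (step m) => k [_ [_ ->]]; right.
    - move=> n Hn; have -> : m + (n + 1) + 1 = (m + n + 1) + 1 by ring.
      by case: (step (m + n + 1)) => k [_ [_ ->]]; left. }
  exists (fun n => u (n + 1)); split; [by delta1fun|split].
    move=> n; case: (step n) => k [_ [H _]]; by apply: (proj2 (HAD k)).
  move=> m n /lt_iff [d Ed] HRmn; case: (step n) => k [Hk [H _]].
  by apply: (Hk (u (m + 1)) _ _ H HRmn); rewrite Ed.
Qed.

End FlatGood.

Theorem flat_good D R : IsDelta1 (fun e => D (e 0%nat)) -> IsDelta1 (fun e => R (e 0%nat) (e 1%nat)) ->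
  good D R -> good (pfin Mo D) (flat_le R).
Proof.
  move=> HD HR HG A HA HAD; apply: NNPP => Hn.
  case: (flat_bad_sequence D R HR A HA HAD).
    by move=> m n Hmn H; apply: Hn; exists m, n.
  move=> g [Hg [HgD Hbad]]; case: (HG g Hg HgD) => m [n [Hmn H]].
  exact: Hbad H.
Qed.

(** ** Noetherian spaces from well-quasi-orders *)

(** If the open sets grew forever, there would be pieces [W p c] of basic open sets entering
    at later and later stages, with [c] above no index of a piece that entered before: a bad
    sequence.  Otherwise all pieces are contained in pieces that enter up to some stage [N]. The
    argument never selects points, which are sets in two of the spaces. The
    relation [T] allows a basic open set to be a union of several pieces. *)
Lemma noetherian_of_good {P : Type} (point : P -> Prop) (index : M -> Prop)
    (basic : P -> M -> Prop) (D : M -> Prop) (R T : M -> M -> Prop) (W : P -> M -> Prop) :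
  (forall p, point p -> IsDelta1 (fun e => basic p (e 0%nat))) ->
  IsDelta1 (fun e => R (e 0%nat) (e 1%nat)) -> IsDelta1 (fun e => T (e 0%nat) (e 1%nat)) ->
  good D R -> (forall i c, index i -> T i c -> D c) ->
  (forall p i, point p -> index i -> basic p i <-> exists c, T i c /\ W p c) ->
  (forall p c c', point p -> D c -> D c' -> R c c' -> W p c' -> W p c) ->
  noetherian Mo point index basic.
Proof.
  move=> Hbasic HR HT HG HTD HTW HW g [Hg1 Hg2] Hdec.
  have Hidx n m z i : pair Mo (pair Mo n m) z in g -> elt Mo i z -> index i.
    by move=> /Hg1 [x [y [/pair_inj [_ ->] [_ [_ H]]]]]; apply: H.
  pose E n c := exists m z i, pair Mo (pair Mo n m) z in g /\ elt Mo i z /\ T i c.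
  have HE : IsDelta1 (fun e => E (e 0%nat) (e 1%nat)) by rewrite /E; delta1.
  have [N HNE] : exists N, forall n c, E n c -> exists n' c', n' <= N /\ E n' c' /\ R c' c.
  { apply: NNPP => Hno.
    case: (least_value (fun N z => exists n c, z = pair Mo n c /\ E n c /\
      forall n', n' <= N -> forall c', E n' c' -> ~ R c' c)); first by delta1.
      move=> N; apply: NNPP => HnN; apply: Hno; exists N => n c Hnc.
      apply: NNPP => HnR; apply: HnN; exists (pair Mo n c), n, c; split=> //; split=> //.
      by move=> n' Hn' c' Hc' HR'; apply: HnR; exists n', c'.
    move=> F [HF HF'].
    case: (primitive_recursion (fun x => F x + x + 1) 0); first by delta1fun.
    move=> z [Hz [_ HzS]].
    case: (pair_split (fun n => F (z n))); first by delta1fun.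
      by move=> n; case: (HF' (z n)) => -[a [b [Eab _]]] _; exists a, b.
    move=> u [v [Hu [Hv Euv]]].
    have HEv n : E (u n) (v n) /\ forall n', n' <= z n -> forall c', E n' c' -> ~ R c' (v n).
      by case: (HF' (z n)) => -[a [b [Eab Hab]]] _; move: Eab; rewrite Euv => /pair_inj [-> ->].
    case: (HG v Hv).
      move=> n; case: (HEv n) => -[m [c [i [H1 [H2 H3]]]]] _.
      exact: HTD (Hidx _ _ _ _ H1 H2) H3.
    move=> k [l [Hkl HRkl]]; case: (HEv l) => _ H; apply: (H (u k) _ (v k)) => //; last by case: (HEv k).
    have Hmono : z (k + 1) <= z l.
      case/succ_le_iff: (Hkl) => [H'|->]; last exact: le_refl.
      left; apply: (increasing_mono z) => // n; rewrite HzS; apply/lt_succ_iff; exact: le_add_r.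
    apply: le_trans Hmono; rewrite HzS Euv.
    apply: le_trans (le_pair_l _ _) _; rewrite addA; exact: le_add_l. }
  exists N => n Hn p.
  case: (classic (point p)) => Hp; last by split=> -[].
  have Hbp := Hbasic p Hp.
  have Hcl k : IsDelta1 (fun e => ingclosed Mo point basic g (k + e 0%nat) p).
    by rewrite /ingclosed; delta1.
  have mono k l : ingclosed Mo point basic g (k + l) p -> ingclosed Mo point basic g k p.
  { move: l; apply: (sigma1_induction (fun l => ingclosed Mo point basic g (k + l) p ->
      ingclosed Mo point basic g k p)).
    - apply: delta1_sigma1; apply: delta1_imp; [exact: Hcl|exact: delta1_const].
    - by rewrite add0.
    - by move=> l IH H; apply: IH; apply: Hdec; rewrite addA. }
  split.
    by move: Hn => /lt_iff [d ->]; rewrite addA; apply: mono.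
  move=> HpN; split=> // m z Hz i Hi Hb.
  have Hii := Hidx _ _ _ _ Hz Hi.
  case: (proj1 (HTW p i Hp Hii) Hb) => c [HTc HWc].
  case: (HNE n c); first by exists m, z, i.
  move=> n' [c' [Hn' [[m' [z' [i' [H1 [H2 H3]]]]] HRc]]].
  have Hii' := Hidx _ _ _ _ H1 H2.
  have [_ Hcl'] : ingclosed Mo point basic g n' p.
    by case/le_iff: Hn' => d Ed; apply: (mono n' d); rewrite -Ed.
  apply: (Hcl' m' z' H1 i' H2); apply/HTW => //; exists c'; split=> //.
  by apply: (HW p c' c) => //; [apply: HTD H3|apply: HTD HTc].
Qed.

End Forward.

Lemma cnoetherian_noetherian point index basic :
  cnoetherian Mo point index basic <-> noetherian Mo point index basic.
Proof.
  have E : incclosed Mo point basic = ingclosed Mo point basic.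
    apply: functional_extensionality => g; apply: functional_extensionality => n.
    apply: functional_extensionality => x; apply: propositional_extensionality.
    split=> -[Hx H]; split=> //.
      by move=> m c Hc i Hi Hb; apply: H; split=> //; exists m, c; split=> //; exists i.
    by move=> [_ [m [c [Hc [i [Hi Hb]]]]]]; apply: (H m c Hc i Hi).
  by rewrite /cnoetherian E.
Qed.

Section QuasiOrder.
Variables (Q L : sets Mo).
Hypothesis HQ : quasiorder Mo Q L.
Local Notation ord := (setorder Mo Q L).
Local Notation inQ := (fun x => x in Q).
Local Notation leL := (fun x y => pair Mo x y in L).

Lemma qo_dom x y : pair Mo x y in L -> x in Q /\ y in Q.
Proof. by case: HQ => H _ /H [x' [y' [/pair_inj [-> ->] [H1 H2]]]]. Qed.

Lemma qo_refl x : x in Q -> pair Mo x x in L.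
Proof. by case: HQ => _ [H _]; apply: H. Qed.

Lemma qo_trans y x z : pair Mo x y in L -> pair Mo y z in L -> pair Mo x z in L.
Proof.
  move=> H1 H2; case: (qo_dom _ _ H1) => Hx Hy; case: (qo_dom _ _ H2) => _ Hz.
  by case: HQ => _ [_ H]; apply: (H x y z).
Qed.

Lemma flat_le_refl a : pfin Mo inQ a -> flat_le leL a a.
Proof. by move=> [_ Ha] x Hx; exists x; split=> //; apply: qo_refl; apply: Ha. Qed.

Lemma flat_le_trans b a c : flat_le leL a b -> flat_le leL b c -> flat_le leL a c.
Proof.
  move=> H1 H2 x /H1 [y [/H2 [z [Hz Hyz]] Hxy]]; exists z; split=> //.
  exact: qo_trans Hxy Hyz.
Qed.

Hypothesis HN : Sigma1Complement.
Hypothesis HG : good inQ leL.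

Let HinQ : IsDelta1 (fun e => (fun x => x in Q) (e 0%nat)).
Proof. by delta1. Qed.
Let HleL : IsDelta1 (fun e => (fun x y => pair Mo x y in L) (e 0%nat) (e 1%nat)).
Proof. by delta1. Qed.
Let HPf : IsDelta1 (fun e => pfin Mo inQ (e 0%nat)).
Proof. exact: pfin_delta1. Qed.
Let Hfle : IsDelta1 (fun e => flat_le leL (e 0%nat) (e 1%nat)).
Proof. exact: flat_le_delta1. Qed.
Let HGflat : good (pfin Mo inQ) (flat_le leL).
Proof. exact: flat_good. Qed.
Let Heq : IsDelta1 (fun e => e 0%nat = e 1%nat).
Proof. by delta1. Qed.

Lemma forward_alexandroff : alex_noetherian Mo (flat Mo ord).
Proof.
  apply/cnoetherian_noetherian.
  apply: (noetherian_of_good HN _ _ _ (pfin Mo inQ) (flat_le leL) eq (fun p c => flat_le leL c p)) => //.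
  - move=> p Hp; apply: (delta1_ext (fun e => flat_le leL (e 0%nat) p)); last by delta1.
    move=> e; split; last by move=> [_ [q [-> H]]].
    by move=> H; split=> //; exists (e 0%nat).
  - by move=> i c Hi <-.
  - move=> p i Hp Hi; split; first by move=> [_ [q [-> H]]]; exists i.
    by move=> [c [<- H]]; split=> //; exists i.
  - by move=> p c c' _ _ _; apply: flat_le_trans.
Qed.

Lemma forward_upper_flat : upper_noetherian Mo (flat Mo ord).
Proof.
  apply/cnoetherian_noetherian.
  have HPP : IsDelta1 (fun e => pfin Mo (pfin Mo inQ) (e 0%nat)) by apply: pfin_delta1.
  have Hff : IsDelta1 (fun e => flat_le (flat_le leL) (e 0%nat) (e 1%nat)) by apply: flat_le_delta1.
  pose W x c := ~ downward Mo (flat Mo ord) (fun z => elt Mo z c) x.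
  apply: (noetherian_of_good HN _ _ _ (pfin Mo (pfin Mo inQ)) (flat_le (flat_le leL)) eq W) => //.
  - move=> p Hp; apply: (delta1_ext (fun e => pfin Mo inQ p /\
      ~ (pfin Mo inQ p /\ exists b, elt Mo b (e 0%nat) /\ flat_le leL p b))) => //; by delta1.
  - by apply: flat_good.
  - by move=> i c Hi <-.
  - move=> p i Hp Hi; split; first by move=> [_ H]; exists i.
    by move=> [c [<- H]].
  - move=> p c c' Hp _ _ Hcc H [_ [b [Hb Hpb]]]; apply: H; split=> //.
    case: (Hcc b Hb) => b' [Hb' Hbb]; exists b'; split=> //; exact: flat_le_trans Hpb Hbb.
Qed.

(** The complement of a finitely generated down-set for the order [sharp] is a union:
    a point is not below any member [b] of [i] iff there is a set [c] that meets each [b], and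
    none of whose elements is above an element of the point. *)
Lemma forward_upper_sharp : upper_noetherian Mo (sharp Mo ord).
Proof.
  apply/cnoetherian_noetherian.
  pose T i c := pfin Mo inQ c /\ forall b, elt Mo b i -> exists y, elt Mo y b /\ elt Mo y c.
  pose W x c := forall y, elt Mo y c -> forall a, elt Mo a x -> ~ pair Mo a y in L.
  apply: (noetherian_of_good HN _ _ _ (pfin Mo inQ) (flat_le leL) T W) => //.
  - move=> p Hp; apply: (delta1_ext (fun e => pfin Mo inQ p /\
      ~ (pfin Mo inQ p /\ exists b, elt Mo b (e 0%nat) /\ forall y, elt Mo y b ->
         exists x, elt Mo x p /\ pair Mo x y in L))) => //; by delta1.
  - rewrite /T; by delta1.
  - by move=> i c _ [].
  - move=> p i Hp Hi; split; last first.
      move=> [c [[Hc1 Hc2] HW]]; split=> // -[_ [b [Hb Hpb]]].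
      case: (Hc2 b Hb) => y [Hyb Hyc]; case: (Hpb y Hyb) => x [Hx Hxy].
      exact: (HW y Hyc x Hx).
    move=> [_ H].
    case: (finite_set (fun y => (exists b, elt Mo b i /\ elt Mo y b) /\
      forall a, elt Mo a p -> ~ pair Mo a y in L) i); first by delta1.
    move=> c [Hc Ec]; exists c; split; last by move=> y /Ec [_ []].
    split; first by split=> // y /Ec [_ [[b [Hb Hy]] _]]; apply: (proj2 (proj2 Hi b Hb)).
    move=> b Hb; apply: NNPP => Hno; apply: H; split=> //; exists b; split=> // y Hy.
    apply: NNPP => Hno'; apply: Hno; exists y; split=> //; apply/Ec; split.
      exact: lt_trans (elt_lt _ _ Hy) (elt_lt _ _ Hb).
    split; first by exists b.
    by move=> a Ha Hay; apply: Hno'; exists a.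
  - move=> p c c' _ _ _ Hcc HW y Hy a Ha Hay.
    case: (Hcc y Hy) => y' [Hy' Hyy]; apply: (HW y' Hy' a Ha); exact: qo_trans Hay Hyy.
Qed.

Lemma forward_P_flat : flat_noetherian Mo ord.
Proof.
  apply: (noetherian_of_good HN _ _ _ (pfin Mo inQ) (flat_le leL) eq
    (fun X i => forall x, elt Mo x i -> downward Mo ord (fun z => z in X) x)) => //.
  - move=> X HX; apply: (delta1_ext (fun e => forall x, elt Mo x (e 0%nat) ->
      x in Q /\ exists z, z in X /\ pair Mo x z in L)) => //; by delta1.
  - by move=> i c Hi <-.
  - by move=> p i Hp Hi; split; [move=> H; exists i|move=> [c [<- H]]].
  - move=> X c c' _ _ _ Hcc H x /Hcc [y [/H [_ [z [Hz Hyz]]] Hxy]].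
    split; first by case: (qo_dom _ _ Hxy).
    exists z; split=> //; exact: qo_trans Hxy Hyz.
Qed.

Lemma forward_P_sharp : sharp_noetherian Mo ord.
Proof.
  apply: (noetherian_of_good HN _ _ _ (pfin Mo inQ) (flat_le leL) eq
    (fun X i => ~ exists x, elt Mo x i /\ upward Mo ord (fun z => z in X) x)) => //.
  - move=> X HX; apply: (delta1_ext (fun e => ~ exists x, elt Mo x (e 0%nat) /\
      (x in Q /\ exists z, z in X /\ pair Mo z x in L))) => //; by delta1.
  - by move=> i c Hi <-.
  - by move=> p i Hp Hi; split; [move=> H; exists i|move=> [c [<- H]]].
  - move=> X c c' _ _ _ Hcc H [x [/Hcc [y [Hy Hxy]] [_ [z [Hz Hzx]]]]].
    apply: H; exists y; split=> //; split; first by case: (qo_dom _ _ Hxy).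
    exists z; split=> //; exact: qo_trans Hzx Hxy.
Qed.

End QuasiOrder.

(** * Failures of the Noetherian property *)

Lemma singleton_function : exists sing : M -> M, Delta1Fun (fun e => sing (e 0%nat)) /\
  forall x, fincoded Mo (sing x) /\ forall y, elt Mo y (sing x) <-> y = x.
Proof.
  case: (least_value (fun x c => fincoded Mo c /\ elt Mo x c /\
    forall y, y < c -> elt Mo y c -> y = x)); first by delta1.
    move=> x; case: (finite_set (fun y => y = x) (x + 1)); first by delta1.
    move=> c [Hc Ec]; exists c; split=> //; split; first by apply/Ec; split=> //; exact: lt_succ.
    by move=> y _ /Ec [].
  move=> sing [Hs HS]; exists sing; split=> // x; case: (HS x) => -[H1 [H2 H3]] _.
  split=> // y; split; last by move->.
  by move=> Hy; apply: H3 => //; apply: elt_lt.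
Qed.

Lemma image_function (f : M -> M) : Delta1Fun (fun e => f (e 0%nat)) ->
  exists img : M -> M, Delta1Fun (fun e => img (e 0%nat)) /\
    forall a, fincoded Mo (img a) /\
      forall z, elt Mo z (img a) <-> exists y, elt Mo y a /\ z = f y.
Proof.
  move=> Hf.
  case: (least_value (fun a c => fincoded Mo c /\
    (forall z, z < c -> elt Mo z c -> exists y, y < a /\ elt Mo y a /\ z = f y) /\
    forall y, y < a -> elt Mo y a -> elt Mo (f y) c)); first by delta1.
    move=> a; case: (sigma1_collection (fun y z => z = f y) a); first by apply: delta1_sigma1; delta1.
      by move=> y _; exists (f y).
    move=> w Hw.
    case: (finite_set (fun z => exists y, y < a /\ elt Mo y a /\ z = f y) w); first by delta1.
    move=> c [Hc Ec]; exists c; split=> //; split; first by move=> z _ /Ec [].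
    move=> y Hy Hya; apply/Ec; split; last by exists y.
    by case: (Hw y Hy) => z [Hz <-].
  move=> img [Hi HI]; exists img; split=> // a; case: (HI a) => -[H1 [H2 H3]] _.
  split=> // z; split.
    by move=> Hz; case: (H2 z (elt_lt _ _ Hz) Hz) => y [_ Hy]; exists y.
  by move=> [y [Hy ->]]; apply: H3 => //; apply: elt_lt.
Qed.

(** The property is applied to the complements of the unions of the basic open sets with
    indices [i 0], ..., [i n]. *)
Lemma noetherian_stabilises {P : Type} (point : P -> Prop) (index : M -> Prop)
    (basic : P -> M -> Prop) (i : M -> M) :
  noetherian Mo point index basic -> Delta1Fun (fun e => i (e 0%nat)) -> (forall n, index (i n)) ->
  exists N, forall p, point p -> basic p (i (N + 1)) -> exists m, m <= N /\ basic p (i m).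
Proof.
  move=> HNoeth Hi Hidx.
  case: singleton_function => sing [Hs HS].
  pose G n k c := (k <= n /\ c = sing (i k)) \/ (n < k /\ c = sing (i n)).
  case: (delta_comprehension (fun p => exists n, n <= p /\ exists k, k <= p /\
    exists c, c <= p /\ p = pair Mo (pair Mo n k) c /\ G n k c)); first by rewrite /G; delta1.
  move=> g Hg.
  have Eg n k c : pair Mo (pair Mo n k) c in g <-> G n k c.
    rewrite Hg; split.
      by move=> [n' [_ [k' [_ [c' [_ [/pair_inj [/pair_inj [-> ->] ->] H]]]]]]].
    move=> H; exists n; split.
      by apply: le_trans (le_pair_l n k) (le_pair_l _ _).
    exists k; split; first by apply: le_trans (le_pair_r n k) (le_pair_l _ _).
    by exists c; split=> //; apply: le_pair_r.
  have Hsing x : index x -> pfin Mo index (sing x).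
    by move=> Hx; case: (HS x) => H1 H2; split=> // y /H2 ->.
  have HGP n k c : G n k c -> pfin Mo index c by move=> [[_ ->]|[_ ->]]; apply: Hsing.
  have Ecl n p : ingclosed Mo point basic g n p <->
      point p /\ forall m, m <= n -> ~ basic p (i m).
    split=> -[Hp H]; split=> //.
      move=> m Hm; apply: (H m (sing (i m))); first by apply/Eg; left.
      by apply/(proj2 (HS (i m))).
    move=> m c /Eg [[Hm ->]|[Hm ->]] x /(proj2 (HS _)) ->; apply: H => //; exact: le_refl.
  case: (HNoeth g).
  - split.
      move=> p /Hg [n [_ [k [_ [c [_ [-> /HGP Hc]]]]]]].
      by exists (pair Mo n k), c; split=> //; split=> //; exists n, k.
    move=> _ [n [k [-> _]]]; case: (le_or_lt k n) => H.
      exists (sing (i k)); split; first by apply/Eg; left.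
      by move=> z /Eg [[_ //]|[Hlt _]]; case: (proj2 (not_lt _ _) H Hlt).
    exists (sing (i n)); split; first by apply/Eg; right.
    by move=> z /Eg [[Hle _]|[_ //]]; case: (proj2 (not_lt _ _) Hle H).
  - move=> n p /Ecl [Hp H]; apply/Ecl; split=> // m Hm; apply: H.
    by left; apply/lt_succ_iff.
  - move=> N HN; exists N => p Hp Hb; apply: NNPP => Hno.
    have /Ecl [_ H] : ingclosed Mo point basic g (N + 1) p.
      apply/(HN _ (lt_succ N)); apply/Ecl; split=> // m Hm Hbm; apply: Hno; by exists m.
    exact: (H _ (le_refl _) Hb).
Qed.

Section Reversal.
Variables (Q L : sets Mo).
Hypothesis HW : iswqo Mo Q L.
Local Notation ord := (setorder Mo Q L).
Local Notation inQ := (fun x => x in Q).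
Local Notation leL := (fun x y => pair Mo x y in L).
Variable A : M -> M.
Hypothesis HA : Delta1Fun (fun e => A (e 0%nat)).
Hypothesis HAQ : forall n, pfin Mo inQ (A n).
Hypothesis Abad : forall m n, m < n -> ~ flat_le leL (A m) (A n).

Let HQ : quasiorder Mo Q L := proj1 HW.

Lemma bad_witness m n : m < n -> exists a, elt Mo a (A m) /\ a in Q /\
  forall y, elt Mo y (A n) -> ~ pair Mo a y in L.
Proof.
  move=> Hmn; apply: NNPP => Hno; case: (Abad m n Hmn) => a Ha.
  apply: NNPP => Hy; apply: Hno; exists a; split=> //; split.
    exact: (proj2 (HAQ m)).
  by move=> y Hya Hay; apply: Hy; exists y.
Qed.

(** The point that belongs to a new basic open set is [A (N + 1)] itself. *)
Lemma not_alexandroff : ~ alex_noetherian Mo (flat Mo ord).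
Proof.
  move=> /cnoetherian_noetherian H.
  case: (noetherian_stabilises _ _ _ A H HA HAQ) => N HN.
  case: (HN (A (N + 1)) (HAQ _)).
    split; first exact: HAQ.
    by exists (A (N + 1)); split=> //; apply: (flat_le_refl Q L HQ); apply: HAQ.
  by move=> m [/lt_succ_iff Hm [_ [q [-> H']]]]; apply: (Abad _ _ Hm).
Qed.

Lemma not_P_flat : ~ flat_noetherian Mo ord.
Proof.
  move=> H; case: (noetherian_stabilises _ _ _ A H HA HAQ) => N HN.
  case: (delta_comprehension (fun x => elt Mo x (A (N + 1)))); first by delta1.
  move=> X HX; case: (HN X).
  - by move=> x /HX Hx; apply: (proj2 (HAQ (N + 1))).
  - move=> x Hx; have HxQ : x in Q by apply: (proj2 (HAQ (N + 1))).
    by split=> //; exists x; split; [apply/HX|apply: (qo_refl Q L HQ)].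
  - move=> m [/lt_succ_iff Hm H']; apply: (Abad _ _ Hm) => x /H' [_ [y [/HX Hy Hxy]]].
    by exists y.
Qed.

(** The separating point is the set of all elements of [Q] that are below no element of
    [A (N + 1)]. *)
Lemma not_P_sharp : ~ sharp_noetherian Mo ord.
Proof.
  move=> H; case: (noetherian_stabilises _ _ _ A H HA HAQ) => N HN.
  case: (delta_comprehension (fun x => x in Q /\ forall y, y < A (N + 1) ->
    elt Mo y (A (N + 1)) -> ~ pair Mo x y in L)); first by delta1.
  move=> X HX; case: (HN X).
  - by move=> x /HX [].
  - by move=> [x [Hx [_ [z [/HX [_ Hz] Hzx]]]]]; apply: (Hz x) => //; apply: elt_lt.
  - move=> m [/lt_succ_iff Hm H']; case: (bad_witness _ _ Hm) => a [Ha [HaQ Hay]].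
    apply: H'; exists a; split=> //; split=> //; exists a; split; last exact: (qo_refl Q L HQ).
    by apply/HX; split=> // y _; apply: Hay.
Qed.

(** As in [not_P_sharp], but the point has to be finite: only elements of the earlier sets
    [A m] are taken.  The index for [A n] consists of the singletons of its elements. *)
Lemma not_upper_sharp : ~ upper_noetherian Mo (sharp Mo ord).
Proof.
  move=> /cnoetherian_noetherian H.
  case: singleton_function => sing [Hs HS].
  case: (image_function sing Hs) => img [Him HI].
  have Hidx n : pfin Mo (pfin Mo inQ) (img (A n)).
    case: (HI (A n)) => H1 H2; split=> // z /H2 [y [Hy ->]]; case: (HS y) => H3 H4.
    by split=> // x /H4 ->; apply: (proj2 (HAQ n)).
  case: (noetherian_stabilises _ _ _ (fun n => img (A n)) H _ Hidx); first by delta1fun.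
  move=> N HN.
  case: (sigma1_collection (fun m w => w = A m) (N + 1)); first by apply: delta1_sigma1; delta1.
    by move=> m _; exists (A m).
  move=> w Hw.
  case: (finite_set (fun x => (exists m, m <= N /\ elt Mo x (A m)) /\
    forall y, y < A (N + 1) -> elt Mo y (A (N + 1)) -> ~ pair Mo x y in L) w); first by delta1.
  move=> x [Hx Ex].
  have HxQ : pfin Mo inQ x.
    by split=> // y /Ex [_ [[m [_ Hy]] _]]; apply: (proj2 (HAQ m)).
  case: (HN x HxQ).
    split=> // -[_ [b [/(proj2 (HI _)) [y [Hy ->]] Hxy]]].
    case: (Hxy y); first by apply/(proj2 (HS y)).
    by move=> a [/Ex [_ [_ Ha]] Hay]; apply: (Ha y) => //; apply: elt_lt.
  move=> m [Hm [_ H']]; apply: H'; split=> //.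
  have Hm' : m < N + 1 by apply/lt_succ_iff.
  case: (bad_witness _ _ Hm') => a [Ha [HaQ Hay]].
  exists (sing a); split; first by apply/(proj2 (HI _)); exists a.
  move=> y /(proj2 (HS a)) ->; exists a; split; last exact: (qo_refl Q L HQ).
  apply/Ex; split; first by case: (Hw m Hm') => z [Hz E]; rewrite E in Hz; apply: lt_trans (elt_lt _ _ Ha) Hz.
  split; first by exists m.
  by move=> y' _; apply: Hay.
Qed.

(** To the copies [(0, a)] of the elements of [Q] are added elements [(1, a)], placed above
    exactly those [(0, b)] for which [b] is not above [a].  Then the principal up-sets of
    [Q] are complements of traces of principal down-sets. *)
Definition dual_le (x y : M) : Prop :=
  exists i, i <= x /\ exists a, a <= x /\ exists j, j <= y /\ exists b, b <= y /\
    x = pair Mo i a /\ y = pair Mo j b /\ a in Q /\ b in Q /\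
    ((i = 0 /\ j = 0 /\ pair Mo a b in L) \/ (i = 0 /\ j = 1 /\ ~ pair Mo b a in L) \/
     (i = 1 /\ j = 1 /\ pair Mo a b in L)).

Lemma dual_le_pair i a j b : dual_le (pair Mo i a) (pair Mo j b) <->
  a in Q /\ b in Q /\
    ((i = 0 /\ j = 0 /\ pair Mo a b in L) \/ (i = 0 /\ j = 1 /\ ~ pair Mo b a in L) \/
     (i = 1 /\ j = 1 /\ pair Mo a b in L)).
Proof.
  split; first by move=> [i' [_ [a' [_ [j' [_ [b' [_ [/pair_inj [-> ->] [/pair_inj [-> ->] H]]]]]]]]]].
  move=> H; exists i; split; first exact: le_pair_l.
  exists a; split; first exact: le_pair_r.
  exists j; split; first exact: le_pair_l.
  by exists b; split; first exact: le_pair_r.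
Qed.

Lemma dual_extension : exists Q' L', iswqo Mo Q' L' /\
  (forall i a, pair Mo i a in Q' <-> (i = 0 \/ i = 1) /\ a in Q) /\
  forall i a j b, pair Mo (pair Mo i a) (pair Mo j b) in L' <->
    a in Q /\ b in Q /\
    ((i = 0 /\ j = 0 /\ pair Mo a b in L) \/ (i = 0 /\ j = 1 /\ ~ pair Mo b a in L) \/
     (i = 1 /\ j = 1 /\ pair Mo a b in L)).
Proof.
  case: (delta_comprehension (fun x => exists i, i <= x /\ exists a, a <= x /\
    x = pair Mo i a /\ (i = 0 \/ i = 1) /\ a in Q)); first by delta1.
  move=> Q' HQ'.
  have EQ' i a : pair Mo i a in Q' <-> (i = 0 \/ i = 1) /\ a in Q.
    rewrite HQ'; split; first by move=> [i' [_ [a' [_ [/pair_inj [-> ->] H]]]]].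
    move=> H; exists i; split; first exact: le_pair_l.
    by exists a; split; first exact: le_pair_r.
  case: (delta_comprehension (fun p => exists x, x <= p /\ exists y, y <= p /\
    p = pair Mo x y /\ dual_le x y)); first by rewrite /dual_le; delta1.
  move=> L' HL'.
  have EL x y : pair Mo x y in L' <-> dual_le x y.
    rewrite HL'; split; first by move=> [x' [_ [y' [_ [/pair_inj [-> ->] H]]]]].
    move=> H; exists x; split; first exact: le_pair_l.
    by exists y; split; first exact: le_pair_r.
  have EL' i a j b := iff_trans (EL (pair Mo i a) (pair Mo j b)) (dual_le_pair i a j b).
  have in01 : (0 : M) <> 1 by move=> E; apply: one_neq_0.
  exists Q', L'; split=> //; apply/iswqo_good; split.
  { split; [|split].
    - move=> p /HL' [x [_ [y [_ [-> [i [_ [a [_ [j [_ [b [_ [-> [-> [Ha [Hb H]]]]]]]]]]]]]]]]].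
      exists (pair Mo i a), (pair Mo j b); split=> //; split; apply/EQ'; split=> //; tauto.
    - move=> x Hx; have /HQ' [i [_ [a [_ [E [Hi Ha]]]]]] := Hx; rewrite E; apply/EL'.
      split=> //; split=> //; have := qo_refl Q L HQ a Ha; tauto.
    - move=> x y z /HQ' [i [_ [a [_ [-> [Hi Ha]]]]]] /HQ' [j [_ [b [_ [-> [Hj Hb]]]]]].
      move=> /HQ' [k [_ [c [_ [-> [Hk Hc]]]]]] /EL' [_ [_ H1]] /EL' [_ [_ H2]].
      apply/EL'; split=> //; split=> //.
      case: H1 => [[Ei [Ej H1]]|[[Ei [Ej H1]]|[Ei [Ej H1]]]];
      case: H2 => [[Ej' [Ek H2]]|[[Ej' [Ek H2]]|[Ej' [Ek H2]]]];
        try by case: in01; rewrite -Ej -Ej'.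
      + by left; split=> //; split=> //; apply: (qo_trans Q L HQ) H1 H2.
      + by right; left; split=> //; split=> // H3; apply: H2; apply: (qo_trans Q L HQ) H3 H1.
      + by right; left; split=> //; split=> // H3; apply: H1; apply: (qo_trans Q L HQ) H2 H3.
      + by right; right; split=> //; split=> //; apply: (qo_trans Q L HQ) H1 H2. }
  move=> g Hg HgQ.
  case: (pair_split g Hg).
    by move=> n; case/HQ': (HgQ n) => i [_ [a [_ [E _]]]]; exists i, a.
  move=> u [v [Hu [Hv E]]].
  have Huv n : (u n = 0 \/ u n = 1) /\ v n in Q by apply/EQ'; rewrite -E; apply: HgQ.
  have [i [Hi Hinf]] : exists i, (i = 0 \/ i = 1) /\ forall x, exists y, x < y /\ u y = i.
    case: (classic (forall x, exists y, x < y /\ u y = 0)) => H0.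
      by exists 0; split; first by left.
    exists 1; split; first by right.
    move=> x; apply: NNPP => H1; apply: H0 => x'; exists (x + x' + 1); split.
      by apply/lt_succ_iff; apply: le_add_r.
    case: (proj1 (Huv (x + x' + 1))) => // Eu; case: H1; exists (x + x' + 1); split=> //.
    by apply/lt_succ_iff; apply: le_add_l.
  case: (subsequence (fun x y => u y = i) 0); [by delta1|done|].
  move=> s [Hs [_ [Hmono HR]]].
  case: (proj1 (iswqo_good Q L) HW) => _ HG.
  case: (HG (fun n => v (s (n + 1)))); first by delta1fun.
    by move=> n; case: (Huv (s (n + 1))).
  move=> m [n [Hmn Hle]]; exists (s (m + 1)), (s (n + 1)); split.
    by apply: Hmono; apply: lt_add_r.
  rewrite !E; apply/EL'; split; first by case: (Huv (s (m + 1))).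
  split; first by case: (Huv (s (n + 1))).
  by rewrite !HR; case: Hi => ->; [left|right; right].
Qed.

(** If [a] is in [A m] then [A (N + 1)] is below the singleton of [(1, a)] iff none of its
    elements is above [a]; so the new elements turn the failure of
    [flat_le (A m) (A (N + 1))] into membership in the down-set generated by the index for [m]. *)
Lemma not_upper_flat : exists Q' L', iswqo Mo Q' L' /\
  ~ upper_noetherian Mo (flat Mo (setorder Mo Q' L')).
Proof.
  case: dual_extension => Q' [L' [HW' [EQ' EL']]]; exists Q', L'; split=> //.
  move=> /cnoetherian_noetherian H.
  case: singleton_function => sing [Hs HS].
  case: (image_function (fun a => sing (pair Mo 1 a))); first by delta1fun.
  move=> img [Him HI].
  case: (image_function (fun a => pair Mo 0 a)); first by delta1fun.
  move=> copy [Hcopy HC].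
  pose inQ' x := x in Q'.
  have Hidx n : pfin Mo (pfin Mo inQ') (img (A n)).
    case: (HI (A n)) => H1 H2; split=> // z /H2 [y [Hy ->]]; case: (HS (pair Mo 1 y)) => H3 H4.
    split=> // x /H4 ->; apply/EQ'; split; [by right|exact: (proj2 (HAQ n))].
  case: (noetherian_stabilises _ _ _ (fun n => img (A n)) H _ Hidx); first by delta1fun.
  move=> N HN.
  have Hp : pfin Mo inQ' (copy (A (N + 1))).
    case: (HC (A (N + 1))) => H1 H2; split=> // z /H2 [y [Hy ->]].
    apply/EQ'; split; [by left|exact: (proj2 (HAQ (N + 1)))].
  case: (HN _ Hp).
    split=> // -[_ [b [/(proj2 (HI _)) [a [Ha ->]] Hpb]]].
    have HaQ : a in Q by apply: (proj2 (HAQ (N + 1))).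
    case: (Hpb (pair Mo 0 a)); first by apply/(proj2 (HC _)); exists a.
    move=> y [/(proj2 (HS _)) -> /EL' [_ [_ H']]].
    have in01 : (0 : M) <> 1 by move=> E; apply: one_neq_0.
    case: H' => [[_ [E _]]|[[_ [_ H']]|[/in01 []]]]; first by case: in01.
    by apply: H'; apply: (qo_refl Q L HQ).
  move=> m [/lt_succ_iff Hm [_ H']]; apply: H'; split=> //.
  case: (bad_witness _ _ Hm) => a [Ha [HaQ Hay]].
  exists (sing (pair Mo 1 a)); split; first by apply/(proj2 (HI _)); exists a.
  move=> x /(proj2 (HC _)) [y [Hy ->]]; exists (pair Mo 1 a); split; first by apply/(proj2 (HS _)).
  apply/EL'; split; first exact: (proj2 (HAQ (N + 1))).
  by split=> //; right; left; split=> //; split=> //; apply: Hay.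
Qed.

End Reversal.

(** * True stages *)

Section TrueStages.
Variable f : M -> M.
Hypothesis Hf : Delta1Fun (fun e => f (e 0%nat)).
Hypothesis Hinj : forall m n, f m = f n -> m = n.

Definition dead (j n : M) : Prop := 0 < j /\ exists k, k <= n /\ j < k /\ f k < f j.
Definition true_stage (j : M) : Prop := forall n, ~ dead j n.

Lemma dead_delta1 : IsDelta1 (fun e => dead (e 0%nat) (e 1%nat)).
Proof. rewrite /dead; by delta1. Qed.
Hint Resolve dead_delta1 : definable.

Lemma dead_mono j n n' : n <= n' -> dead j n -> dead j n'.
Proof.
  by move=> H [H0 [k [Hk Hjk]]]; split=> //; exists k; split=> //; apply: le_trans Hk H.
Qed.

(** The stages that look true at [n] form a stack: if one of them dies, then so do all
    those above it, because their values are larger. *)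
Lemma dead_above j j' n : j < j' -> ~ dead j j' -> dead j n -> dead j' n.
Proof.
  move=> Hjj Hn [H0 [k [Hk [Hjk Hfk]]]].
  have Hj'k : j' < k.
    by apply/not_le => H; apply: Hn; split=> //; exists k.
  split; first exact: lt_trans H0 Hjj.
  exists k; split=> //; split=> //; apply: lt_le_trans Hfk _; apply/not_lt => H.
  by apply: Hn; split=> //; exists j'; split; first exact: le_refl.
Qed.

(** A stage after [b] with the least value that [f] takes after [b] is true. *)
Lemma true_stages_unbounded b : exists t, b < t /\ true_stage t.
Proof.
  case: (sigma1_least (fun v => exists k, b < k /\ f k = v)); first by apply: sigma1_ex; sigma1.
    by exists (f (b + 1)), (b + 1); split=> //; apply: lt_succ.
  move=> v [[t [Hbt Et]] Hmin]; exists t; split=> // n [_ [k [_ [Htk Hfk]]]].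
  apply: (Hmin (f k)); first by rewrite -Et.
  by exists k; split=> //; apply: lt_trans Hbt Htk.
Qed.

(** The stage [s] witnesses that [j] is not the greatest stage that looks true both at [m]
    and at [n].  The condition [j = j'] is what makes the relation transitive. *)
Definition stage_le (j m j' n : M) : Prop :=
  (j = j' /\ m = n) \/ (m < n /\ (dead j n \/
    (j = j' /\ exists s, s <= m /\ j < s /\ ~ dead s m /\ ~ dead s n))).

Lemma stage_le_trans j m j' n j'' p : stage_le j m j' n -> stage_le j' n j'' p ->
  stage_le j m j'' p.
Proof.
  move=> [[-> ->]//|[Hmn H1]] [[<- <-]|[Hnp H2]]; first by right.
  right; split; first exact: lt_trans Hmn Hnp.
  case: H1 => [H1|[Ej [s [Hsm [Hjs [Hm Hn]]]]]]; first by left; apply: dead_mono H1; left.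
  case: H2 => [H2|[Ej' [s' [Hsn [Hjs' [Hn' Hp']]]]]]; first by left; rewrite Ej.
  right; split; first by rewrite Ej.
  case: (classic (dead s p)) => Hsp; last by exists s.
  exists s'; split; last first.
    split; first by rewrite Ej.
    by split=> // H; apply: Hn'; apply: dead_mono H; left.
  case: (lt_total s s') => [Hss|[Ess|Hss]].
  - case: Hp'; apply: (dead_above s) => //.
    by move=> H; apply: Hn; apply: dead_mono H.
  - by rewrite -Ess.
  - by left; apply: lt_le_trans Hss Hsm.
Qed.

Definition in_order (x : M) : Prop :=
  exists j, j <= x /\ exists m, m <= x /\ x = pair Mo j m /\ j <= m /\ ~ dead j m.
Definition order_le (x y : M) : Prop :=
  exists j, j <= x /\ exists m, m <= x /\ exists j', j' <= y /\ exists n, n <= y /\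
    x = pair Mo j m /\ y = pair Mo j' n /\ stage_le j m j' n.

Lemma in_order_pair j m : in_order (pair Mo j m) <-> j <= m /\ ~ dead j m.
Proof.
  split; first by move=> [j' [_ [m' [_ [/pair_inj [-> ->] H]]]]].
  move=> H; exists j; split; first exact: le_pair_l.
  by exists m; split; first exact: le_pair_r.
Qed.

Lemma order_le_pair j m j' n : order_le (pair Mo j m) (pair Mo j' n) <-> stage_le j m j' n.
Proof.
  split.
    by move=> [a [_ [b [_ [c [_ [d [_ [/pair_inj [-> ->] [/pair_inj [-> ->] H]]]]]]]]]].
  move=> H; exists j; split; first exact: le_pair_l.
  exists m; split; first exact: le_pair_r.
  exists j'; split; first exact: le_pair_l.
  by exists n; split; first exact: le_pair_r.
Qed.

Lemma in_order_delta1 : IsDelta1 (fun e => in_order (e 0%nat)).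
Proof. rewrite /in_order; by delta1. Qed.
Lemma order_le_delta1 : IsDelta1 (fun e => order_le (e 0%nat) (e 1%nat)).
Proof. rewrite /order_le /stage_le; by delta1. Qed.
Hint Resolve in_order_delta1 order_le_delta1 : definable.

Lemma stack_function : exists A : M -> M, Delta1Fun (fun e => A (e 0%nat)) /\
  forall m, fincoded Mo (A m) /\
    forall z, elt Mo z (A m) <-> exists j, j <= m /\ z = pair Mo j m /\ ~ dead j m.
Proof.
  case: (least_value (fun m c => fincoded Mo c /\
    (forall z, z < c -> elt Mo z c -> exists j, j <= m /\ z = pair Mo j m /\ ~ dead j m) /\
    forall j, j <= m -> ~ dead j m -> elt Mo (pair Mo j m) c)); first by delta1.
    move=> m; case: (finite_set (fun z => exists j, j <= m /\ z = pair Mo j m /\ ~ dead j m)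
      (pair Mo m m + 1)); first by delta1.
    move=> c [Hc Ec]; exists c; split=> //; split; first by move=> z _ /Ec [].
    move=> j Hj Hd; apply/Ec; split; last by exists j.
    by apply/lt_succ_iff; apply: le_pair_mono => //; apply: le_refl.
  move=> A [HA HA']; exists A; split=> // m; case: (HA' m) => -[H1 [H2 H3]] _.
  split=> // z; split; first by move=> Hz; apply: H2 => //; apply: elt_lt.
  by move=> [j [Hj [-> Hd]]]; apply: H3.
Qed.

Lemma greatest (P : M -> Prop) b : IsDelta1 (fun e => P (e 0%nat)) -> P 0 ->
  exists x, x <= b /\ P x /\ forall y, y <= b -> x < y -> ~ P y.
Proof.
  move=> HP H0.
  case: (sigma1_least (fun u => exists x, x <= b /\ x + u = b /\ P x)); first by apply: delta1_sigma1; delta1.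
    by exists b, 0; split; [apply: le_0|split=> //; ring].
  move=> u [[x [Hx [Eu HPx]]] Hmin]; exists x; split=> //; split=> // y Hy Hxy HPy.
  case/le_iff: (Hy) => w Ew; apply: (Hmin w); last by exists y.
  apply: (lt_add_cancel _ _ x); rewrite (addC u) Eu Ew addC; exact: lt_add_r.
Qed.

Section BadSequence.
Variables (g : M -> M).
Hypothesis Hg : Delta1Fun (fun e => g (e 0%nat)).
Hypothesis HgD : forall n, in_order (g n).
Hypothesis Hbad : forall m n, m < n -> ~ order_le (g m) (g n).

(** Bad sequences are injective, so that the second components can be made to
    increase.  If then a first component were to die, the term would be below a later
    one; hence all of them are true.  If they were bounded, they would stay below some true stage
    [t]; then two terms with the same first component would be comparable, with [t] as
    witness, so these components would be distinct: this contradicts the pigeonhole principle. *)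
Lemma bad_sequence_true : exists t : M -> M, Delta1Fun (fun e => t (e 0%nat)) /\
  (forall n, true_stage (t n)) /\ forall m n, m < n -> t m < t n.
Proof.
  case: (pair_split g Hg).
    by move=> n; case: (HgD n) => j [_ [m [_ [E _]]]]; exists j, m.
  move=> u [v [Hu [Hv E]]].
  have Huv n : u n <= v n /\ ~ dead (u n) (v n) by apply/in_order_pair; rewrite -E.
  have Hbd m n : m < n -> ~ stage_le (u m) (v m) (u n) (v n).
    by move=> Hmn; rewrite -order_le_pair -!E; apply: Hbad.
  case: (subsequence (fun x y => v x < v y) 0); first by delta1.
    move=> x.
    have Hh : Delta1Fun (fun e => pair Mo (u (x + 1 + e 0%nat)) (v (x + 1 + e 0%nat))) by delta1fun.
    have /= HI := injective_unbounded (fun i => pair Mo (u (x + 1 + i)) (v (x + 1 + i))) Hh.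
    case: (HI _ (pair Mo (v x) (v x) + 1)).
      move=> i j Hji /pair_inj [E1 E2].
      apply: (Hbd (x + 1 + j) (x + 1 + i)); last by left.
      by rewrite !(addC (x + 1)); apply: lt_add_r.
    move=> i /succ_le_iff Hi; exists (x + 1 + i); split.
      by apply: lt_le_trans (lt_succ x) (le_add_l _ _).
    apply/not_le => H; apply: (lt_irrefl (pair Mo (v x) (v x))); apply: lt_le_trans Hi _.
    by apply: le_pair_mono => //; apply: le_trans H; case: (Huv (x + 1 + i)).
  move=> s [Hs [_ [Hmono HR]]].
  pose J n := u (s n); pose V n := v (s n).
  have HJ : Delta1Fun (fun e => J (e 0%nat)) by rewrite /J; delta1fun.
  have HV : Delta1Fun (fun e => V (e 0%nat)) by rewrite /V; delta1fun.
  have Vmono : forall m n, m < n -> V m < V n by apply: increasing_mono.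
  have Vge : forall n, n <= V n by apply: increasing_ge.
  have Jtrue n : true_stage (J n).
    move=> p Hp; have Hn : n < n + p + 1 by apply/lt_succ_iff; apply: le_add_l.
    apply: (Hbd _ _ (Hmono _ _ Hn)); right; split; first exact: Vmono.
    left; apply: dead_mono Hp; apply: le_trans (Vge _).
    by apply/le_iff; exists (n + 1); ring.
  have Junb n0 : exists n, n0 < n /\ J n0 < J n.
    case: (true_stages_unbounded (J n0)) => t [Ht Htt].
    have Hh : Delta1Fun (fun e => J (n0 + t + 1 + e 0%nat)) by delta1fun.
    apply: NNPP => Hno.
    have HJle x : n0 < x -> J x <= J n0.
      by move=> Hx; apply/not_lt => H; apply: Hno; exists x.
    have /= HI := injective_unbounded (fun i => J (n0 + t + 1 + i)) Hh.
    case: (HI _ (J n0 + 1)); last first.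
      move=> i /succ_le_iff; apply/not_lt; apply: HJle.
      apply: lt_le_trans (le_add_l _ _); apply/lt_succ_iff; exact: le_add_l.
    move=> i j Hji EJ.
    have Hxy : n0 + t + 1 + j < n0 + t + 1 + i.
      by rewrite !(addC (n0 + t + 1)); apply: lt_add_r.
    apply: (Hbd _ _ (Hmono _ _ Hxy)); right; split; first exact: Vmono.
    right; split=> //; exists t; split; last first.
      split; last by split; apply: Htt.
      apply: le_lt_trans Ht; apply: HJle; apply: lt_le_trans (le_add_l _ _).
      by apply/lt_succ_iff; apply: le_add_l.
    apply: le_trans (Vge _); apply/le_iff; exists (n0 + 1 + j); ring.
  case: (subsequence (fun x y => J x < J y) 0); [by delta1|done|].
  move=> r [Hr [_ [rmono rR]]]; exists (fun n => J (r n)); split; [by delta1fun|split=> //].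
  by apply: increasing_mono => //; delta1fun.
Qed.

(** All values of [f] below its value at a true stage are taken before this stage, and the
    values at the true stages of the sequence are unbounded as [f] is injective. *)
Lemma range_decided : IsSigma1 (fun e => ~ exists n, f n = e 0%nat).
Proof.
  case: bad_sequence_true => t [Ht [Htrue Hmono]].
  have tpos n : 0 < t (n + 1).
    by apply: le_lt_trans (Hmono _ _ (lt_succ n)); apply: le_0.
  apply: (sigma1_ext (fun e => exists n, e 0%nat < f (t (n + 1)) /\
    forall k, k <= t (n + 1) -> f k <> e 0%nat)).
    move=> e; split.
      move=> [n [Hn Hk]] [k Ek]; case: (le_or_lt k (t (n + 1))) => H; first exact: Hk Ek.
      apply: (Htrue (n + 1) k); split=> //; exists k; split; first exact: le_refl.
      by split=> //; rewrite Ek.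
    move=> Hno.
    have Hh : Delta1Fun (fun e => f (t (e 0%nat + 1))) by delta1fun.
    have /= HI := injective_unbounded (fun i => f (t (i + 1))) Hh.
    case: (HI _ (e 0%nat + 1)).
      move=> i j Hji /Hinj Et; have := Hmono _ _ (lt_add_r _ _ 1 Hji).
      by rewrite Et; apply: lt_irrefl.
    move=> n /succ_le_iff Hn; exists n; split=> // k _ Ek; apply: Hno; by exists k.
  apply: (sigma1_ex (fun n e => e 0%nat < f (t (n + 1)) /\
    forall k, k <= t (n + 1) -> f k <> e 0%nat)).
  by apply: delta1_sigma1; delta1.
Qed.

End BadSequence.

Theorem range_or_bad :
  IsSigma1 (fun e => ~ exists n, f n = e 0%nat) \/
  exists Q L A, iswqo Mo Q L /\ Delta1Fun (fun e => A (e 0%nat)) /\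
    (forall n, pfin Mo (fun x => x in Q) (A n)) /\
    forall m n, m < n -> ~ flat_le (fun x y => pair Mo x y in L) (A m) (A n).
Proof.
  case: (classic (good in_order order_le)) => [HG|HnG]; last first.
    left; apply: NNPP => Hno; apply: HnG => g Hg HgD; apply: NNPP => Hb; apply: Hno.
    apply: (range_decided g) => // m n Hmn H; apply: Hb; by exists m, n.
  right.
  case: (delta_comprehension in_order in_order_delta1) => Q EQ.
  case: (delta_comprehension (fun p => exists x, x <= p /\ exists y, y <= p /\
    p = pair Mo x y /\ in_order x /\ in_order y /\ order_le x y)); first by delta1.
  move=> L EL.
  have EL' x y : pair Mo x y in L <-> in_order x /\ in_order y /\ order_le x y.
    rewrite EL; split; first by move=> [x' [_ [y' [_ [/pair_inj [-> ->] H]]]]].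
    move=> H; exists x; split; first exact: le_pair_l.
    by exists y; split; first exact: le_pair_r.
  case: stack_function => A [HA HA']; exists Q, L, A; split; last split=> //.
  { apply/iswqo_good; split.
    { split; [|split].
      + move=> p /EL [x [_ [y [_ [-> [Hx [Hy _]]]]]]].
        by exists x, y; split=> //; split; apply/EQ.
      + move=> x /EQ Hx; apply/EL'; split=> //; split=> //.
        case: Hx => j [_ [m [_ [-> _]]]]; apply/order_le_pair; by left.
      + move=> x y z _ _ _ /EL' [Hx [Hy H1]] /EL' [_ [Hz H2]]; apply/EL'; split=> //; split=> //.
        move: Hx Hy Hz H1 H2 => [j [_ [m [_ [-> _]]]]] [j' [_ [m' [_ [-> _]]]]].
        move=> [j'' [_ [m'' [_ [-> _]]]]] /order_le_pair H1 /order_le_pair H2.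
        apply/order_le_pair; exact: stage_le_trans H1 H2. }
    move=> g Hg HgQ; have HgD n : in_order (g n) by apply/EQ.
    case: (HG g Hg HgD) => m [n [Hmn H]]; exists m, n; split=> //; by apply/EL'. }
  have HAD m z : elt Mo z (A m) -> in_order z.
    by move=> /(proj2 (HA' m)) [j [Hj [-> Hd]]]; apply/in_order_pair.
  split; first by move=> n; split; [case: (HA' n)|move=> x /HAD /EQ].
  move=> m n Hmn H.
  case: (greatest (fun j => ~ dead j m /\ ~ dead j n) m).
  - by delta1.
  - by split; move=> [/lt_irrefl].
  - move=> j [Hj [[Hm Hn] Hmax]].
    case: (H (pair Mo j m)); first by apply/(proj2 (HA' m)); exists j.
    move=> y [/(proj2 (HA' n)) [j' [Hj' [-> _]]] /EL' [_ [_ /order_le_pair]]].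
    move=> [[_ Emn]|[_ [//|[_ [s [Hs [Hjs Hss]]]]]]]; last exact: Hmax Hjs Hss.
    by rewrite Emn in Hmn; case: (lt_irrefl n).
Qed.

End TrueStages.

Lemma double_inj (x y : M) : x + x = y + y -> x = y.
Proof.
  move=> E; case: (lt_total x y) => [/lt_iff [z Ez]|[//|/lt_iff [z Ez]]].
    case: (succ_neq_0 (z + z + 1)); apply: (add_cancel _ _ (x + x)).
    transitivity (y + y); [by rewrite Ez; ring|by rewrite -E; ring].
  case: (succ_neq_0 (z + z + 1)); apply: (add_cancel _ _ (y + y)).
  transitivity (x + x); [by rewrite Ez; ring|by rewrite E; ring].
Qed.

Lemma odd_even (x y : M) : x + x + 1 <> y + y.
Proof.
  move=> E; case: (le_or_lt y x) => [/le_iff [z Ez]|/lt_iff [z Ez]].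
    case: (succ_neq_0 (z + z)); apply: (add_cancel _ _ (y + y)).
    transitivity (x + x + 1); [by rewrite Ez; ring|by rewrite E; ring].
  case: (succ_neq_0 (z + z)); apply: (add_cancel _ _ (x + x + 1)).
  transitivity (y + y); [by rewrite Ez; ring|by rewrite -E; ring].
Qed.

(** The construction is applied to an injection whose odd values are the numbers
    [x + x + 1] with [P x]: only the code of [x] with its least witness gets this value, and
    any other [n] gets the value [n + n]. *)
Theorem no_bad_comprehension :
  (forall Q L A, iswqo Mo Q L -> Delta1Fun (fun e => A (e 0%nat)) ->
    (forall n, pfin Mo (fun x => x in Q) (A n)) ->
    ~ forall m n, m < n -> ~ flat_le (fun x y => pair Mo x y in L) (A m) (A n)) -> Sigma1Comprehension.
Proof.
  move=> Hno P HP; case: (HP) => [B [HB HPB]].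
  pose R x y := B (scons y (scons x (fun _ => 0))).
  have HR : IsDelta1 (fun e => R (e 0%nat) (e 1%nat)).
    apply: delta0_delta1.
    pose p i : nat + M := match i with 0%nat => inl 1%nat | 1%nat => inl 0%nat | _ => inr 0 end.
    apply: delta0_ext (delta0_sub p _ HB) => e.
    suff -> : (fun i => place e (p i)) = scons (e 1%nat) (scons (e 0%nat) (fun _ => 0)) by [].
    by apply: functional_extensionality; case=> [|[|i]].
  have EP x : P x <-> exists y, R x y by exact: (HPB (scons x (fun _ => 0))).
  pose least x y := R x y /\ forall y', y' < y -> ~ R x y'.
  have least_unique x y y' : least x y -> least x y' -> y = y'.
    move=> [H1 H2] [H3 H4]; case: (lt_total y y') => [H|[//|H]]; first by case: (H4 y).
    by case: (H2 y').
  have Hleast : IsDelta1 (fun e => least (e 0%nat) (e 1%nat)) by rewrite /least; delta1.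
  pose enum n v := (exists x, x <= n /\ exists y, y <= n /\ n = pair Mo x y /\ least x y /\
      v = x + x + 1) \/
    (~ (exists x, x <= n /\ exists y, y <= n /\ n = pair Mo x y /\ least x y) /\ v = n + n).
  case: (least_value enum); first by rewrite /enum; delta1.
    move=> n; case: (classic (exists x, x <= n /\ exists y, y <= n /\ n = pair Mo x y /\ least x y)).
      by move=> [x [Hx [y [Hy [E HL]]]]]; exists (x + x + 1); left; exists x; split=> //; exists y.
    by move=> H; exists (n + n); right.
  move=> f [Hf HF].
  have {}HF n : enum n (f n) by case: (HF n).
  have Hinj m n : f m = f n -> m = n.
  { move=> E; have := HF n; rewrite -E; move: (HF m).
    move=> [[x [_ [y [_ [-> [Hxy ->]]]]]]|[_ ->]] [[x' [_ [y' [_ [-> [Hxy' Ex]]]]]]|[_ En]].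
    - have Exx : x = x' by apply: double_inj; apply: add_cancel Ex.
      by rewrite -Exx in Hxy' *; rewrite (least_unique x y y').
    - by case: (odd_even _ _ En).
    - by case: (odd_even x' m).
    - exact: double_inj. }
  have Erange x : (exists n, f n = x + x + 1) <-> P x.
    split.
      move=> [n En]; case: (HF n); rewrite En; last by move=> [_ /odd_even].
      move=> [x' [_ [y [_ [_ [[HR' _] Ex]]]]]]; apply/EP; exists y.
      by have -> : x = x' by apply: double_inj; apply: add_cancel Ex.
    move=> /EP /(sigma1_least (R x)) [|y Hy]; first by apply: delta1_sigma1; delta1.
    exists (pair Mo x y); case: (HF (pair Mo x y)).
      by move=> [x' [_ [y' [_ [/pair_inj [<- _] [_ ->]]]]]].
    move=> [[]]; exists x; split; first exact: le_pair_l.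
    by exists y; split; first exact: le_pair_r.
  case: (range_or_bad f Hf Hinj) => [HS|[Q [L [A [H1 [H2 [H3 H4]]]]]]]; last first.
    by case: (Hno Q L A H1 H2 H3).
  apply: delta_comprehension; split=> //.
  apply: (sigma1_ext (fun e => ~ exists n, f n = e 0%nat + e 0%nat + 1)).
    by move=> e; rewrite Erange.
  apply: (sigma1_app (fun x _ => ~ exists n, f n = x)) => //; by delta1fun.
Qed.
End Arithmetic.

(** * The equivalence *)

Lemma no_bad_complement Mo (HM : models Mo RCA0) :
  (forall Q L A, iswqo Mo Q L -> Delta1Fun Mo (fun e => A (e 0)) ->
    (forall n, pfin Mo (fun x => smem Mo x Q) (A n)) ->
    ~ forall m n, slt Mo m n -> ~ flat_le Mo (fun x y => smem Mo (pair Mo x y) L) (A m) (A n)) ->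
  Sigma1Complement Mo.
Proof. by move=> H; apply: comprehension_complement => //; apply: no_bad_comprehension. Qed.

Theorem theorem4p7 :
  equivalent_over RCA0
    [ ACA0;
      for_all_wqo (fun Q => cNoetherian (Alexandroff (Pf_flat Q)));
      for_all_wqo (fun Q => cNoetherian (upper (Pf_flat Q)));
      for_all_wqo (fun Q => cNoetherian (upper (Pf_sharp Q)));
      for_all_wqo (fun Q => gNoetherian (upper_P_flat Q));
      for_all_wqo (fun Q => gNoetherian (upper_P_sharp Q)) ].
Proof.
  apply: equivalent_over_models.
  - exact: RCA0_subst_closed.
  - move=> U /= [<-|[<-|[<-|[<-|[<-|[<-|[]]]]]]]; first exact: ACA0_subst_closed.
    all: by apply: closed_subst_closed => f r; reflexivity.
  - move=> Mo HM U V HU HV HmU.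
    pose e (n : nat) := s0 Mo; pose d (n : nat) := sset Mo.
    have HN : Sigma1Complement Mo.
    { case: HU => [EU|[EU|[EU|[EU|[EU|[EU|[]]]]]]]; subst U.
      - exact: ACA0_complement.
      - have /sat_alex H := HmU _ eq_refl e d.
        apply: no_bad_complement => // Q L A HW HA HAQ Hbad.
        exact: (not_alexandroff Mo HM Q L HW A HA HAQ Hbad (H Q L HW)).
      - have /sat_upper_flat H := HmU _ eq_refl e d.
        apply: no_bad_complement => // Q L A HW HA HAQ Hbad.
        case: (not_upper_flat Mo HM Q L HW A HA HAQ Hbad) => Q' [L' [HW' Hn]].
        exact: Hn (H Q' L' HW').
      - have /sat_upper_sharp H := HmU _ eq_refl e d.
        apply: no_bad_complement => // Q L A HW HA HAQ Hbad.
        exact: (not_upper_sharp Mo HM Q L HW A HA HAQ Hbad (H Q L HW)).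
      - have /sat_upper_P_flat H := HmU _ eq_refl e d.
        apply: no_bad_complement => // Q L A HW HA HAQ Hbad.
        exact: (not_P_flat Mo HM Q L HW A HA HAQ Hbad (H Q L HW)).
      - have /sat_upper_P_sharp H := HmU _ eq_refl e d.
        apply: no_bad_complement => // Q L A HW HA HAQ Hbad.
        exact: (not_P_sharp Mo HM Q L HW A HA HAQ Hbad (H Q L HW)). }
    case: HV => [EV|[EV|[EV|[EV|[EV|[EV|[]]]]]]]; subst V; first exact: complement_ACA0.
    all: move=> _ -> {}e {}d.
    + apply/sat_alex => Q L /(iswqo_good Mo HM) [HQ HG]; exact: forward_alexandroff.
    + apply/sat_upper_flat => Q L /(iswqo_good Mo HM) [HQ HG]; exact: forward_upper_flat.
    + apply/sat_upper_sharp => Q L /(iswqo_good Mo HM) [HQ HG]; exact: forward_upper_sharp.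
    + apply/sat_upper_P_flat => Q L /(iswqo_good Mo HM) [HQ HG]; exact: forward_P_flat.
    + apply/sat_upper_P_sharp => Q L /(iswqo_good Mo HM) [HQ HG]; exact: forward_P_sharp.
Qed.
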